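(* Every knot has a potholder diagram. That is, for every knot $K$ in $\mathbb{R}^3$ there is an integer $n \ge 1$ such that $K$ is carried by the potholder curve $P_n$.
   Context: Knots are tame. All curves and diagrams are regular (immersed), with finitely many self-intersections, all of them transverse double points. A closed immersed planar curve $C$ carries a knot $K$ if some choice of over- and under-crossing arcs at every crossing point of $C$ yields a knot diagram of $K$. Potholder curve $P_n$: let $N = 2n+1$. Take $N$ horizontal segments (row $j$ on the line $y=j$, from $x=1/2$ to $x=N+1/2$, $1\le j\le N$) and $N$ vertical segments (column $i$ on the line $x=i$, from $y=1/2$ to $y=N+1/2$, $1\le i\le N$), giving $N^2$ crossing points. Join the ends by pairwise disjoint simple arcs lying outside the square, each one being a small cap between neighbouring ends, as follows: the right ends of rows $2j-1$ and $2j$ are joined, and the left ends of rows $2j$ and $2j+1$ are joined ($1\le j\le n$); the top ends of columns $2i-1$ and $2i$ are joined, and the bottom ends of columns $2i$ and $2i+1$ are joined ($1\le i\le n$); the left end of row $1$ is joined to the bottom end of column $1$ around the lower left corner; the right end of row $N$ is joined to the top end of column $N$ around the upper right corner. The result is one closed immersed curve with $(2n+1)^2$ crossings. A potholder diagram of $K$ is a diagram of $K$ whose underlying curve is some $P_n$. *)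

(* Defs.v *)
From HB Require Import structures.
From mathcomp Require Import all_boot all_order all_algebra.
From mathcomp Require Import all_classical all_reals all_analysis.

Set Implicit Arguments.
Unset Strict Implicit.
Unset Printing Implicit Defensive.

Import Order.TTheory GRing.Theory Num.Theory.
Import numFieldNormedType.Exports.

Local Open Scope classical_set_scope.
Local Open Scope ring_scope.

(* [fst : space R -> plane R] is the projection along which diagrams are drawn
   and [snd : space R -> R] is the height. *)
Notation plane R := (R * R)%type.
Notation space R := ((R * R) * R)%type.

Section Knots.
Context {R : realType}.

Definition simple_closed_curve (K : set (space R)) : Prop :=
  exists g : R -> space R,
    [/\ {within `[0, 1], continuous g}, g 0 = g 1,
        {in `[0, 1[ &, injective g} & K = g @` `[0, 1]].

Definition homeomorphism (f : space R -> space R) : Prop :=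
  continuous f /\
  exists g : space R -> space R, [/\ continuous g, cancel f g & cancel g f].

Definition ambient_isotopic (K L : set (space R)) : Prop :=
  exists F : R -> space R -> space R,
    [/\ {within `[0, 1] `*` [set: space R],
           continuous (fun p : R * space R => F p.1 p.2)},
        forall t, t \in `[0, 1] -> homeomorphism (F t),
        forall p, F 0 p = p
      & F 1 @` K = L].

Definition edge m (v : 'I_m -> space R) (i : 'I_m) (t : R) : space R :=
  (1 - t) *: v i + t *: v (ordS i).

(* [ordS] is the cyclic successor, so [v] lists the vertices of a closed
   polygon; half-open edges cover it without repetition, so that the second
   condition says exactly that it does not meet itself. *)
Definition polygonal_knot (K : set (space R)) : Prop :=
  exists (m : nat) (v : 'I_m.+1 -> space R),
    K = \bigcup_i (edge v i @` `[0, 1]) /\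
    (forall i j s t, s \in `[0, 1[ -> t \in `[0, 1[ ->
       edge v i s = edge v j t -> i = j /\ s = t).

Definition tame (K : set (space R)) : Prop :=
  exists L, polygonal_knot L /\ ambient_isotopic K L.

(* A closed curve in the plane is given by a parametrization [c] on [0, 1] with
   [c 0 = c 1].  At a double point x, [over x] tells whether the first of the
   two passages through x, in the order of the parameter, is the upper one.
   These definitions are meant for regular curves whose only self-intersections
   are finitely many transverse double points; the isotopy class of [lift c h]
   then depends only on [c] and on the choice [over] that [h] realizes. *)
Definition lift (c : R -> plane R) (h : R -> R) : set (space R) :=
  (fun t => (c t, h t)) @` `[0, 1].

Definition realizes (c : R -> plane R) (over : plane R -> bool) (h : R -> R) :
    Prop :=
  [/\ {within `[0, 1], continuous h}, h 0 = h 1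
    & forall s t, s \in `[0, 1[ -> t \in `[0, 1[ -> s < t -> c s = c t ->
        if over (c s) then h t < h s else h s < h t].

Definition diagram_of (c : R -> plane R) (over : plane R -> bool)
    (K : set (space R)) : Prop :=
  exists h, realizes c over h /\ ambient_isotopic K (lift c h).

Definition carries (c : R -> plane R) (K : set (space R)) : Prop :=
  exists over : plane R -> bool, diagram_of c over K.

End Knots.

Section Potholder.
Context {R : realType}.

Definition segment (p q : plane R) (s : R) : plane R :=
  (1 - s) *: p + s *: q.

(* Circular arc of radius 1/2 and centre p, from angle a to angle b. *)
Definition arc (p : plane R) (a b : R) (s : R) : plane R :=
  let u := (1 - s) * a + s * b in
  (p.1 + cos u / 2, p.2 + sin u / 2).

(* The paths of [ps], each defined on [0, 1], run one after the other in equal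
   times; [%%] closes up the curve at time 1. *)
Definition concat (ps : seq (R -> plane R)) (t : R) : plane R :=
  let u := (size ps)%:R * t in
  let k := Num.truncn u in
  nth (fun=> 0) ps (k %% size ps) (u - k%:R).

Variable n : nat.
Let N : nat := n.*2.+1.
Let lo : R := 1 / 2.
Let hi : R := N%:R + 1 / 2.

(* The curve runs along row 1, row 2, ..., row N, then along column N, ...,
   column 1 and back to row 1.  Odd rows are run rightwards and even rows
   leftwards, odd columns downwards and even columns upwards.  The caps are
   circular, tangent to the strands they join, so that the curve is regular up
   to a change of speed. *)
Definition row (j : nat) : R -> plane R :=
  if odd j then segment (lo, j%:R) (hi, j%:R)
  else segment (hi, j%:R) (lo, j%:R).

Definition column (i : nat) : R -> plane R :=
  if odd i then segment (i%:R, hi) (i%:R, lo)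
  else segment (i%:R, lo) (i%:R, hi).

(* From the end of row j to the start of row j+1 or, when j = N, around the
   upper right corner to the top of column N. *)
Definition row_cap (j : nat) : R -> plane R :=
  if j == N then arc (hi, hi) (- (pi / 2)) pi
  else if odd j then arc (hi, j%:R + 1 / 2) (- (pi / 2)) (pi / 2)
  else arc (lo, j%:R + 1 / 2) (- (pi / 2)) (- (pi + pi / 2)).

(* From the end of column i to the start of column i-1 or, when i = 1, around
   the lower left corner to the left end of row 1. *)
Definition column_cap (i : nat) : R -> plane R :=
  if i == 1%N then arc (lo, lo) 0 (- (pi + pi / 2))
  else if odd i then arc (i%:R - 1 / 2, lo) 0 (- pi)
  else arc (i%:R - 1 / 2, hi) 0 pi.

Definition potholder : R -> plane R :=
  concat (flatten [seq [:: row j; row_cap j] | j <- iota 1 N] ++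
          flatten [seq [:: column i; column_cap i] | i <- rev (iota 1 N)]).

End Potholder.

(* Main.v *)
(* After shears the polygon is in general position: its tips, the local extrema
   of x, have distinct images in the (y,z)-plane.  Tents over these images
   stretch the tips to walls nested alternately on the left and on the right,
   which turns the knot into a zigzag of strands that are graphs over x.  The
   strands are combed one after the other to horizontal segments of the plane
   z = 0.  After a tilt the combed strands form one arc that is a graph over y,
   while the last strand is still a graph over x, with an arbitrary height h
   above that plane.  Up to isotopy such a curve is determined by the levels of
   its finitely many crossings and by the sides on which it passes the arc.  A
   tilted potholder splits in the same way into its rows, a graph over y, and
   its columns, a graph over x: the i-th crossing is moved to column i, into the
   cap on the required side, and the signs of the heights at the crossings of
   the potholder realize the curve.  All isotopies are composites of maps that
   move one coordinate monotonically on the fibres of the other two. *)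
Require Import Defs.
From mathcomp Require Import all_boot all_order all_algebra.
From mathcomp Require Import all_classical all_reals all_analysis.
From mathcomp Require Import ring lra zify.

Set Implicit Arguments.
Unset Strict Implicit.
Unset Printing Implicit Defensive.
Import Order.TTheory GRing.Theory Num.Theory.
Import numFieldNormedType.Exports.
Local Open Scope classical_set_scope.
Local Open Scope ring_scope.

(** * Isotopies *)

Section Continuity.
Context {R : realType}.
Implicit Types T : topologicalType.

(** Every isotopy has to be exhibited through homeomorphisms of the whole space. A map that moves
    one coordinate and expands its fibres by at least a fixed factor is one, and so are its convex
    combinations with the identity. Hence a move is admissible as soon as its support misses what
    must stay fixed, and compactness provides the room. Combing rests on the nesting of the walls:
    over the x-range of a strand the earlier strands are constant points of the (y,z)-plane, so a
    strand can be drawn back along its own course without meeting them, while the strands not yet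
    combed are dragged along without control. The last strand is out of reach of this argument,
    because it returns from the innermost wall to the outermost one; it keeps its shape and carries
    all the knotting. In the comparison with the potholder only the zeros of the height of that
    strand are obstacles: wherever the height is nonzero, the strand and the arc pass each other
    freely in projection. This leaves finitely many data to match, and all other crossings of the
    potholder are absorbed by the signs of the height. *)

Lemma ctsD T (f g : T -> R) : continuous f -> continuous g ->
  continuous (fun x => f x + g x).
Proof. by move=> cf cg x; apply: cvgD; [exact: cf|exact: cg]. Qed.

Lemma ctsN T (f : T -> R) : continuous f -> continuous (fun x => - f x).
Proof. by move=> cf x; apply: cvgN; exact: cf. Qed.

Lemma ctsM T (f g : T -> R) : continuous f -> continuous g ->
  continuous (fun x => f x * g x).
Proof. by move=> cf cg x; apply: cvgM; [exact: cf|exact: cg]. Qed.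

Lemma ctsC T (a : R) : continuous (fun _ : T => a).
Proof. by move=> x; exact: cvg_cst. Qed.

Lemma ctsmax T (f g : T -> R) : continuous f -> continuous g ->
  continuous (fun x => Num.max (f x) (g x)).
Proof. by move=> cf cg x; apply: continuous_max; [exact: cf|exact: cg]. Qed.

Lemma ctsmin T (f g : T -> R) : continuous f -> continuous g ->
  continuous (fun x => Num.min (f x) (g x)).
Proof. by move=> cf cg x; apply: continuous_min; [exact: cf|exact: cg]. Qed.

Lemma ctsnorm T (f : T -> R) : continuous f -> continuous (fun x => `|f x|).
Proof. by move=> cf x; apply: cvg_norm; exact: cf. Qed.

Lemma ctsV T (f : T -> R) : (forall x, f x != 0) -> continuous f ->
  continuous (fun x => (f x)^-1).
Proof. by move=> f0 cf x; apply: cvgV => //; exact: cf. Qed.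

Lemma ctscomp (S T U : topologicalType) (f : S -> T) (g : T -> U) :
  continuous f -> continuous g -> continuous (fun x => g (f x)).
Proof. by move=> cf cg x; apply: continuous_comp; [exact: cf|exact: cg]. Qed.

Lemma ctspair (S T U : topologicalType) (f : S -> T) (g : S -> U) :
  continuous f -> continuous g -> continuous (fun x => (f x, g x)).
Proof. by move=> cf cg x; apply: cvg_pair; [exact: cf|exact: cg]. Qed.

Lemma ctsfst (S T U : topologicalType) (f : S -> T * U) :
  continuous f -> continuous (fun x => (f x).1).
Proof. by move=> cf; apply: ctscomp cf _ => x; exact: cvg_fst. Qed.

Lemma ctssnd (S T U : topologicalType) (f : S -> T * U) :
  continuous f -> continuous (fun x => (f x).2).
Proof. by move=> cf; apply: ctscomp cf _ => x; exact: cvg_snd. Qed.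

Lemma ctsid T : continuous (fun x : T => x).
Proof. by move=> x. Qed.

End Continuity.

Ltac cts1 :=
  lazymatch goal with
  | |- continuous (fun x => x) => exact: ctsid
  | |- continuous (fun x => @?f x + @?g x) => apply: (@ctsD _ _ f g)
  | |- continuous (fun x => - @?f x) => apply: (@ctsN _ _ f)
  | |- continuous (fun x => @?f x * @?g x) => apply: (@ctsM _ _ f g)
  | |- continuous (fun x => Num.max (@?f x) (@?g x)) => apply: (@ctsmax _ _ f g)
  | |- continuous (fun x => Num.min (@?f x) (@?g x)) => apply: (@ctsmin _ _ f g)
  | |- continuous (fun x => `|@?f x|) => apply: (@ctsnorm _ _ f)
  | |- continuous (fun x => (@?f x, @?g x)) => apply: (@ctspair _ _ _ f g)
  | |- continuous (fun x => (@?f x).1) => apply: (@ctsfst _ _ _ f)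
  | |- continuous (fun x => (@?f x).2) => apply: (@ctssnd _ _ _ f)
  | |- continuous (fun x => ?g (@?f x)) =>
      first [ assumption | exact: ctsC | apply: (@ctscomp _ _ _ f g); [|try assumption] ]
  | |- _ => first [ assumption | exact: ctsC ]
  end.
Ltac cts := repeat (cts1; cbn beta).

Notation pt R := (R * R * R)%type.

Section Iso.
Context {R : realType}.
Implicit Types (P Q : pt R -> pt R).

(** The deformation is continuous for all real times, not only on the unit interval, so that
    composing isotopies never meets a subspace topology; [amb_iso] returns to the restricted
    form. *)
Definition iso P := exists F : R -> pt R -> pt R,
  [/\ continuous (fun p : R * pt R => F p.1 p.2),
      forall t, t \in `[0, 1] -> homeomorphism (F t),
      forall p, F 0 p = p & forall p, F 1 p = P p].

Let in00 : (0 : R) \in `[0, 1].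
Proof. by rewrite in_itv /= lexx ler01. Qed.

Let in11 : (1 : R) \in `[0, 1].
Proof. by rewrite in_itv /= lexx ler01. Qed.

Lemma homeo_ext P Q : (forall p, P p = Q p) -> homeomorphism P -> homeomorphism Q.
Proof. by move=> /funext ->. Qed.

Lemma homeo_id : homeomorphism (fun p : pt R => p).
Proof. by split; [exact: ctsid | exists (fun p => p); split=> //; exact: ctsid]. Qed.

Lemma homeo_comp P Q : homeomorphism P -> homeomorphism Q ->
  homeomorphism (fun p => P (Q p)).
Proof.
move=> [cP [P' [cP' PK KP]]] [cQ [Q' [cQ' QK KQ]]]; split; first by cts.
exists (fun p => Q' (P' p)); split; first by cts.
- by move=> p; rewrite PK QK.
- by move=> p; rewrite KQ KP.
Qed.

Lemma iso_homeo P : iso P -> homeomorphism P.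
Proof. by move=> [F [_ hF _ F1]]; apply: homeo_ext F1 _; exact: hF. Qed.

Lemma iso_id : iso (fun p => p).
Proof. by exists (fun _ p => p); split=> // [|t _]; [cts | exact: homeo_id]. Qed.

Lemma iso_ext P Q : (forall p, P p = Q p) -> iso P -> iso Q.
Proof. by move=> /funext ->. Qed.

Lemma iso_comp P Q : iso P -> iso Q -> iso (fun p => P (Q p)).
Proof.
move=> [F [cF hF F0 F1]] [G [cG hG G0 G1]].
exists (fun t p => F t (G t p)); split.
- have cH : continuous (fun p : R * pt R => (p.1, G p.1 p.2)) by cts.
  exact: (ctscomp cH cF).
- by move=> t t01; apply: homeo_comp; [exact: hF | exact: hG].
- by move=> p; rewrite F0 G0.
- by move=> p; rewrite F1 G1.
Qed.

Lemma iso_inv P : iso P -> exists Q, [/\ iso Q, cancel P Q & cancel Q P].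
Proof.
move=> [F [cF hF F0 F1]].
have [cP [Q [cQ PK KP]]] : homeomorphism P.
  by apply: homeo_ext F1 _; exact: hF.
exists Q; split=> //.
exists (fun t p => F (1 - t) (Q p)); split.
- have cH : continuous (fun p : R * pt R => (1 - p.1, Q p.2)) by cts.
  exact: (ctscomp cH cF).
- move=> t; rewrite in_itv /= => /andP[t0 t1]; apply: (@homeo_comp (F (1 - t)) Q).
    by apply: hF; rewrite in_itv /=; apply/andP; split; lra.
  by split=> //; exists P.
- by move=> p; rewrite subr0 F1 KP.
- by move=> p; rewrite subrr F0.
Qed.

Lemma iso_conj P S : continuous S -> (forall p, S (S p) = p) -> iso P ->
  iso (fun p => S (P (S p))).
Proof.
move=> cS SK [F [cF hF F0 F1]].
have hS : homeomorphism S by split=> //; exists S.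
exists (fun t p => S (F t (S p))); split.
- have cH : continuous (fun p : R * pt R => (p.1, S p.2)) by cts.
  by have := ctscomp (ctscomp cH cF) cS.
- by move=> t t01; apply: (@homeo_comp S (fun p => F t (S p))) => //; apply: (@homeo_comp (F t) S) => //; exact: hF.
- by move=> p; rewrite F0 SK.
- by move=> p; rewrite F1.
Qed.

Lemma amb_iso (K L : set (pt R)) P : ambient_isotopic K L -> iso P ->
  ambient_isotopic K (P @` L).
Proof.
move=> [F [cF hF F0 F1]] [G [cG hG G0 G1]].
exists (fun t p => G t (F t p)); split.
- move=> x.
  have c1 : {within `[0, 1] `*` [set: pt R],
      continuous (fun p : R * pt R => p.1)}.
    by apply: continuous_subspaceT => p; exact: cvg_fst.
  have cH : {within `[0, 1] `*` [set: pt R],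
      continuous (fun p : R * pt R => (p.1, F p.1 p.2))}.
    move=> p; have h1 := c1 p; have h2 := cF p. have := cvg_pair h1 h2; exact.
  exact: (continuous_comp (cH x) (cG _)).
- by move=> t t01; apply: (@homeo_comp (G t) (F t)); [exact: hG | exact: hF].
- by move=> p; rewrite G0 F0.
- rewrite -F1; apply/seteqP; split=> [_ [x Kx <-]|_ [_ [x Kx <-] <-]].
    by exists (F 1 x); [exists x | rewrite G1].
  by exists x => //; rewrite G1.
Qed.

(* The vertical map is a homeomorphism because it expands every fibre at least
   by the factor [k]; its inverse is therefore continuous as well. *)
Lemma homeo_mono (phi : pt R -> R) (k : R) : continuous phi -> 0 < k ->
  (forall x y y' z, y < y' -> k * (y' - y) <= phi (x, y', z) - phi (x, y, z)) ->
  homeomorphism (fun p => (p.1.1, phi p, p.2)).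
Proof.
move=> cphi k0 mono; split; first by cts.
have incr x y y' z : y < y' -> phi (x, y, z) < phi (x, y', z).
  move=> yy'; rewrite -subr_gt0; apply: lt_le_trans (mono _ _ _ _ yy').
  by rewrite mulr_gt0 // subr_gt0.
have cfib x z : continuous (fun y => phi (x, y, z)).
  have cH : continuous (fun y : R => (x, y, z)) by cts.
  exact: (ctscomp cH cphi).
have surj x z v : exists y, phi (x, y, z) = v.
  set c := phi (x, 0, z); set d := (v - c) / k.
  have dk : k * d = v - c by rewrite /d mulrC divfK // gt_eqF.
  have cw a b : {within `[a, b], continuous (fun y => phi (x, y, z))}.
    exact: continuous_subspaceT.
  have [vc|vc|vc] := ltgtP v c; last by exists 0.
  - have d0 : d < 0 by rewrite -(pmulr_rlt0 _ k0) dk subr_lt0.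
    have h := mono x d 0 z d0; rewrite -/c in h.
    have [|y _ <-] := @IVT R (fun y => phi (x, y, z)) d 0 v (ltW d0) (cw _ _).
      by rewrite ge_min le_max -/c (ltW vc) orbT andbT; apply/orP; left; lra.
    by exists y.
  - have d0 : 0 < d by rewrite -(pmulr_rgt0 _ k0) dk subr_gt0.
    have h := mono x 0 d z d0; rewrite -/c in h.
    have [|y _ <-] := @IVT R (fun y => phi (x, y, z)) 0 d v (ltW d0) (cw _ _).
      by rewrite ge_min le_max -/c (ltW vc) /=; apply/orP; right; lra.
    by exists y.
pose g (p : pt R) : R := sval (cid (surj p.1.1 p.2 p.1.2)).
have gP p : phi (p.1.1, g p, p.2) = p.1.2 by rewrite /g; case: cid.
have cg : continuous g.
  move=> [[x0 v0] z0]; set y0 := g (x0, v0, z0).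
  have h0 : phi (x0, y0, z0) = v0 by exact: (gP (x0, v0, z0)).
  apply/cvgrPdist_lt => e e0.
  have e2 : 0 < e / 2 by rewrite divr_gt0.
  have cu : continuous (fun p : pt R => phi (p.1.1, y0 + e / 2, p.2) - p.1.2).
    have cH : continuous (fun p : pt R => (p.1.1, y0 + e / 2, p.2)) by cts.
    by have := ctscomp cH cphi => ?; cts.
  have cl : continuous (fun p : pt R => p.1.2 - phi (p.1.1, y0 - e / 2, p.2)).
    have cH : continuous (fun p : pt R => (p.1.1, y0 - e / 2, p.2)) by cts.
    by have := ctscomp cH cphi => ?; cts.
  have pu : 0 < phi (x0, y0 + e / 2, z0) - v0.
    by rewrite -h0 subr_gt0 incr // ltrDl.
  have pl : 0 < v0 - phi (x0, y0 - e / 2, z0).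
    by rewrite -h0 subr_gt0 incr // gtrBl.
  have nu := @cvgr_gt _ _ _ _ _ _ (cu (x0, v0, z0)) _ pu.
  have nl := @cvgr_gt _ _ _ _ _ _ (cl (x0, v0, z0)) _ pl.
  near=> p.
  have u1 : 0 < phi (p.1.1, y0 + e / 2, p.2) - p.1.2 by near: p; exact: nu.
  have l1 : 0 < p.1.2 - phi (p.1.1, y0 - e / 2, p.2) by near: p; exact: nl.
  rewrite -(gP p) in u1 l1.
  have up : g p < y0 + e / 2.
    rewrite ltNge; apply/negP; rewrite le_eqVlt => /orP[/eqP E|E].
      by rewrite E subrr ltxx in u1.
    by have := incr p.1.1 _ _ p.2 E; lra.
  have lp : y0 - e / 2 < g p.
    rewrite ltNge; apply/negP; rewrite le_eqVlt => /orP[/eqP E|E].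
      by rewrite E subrr ltxx in l1.
    by have := incr p.1.1 _ _ p.2 E; lra.
  by rewrite -/y0 ltr_norml; move: e0 e2 up lp; move: (g p) => gp *; apply/andP; split; lra.
exists (fun p => (p.1.1, g p, p.2)); split; first by cts.
- move=> [[x y] z] /=; congr (_, _, _).
  have := gP (x, phi (x, y, z), z) => /=; set y' := g _ => E.
  by case: (ltgtP y' y) => // c; have := incr x _ _ z c; rewrite E ltxx.
- by move=> [[x y] z] /=; rewrite (gP (x, y, z)).
Unshelve. all: by end_near.
Qed.

(** Interpolating linearly with the identity keeps the fibres expanding, at time t by the factor
    [1 - t + t * k], so [homeo_mono] applies at every time. *)
Lemma iso_mono (phi : pt R -> R) (k : R) : continuous phi -> 0 < k ->
  (forall x y y' z, y < y' -> k * (y' - y) <= phi (x, y', z) - phi (x, y, z)) ->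
  iso (fun p => (p.1.1, phi p, p.2)).
Proof.
move=> cphi k0 mono.
exists (fun t p => (p.1.1, (1 - t) * p.1.2 + t * phi p, p.2)); split.
- by cts.
- move=> t; rewrite in_itv /= => /andP[t0 t1].
  apply: (@homeo_mono (fun p => (1 - t) * p.1.2 + t * phi p) (1 - t + t * k)).
  + by cts.
  + have := mulr_ge0 t0 (ltW k0).
    by move: t1; rewrite le_eqVlt => /orP[/eqP ->|]; lra.
  + move=> x y y' z yy' /=; have := mono x y y' z yy' => h.
    have := ler_wpM2l t0 h; move: (phi _) (phi _) => a b; rewrite mulrA !mulrBr; nra.
- by move=> [[x y] z] /=; congr (_, _, _); rewrite subr0 mul1r mul0r addr0.
- by move=> [[x y] z] /=; congr (_, _, _); rewrite subrr mul0r mul1r add0r.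
Qed.

Definition swap_xy (p : pt R) : pt R := (p.1.2, p.1.1, p.2).
Definition swap_yz (p : pt R) : pt R := (p.1.1, p.2, p.1.2).

Lemma iso_swap_xy P : iso P -> iso (fun p => swap_xy (P (swap_xy p))).
Proof. by apply: iso_conj; [rewrite /swap_xy; cts | case=> [[x y] z]]. Qed.

Lemma iso_swap_yz P : iso P -> iso (fun p => swap_yz (P (swap_yz p))).
Proof. by apply: iso_conj; [rewrite /swap_yz; cts | case=> [[x y] z]]. Qed.

Lemma iso_mono_x (phi : pt R -> R) (k : R) : continuous phi -> 0 < k ->
  (forall x x' y z, x < x' -> k * (x' - x) <= phi (x', y, z) - phi (x, y, z)) ->
  iso (fun p => (phi p, p.1.2, p.2)).
Proof.
move=> cphi k0 mono.
have cs : continuous swap_xy by rewrite /swap_xy; cts.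
have := @iso_mono (fun p => phi (swap_xy p)) k (ctscomp cs cphi) k0
  (fun x y y' z => mono y y' x z).
by move/iso_swap_xy; apply: iso_ext => -[[x y] z].
Qed.

Lemma iso_mono_z (phi : pt R -> R) (k : R) : continuous phi -> 0 < k ->
  (forall x y z z', z < z' -> k * (z' - z) <= phi (x, y, z') - phi (x, y, z)) ->
  iso (fun p => (p.1.1, p.1.2, phi p)).
Proof.
move=> cphi k0 mono.
have cs : continuous swap_yz by rewrite /swap_yz; cts.
have := @iso_mono (fun p => phi (swap_yz p)) k (ctscomp cs cphi) k0
  (fun x y y' z => mono x z y y').
by move/iso_swap_yz; apply: iso_ext => -[[x y] z].
Qed.

End Iso.

Lemma le_or_lt (R : realDomainType) (x y : R) : x <= y \/ y < x.
Proof. by case: leP; [left | right]. Qed.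

Lemma max_cases (R : realDomainType) (x y : R) :
  x <= y /\ Num.max x y = y \/ y < x /\ Num.max x y = x.
Proof. by case: leP; [left | right]. Qed.

Lemma min_cases (R : realDomainType) (x y : R) :
  x <= y /\ Num.min x y = x \/ y < x /\ Num.min x y = y.
Proof. by case: leP; [left | right]. Qed.

Lemma norm_cases (R : realDomainType) (x : R) :
  0 <= x /\ `|x| = x \/ x < 0 /\ `|x| = - x.
Proof. by case: ger0P; [left | right]. Qed.

Ltac numeric T :=
  lazymatch T with
  | is_true (Order.le _ _) => idtac
  | is_true (Order.lt _ _) => idtac
  | is_true (andb (Order.le _ _) _) => idtac
  | is_true (andb (Order.lt _ _) _) => idtac
  | @eq (_ -> _) _ _ => fail
  | @eq nat _ _ => fail
  | @eq bool _ _ => fail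
  | @eq (prod _ _) _ _ => fail
  | @eq _ _ _ => idtac
  | _ => fail
  end.
(* [lra] is much faster on a context from which everything else is cleared. *)
Ltac keep_numeric :=
  repeat match goal with
  | H : ?T |- _ => tryif numeric T then fail else clear H
  end.
Ltac qlra := solve
  [ keep_numeric; repeat match goal with x := _ |- _ => clearbody x end; lra
  | keep_numeric; lra
  | lra ].
Ltac simple_term a :=
  lazymatch a with
  | context [Num.max _ _] => fail
  | context [Num.min _ _] => fail
  | context [`|_|] => fail
  | _ => idtac
  end.
(* Splits the goal along its minima, maxima and absolute values, innermost
   ones first. *)
Ltac mmcase :=
  repeat match goal with
  | |- context [Num.max ?a ?b] => simple_term a; simple_term b; case: (max_cases a b) => -[? ->]
  | |- context [Num.min ?a ?b] => simple_term a; simple_term b; case: (min_cases a b) => -[? ->]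
  | |- context [`|?a|] => simple_term a; case: (norm_cases a) => -[? ->]
  end.
Ltac mm := mmcase; qlra.

(** * Pushing a graph aside inside a thin neighbourhood *)

Section Push.
Context {R : realType}.

(** A tent of height 1 over 0 with feet at [- a] and [b]. The two feet are independent, because a
    push needs a long foot only on the side towards which it goes. *)
Definition hat (a b y : R) := Num.max 0 (Num.min (1 + y / a) (1 - y / b)).

Lemma hat_lip (a b y y' : R) : 0 < a -> 0 < b -> y <= y' ->
  - ((y' - y) / b) <= hat a b y' - hat a b y <= (y' - y) / a.
Proof.
move=> a0 b0 yy'; rewrite /hat.
have s0 : 0 <= (y' - y) / a by apply: divr_ge0; [rewrite subr_ge0 | exact: ltW].
have t0 : 0 <= (y' - y) / b by apply: divr_ge0; [rewrite subr_ge0 | exact: ltW].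
have -> : y' / a = y / a + (y' - y) / a by rewrite mulrBl; ring.
have -> : y' / b = y / b + (y' - y) / b by rewrite mulrBl; ring.
move: s0 t0; move: (_ / a) (_ / b) ((_ - _) / a) ((_ - _) / b) => A B s t.
by move=> s0 t0; apply/andP; split; mm.
Qed.

Lemma hat_out (a b y : R) : 0 < a -> 0 < b -> y <= - a \/ b <= y -> hat a b y = 0.
Proof.
move=> a0 b0; rewrite /hat => -[out|out].
  have : y / a <= -1 by rewrite ler_pdivrMr // mulN1r.
  by clear; move: (_ / a) (_ / b) => A B; mm.
have : 1 <= y / b by rewrite ler_pdivlMr // mul1r.
by clear; move: (_ / a) (_ / b) => A B; mm.
Qed.

(** The hat has its feet at distance [rho] beyond both ends of the swept segment. Its slope on the
    side of the motion is [1 / (rho + |v|)] in size, so the pushed fibre still expands by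
    [rho / (rho + |v|)], which is bounded below by [rho / (rho + V)]. *)
Lemma push (p v zeta : R -> R) (V rho : R) :
  continuous p -> continuous v -> continuous zeta ->
  (forall x, `|v x| <= V) -> 0 < rho ->
  exists P : pt R -> pt R, [/\ iso P,
    forall x, P (x, p x, zeta x) = (x, p x + v x, zeta x)
  & forall x y z, v x = 0 \/ (forall s, 0 <= s <= 1 ->
       rho <= Num.max `|y - p x - s * v x| `|z - zeta x|) ->
     P (x, y, z) = (x, y, z)].
Proof.
move=> cp cv czeta vV rho0.
pose a x := rho + Num.max 0 (- v x); pose b x := rho + Num.max 0 (v x).
have a0 x : 0 < a x by rewrite /a; mm.
have b0 x : 0 < b x by rewrite /b; mm.
pose f x z := Num.max 0 (1 - `|z - zeta x| / rho).
have f01 x z : 0 <= f x z <= 1.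
  rewrite /f; have : 0 <= `|z - zeta x| / rho by rewrite divr_ge0 // ltW.
  by move: (_ / rho) => u u0; apply/andP; split; mm.
pose phi (q : pt R) :=
  q.1.2 + v q.1.1 * (hat (a q.1.1) (b q.1.1) (q.1.2 - p q.1.1) * f q.1.1 q.2).
have cphi : continuous phi.
  rewrite /phi /hat /f.
  have ca : continuous (fun q : pt R => (a q.1.1)^-1).
    apply: ctsV => [q|]; first by rewrite gt_eqF.
    by rewrite /a; cts.
  have cb : continuous (fun q : pt R => (b q.1.1)^-1).
    apply: ctsV => [q|]; first by rewrite gt_eqF.
    by rewrite /b; cts.
  by cts.
have V0 : 0 <= V := le_trans (normr_ge0 _) (vV 0).
have rV : 0 < rho + V by qlra.
exists (fun q => (q.1.1, phi q, q.2)); split.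
- apply: (@iso_mono _ phi (rho / (rho + V))) => //; first by rewrite divr_gt0.
  move=> x y y' z yy'; rewrite /phi /=.
  have yl : y - p x <= y' - p x by qlra.
  have /andP[] := hat_lip (a0 x) (b0 x) yl.
  have -> : y' - p x - (y - p x) = y' - y by ring.
  move: (hat _ _ _) (hat _ _ _) => h h' lo up.
  have /andP[f0 f1] := f01 x z; move: (f x z) f0 f1 => u u0 u1.
  have d0 : 0 < y' - y by qlra.
  have key w : 0 <= w -> w <= V -> rho / (rho + V) <= 1 - w / (rho + w).
    move=> w0 wV; have rw : 0 < rho + w by qlra.
    have -> : 1 - w / (rho + w) = rho / (rho + w) by field; rewrite gt_eqF.
    by rewrite ler_pM2l // lef_pV2 ?posrE //; qlra.
  have -> : y' + v x * (h' * u) - (y + v x * (h * u)) =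
            (y' - y) + (v x * (h' - h)) * u by ring.
  have [v0|v0] := le_or_lt 0 (v x).
    have bE : b x = rho + v x by rewrite /b; mm.
    have k := key (v x) v0 (le_trans (ler_norm _) (vV x)); rewrite bE in lo.
    have h1 : v x * (h' - h) >= - (v x / (rho + v x) * (y' - y)).
      by apply: le_trans (ler_wpM2l v0 lo); rewrite mulrN lerN2 mulrAC mulrA.
    have h2 : 0 <= v x / (rho + v x) by rewrite divr_ge0 //; qlra.
    have h3 := ler_wpM2r (ltW d0) k.
    have h4 : 0 <= v x / (rho + v x) * (y' - y) by rewrite mulr_ge0 // ltW.
    move: h1 h3 h4; move: (_ / (_ + _)) (_ / (_ + _)) => r1 r2.
    by move: (v x * _) => w *; nra.
  have aE : a x = rho - v x by rewrite /a; mm.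
  have nv0 : 0 <= - v x by qlra.
  have nV : - v x <= V by apply: le_trans (vV x); rewrite -normrN ler_norm.
  have k := key (- v x) nv0 nV; rewrite aE in up.
  have h1 : v x * (h' - h) >= - (- v x / (rho - v x) * (y' - y)).
    have := ler_wpM2l nv0 up; rewrite mulrA (mulrAC (- v x)); qlra.
  have h2 : 0 <= - v x / (rho - v x) by rewrite divr_ge0 //; qlra.
  have h3 := ler_wpM2r (ltW d0) k.
  have h4 : 0 <= - v x / (rho - v x) * (y' - y) by rewrite mulr_ge0 // ltW.
  move: h1 h3 h4; move: (_ / (_ + _)) (_ / (_ + _)) => r1 r2.
  by move: (v x * _) => w *; nra.
- move=> x; rewrite /phi /= /hat /f !subrr normr0 !mul0r addr0 subr0 minxx.
  by rewrite max_r ?ler01 // mul1r mulr1.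
- move=> x y z H; congr (_, _, _); rewrite /phi /=.
  case: H => [->|H]; first by rewrite mul0r addr0.
  have [zr|zr] := le_or_lt rho `|z - zeta x|.
    rewrite /f max_l ?mulr0 ?addr0 // subr_le0 lter_pdivlMr // mul1r //.
  suff -> : hat (a x) (b x) (y - p x) = 0 by rewrite mul0r mulr0 addr0.
  have {}H s : 0 <= s <= 1 -> rho <= `|y - p x - s * v x|.
    by move=> /H; rewrite le_max => /orP[//|]; qlra.
  have out : y - p x <= - a x \/ b x <= y - p x.
    have H0 := H 0; have H1 := H 1; rewrite /a /b.
    set d := y - p x in H H0 H1 *.
    have := H0; rewrite lexx ler01 mul0r subr0 => /(_ isT).
    have := H1; rewrite lexx ler01 mul1r => /(_ isT) {H0 H1} H1 H0.
    have [vz|vz] := eqVneq (v x) 0.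
      by rewrite vz oppr0 maxxx; move: H0; mmcase => ?; [right|left]; qlra.
    (* If [d / v x] lay between 0 and 1, the point would be on the swept segment, at distance 0. *)
    have HS := H (d / v x); rewrite divfK // subrr normr0 in HS.
    have HS' : ~ (0 <= d / v x <= 1) by move=> /HS; qlra.
    have [v0|v0] := le_or_lt 0 (v x).
      have {}v0 : 0 < v x by rewrite lt_neqAle eq_sym vz.
      have [d0|d0] := le_or_lt 0 d; last by left; move: H0; mm.
      right; have d1 : v x < d.
        rewrite ltNge; apply/negP => dv; apply: HS'.
        apply/andP; split; first exact: divr_ge0 d0 (ltW v0).
        by rewrite ler_pdivrMr // mul1r.
      by move: H1; mm.
    have [d0|d0] := le_or_lt d 0; last by right; move: H0; mm.
    left; have d1 : d < v x.
      rewrite ltNge; apply/negP => dv; apply: HS'.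
      apply/andP; split; last by rewrite ler_ndivrMr // mul1r.
      by rewrite -mulrNN -invrN; apply: mulr_ge0; rewrite ?invr_ge0; qlra.
    by move: H1; mm.
  exact: hat_out.
Qed.

End Push.

(** * Continuous functions on the line *)

Section Inverse.
Context {R : realType}.

Definition clamp (a b x : R) := Num.max a (Num.min x b).

Lemma clamp_itv a b x : a <= b -> a <= clamp a b x <= b.
Proof. by move=> ab; rewrite /clamp; apply/andP; split; mm. Qed.

Lemma clamp_id a b x : a <= x <= b -> clamp a b x = x.
Proof. by move=> /andP[ax xb]; rewrite /clamp; mm. Qed.

Lemma clamp_le a b x : a <= b -> x <= a -> clamp a b x = a.
Proof. by move=> ab xa; rewrite /clamp; mm. Qed.

Lemma clamp_ge a b x : a <= b -> b <= x -> clamp a b x = b.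
Proof. by move=> ab bx; rewrite /clamp; mm. Qed.

Lemma clamp_lip a b x y : `|clamp a b x - clamp a b y| <= `|x - y|.
Proof. by rewrite /clamp; mm. Qed.

Lemma cts_clamp (T : topologicalType) (a b : R) (f : T -> R) :
  continuous f -> continuous (fun x => clamp a b (f x)).
Proof. by move=> cf; rewrite /clamp; cts. Qed.

(** Clamping the argument to the range of [f] extends the inverse to a continuous function on the
    whole line, as the globally defined isotopies require. *)
Lemma inverse_incr (f : R -> R) a b : a <= b -> continuous f ->
  (forall s t, a <= s -> s < t -> t <= b -> f s < f t) ->
  exists g : R -> R, [/\ continuous g, forall t, a <= t <= b -> g (f t) = t,
    forall x, a <= g x <= b & forall x, f a <= x <= f b -> f (g x) = x].
Proof.
move=> ab cf mono.
have fab : f a <= f b.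
  by move: ab; rewrite le_eqVlt => /orP[/eqP-> //|ab]; apply/ltW/mono.
have ex x : exists y, a <= y <= b /\ f y = clamp (f a) (f b) x.
  have /andP[c1 c2] := clamp_itv x fab.
  have cw : {within `[a, b], continuous f} by exact: continuous_subspaceT.
  have [|y yab <-] := @IVT R f a b (clamp (f a) (f b) x) ab cw.
    by rewrite min_l // max_r // c1 c2.
  by exists y; move: yab; rewrite in_itv.
pose g x := sval (cid (ex x)).
have gab x : a <= g x <= b by rewrite /g; case: cid => y [].
have fg x : f (g x) = clamp (f a) (f b) x by rewrite /g; case: cid => y [].
have le_of s t : a <= s <= b -> a <= t <= b -> f s < f t -> s < t.
  move=> /andP[as_ sb] /andP[at_ tb] fst; rewrite ltNge; apply/negP.
  rewrite le_eqVlt => /orP[/eqP E|E]; first by rewrite E ltxx in fst.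
  by have := mono _ _ at_ E sb; qlra.
exists g; split=> //.
- move=> x0; apply/cvgrPdist_lt => e e0.
  have /andP[ay yb] := gab x0; set y0 := g x0 in ay yb *.
  have cc : continuous (fun x => clamp (f a) (f b) x) by apply/cts_clamp/ctsid.
  have up : \forall x \near x0, g x < y0 + e.
    have [be|be] := ltP b (y0 + e).
      by near=> x; apply: le_lt_trans be; case/andP: (gab x).
    have lt1 : clamp (f a) (f b) x0 < f (y0 + e).
      by rewrite -fg; apply: mono => //; rewrite ltrDl.
    have nr := @cvgr_lt _ _ _ _ _ _ (cc x0) _ lt1.
    near=> x; have : clamp (f a) (f b) x < f (y0 + e) by near: x; exact: nr.
    rewrite -fg; apply: le_of; first exact: gab.
    by rewrite be andbT (le_trans ay) // lerDl ltW.
  have dn : \forall x \near x0, y0 - e < g x.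
    have [be|be] := ltP (y0 - e) a.
      by near=> x; apply: lt_le_trans be _; case/andP: (gab x).
    have lt1 : f (y0 - e) < clamp (f a) (f b) x0.
      by rewrite -fg; apply: mono => //; rewrite gtrBl.
    have nr := @cvgr_gt _ _ _ _ _ _ (cc x0) _ lt1.
    near=> x; have : f (y0 - e) < clamp (f a) (f b) x by near: x; exact: nr.
    rewrite -fg; apply: le_of; last exact: gab.
    by rewrite be /=; qlra.
  near=> x.
  have u1 : g x < y0 + e by near: x; exact: up.
  have d1 : y0 - e < g x by near: x; exact: dn.
  by rewrite ltr_norml; apply/andP; split; qlra.
- move=> t tab; have /andP[a1 b1] := tab.
  have la : f a <= f t.
    by move: (a1); rewrite le_eqVlt => /orP[/eqP <- //|h]; apply/ltW/mono.
  have lb : f t <= f b.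
    by move: (b1); rewrite le_eqVlt => /orP[/eqP <- //|h]; apply/ltW/mono.
  have E : f (g (f t)) = f t by rewrite fg clamp_id // la.
  have /andP[a2 b2] := gab (f t).
  case: (ltgtP (g (f t)) t) => // c.
    by have := mono _ _ a2 c b1; rewrite E ltxx.
  by have := mono _ _ a1 c b2; rewrite E ltxx.
- by move=> x xab; rewrite fg clamp_id.
Unshelve. all: by end_near.
Qed.

End Inverse.

Section Chain.
Context {R : realType}.

(** Paths run one after the other in unit times, without a last one. For negative [t] the truncation
    is 0 and the first path is simply continued. *)
Definition chain T (f : nat -> R -> T) (t : R) : T :=
  f (Num.truncn t) (t - (Num.truncn t)%:R).

Lemma truncn_lt1 (t : R) : t < 1 -> Num.truncn t = 0%N.
Proof. by move=> t1; apply/Num.Theory.truncn0Pn; rewrite -ltNge. Qed.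

Lemma chainE T (f : nat -> R -> T) k t : k%:R <= t < k.+1%:R ->
  chain f t = f k (t - k%:R).
Proof. by move=> tk; rewrite /chain (Num.Theory.truncn_def tk). Qed.

Lemma chainE_closed T (f : nat -> R -> T) k t : f k 1 = f k.+1 0 ->
  k%:R <= t <= k.+1%:R -> chain f t = f k (t - k%:R).
Proof.
move=> fk /andP[kt]; rewrite le_eqVlt => /orP[/eqP ->|tk].
  rewrite (@chainE _ _ k.+1) ?lexx ?ltr_nat //= subrr -fk; congr (f k _).
  by rewrite -natrB // subSnn.
by apply: chainE; rewrite kt.
Qed.

Lemma cts_chain (f : nat -> R -> R) : (forall k, continuous (f k)) ->
  (forall k, f k 1 = f k.+1 0) -> continuous (chain f).
Proof.
move=> cf fk t0; rewrite /continuous_at.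
have [t1|t1] := ltP t0 1.
  have E : \forall t \near t0, f 0%N t = chain f t.
    near=> t; rewrite /chain truncn_lt1 ?subr0 //; near: t; exact: lt_nbhsl.
  have -> : chain f t0 = f 0%N t0 by rewrite /chain truncn_lt1 ?subr0.
  by apply: cvg_trans (cf 0%N t0); apply: near_eq_cvg.
pose k := (Num.truncn t0).-1.
have /andP[k1 k2] : (Num.truncn t0)%:R <= t0 < (Num.truncn t0).+1%:R.
  by apply: Num.Theory.truncn_itv; qlra.
have kE : Num.truncn t0 = k.+1.
  rewrite /k prednK // lt0n; apply/eqP => E.
  by rewrite E in k2; qlra.
rewrite kE in k1 k2.
(* One formula without cases that agrees with the chain on the open interval from [k] to [k.+2]: on
   either side of the joint one of the first two terms is frozen at the common value [f k 1]. *)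
pose h t := f k (Num.min (t - k%:R) 1) + f k.+1 (Num.max (t - k.+1%:R) 0) - f k 1.
have kS : k.+1%:R = k%:R + 1 :> R by rewrite -natr1.
have kSS : k.+2%:R = k%:R + 2 :> R by rewrite -natr1 kS -addrA.
have hE t : k%:R < t < k.+2%:R -> h t = chain f t.
  move=> /andP[a b]; rewrite /h.
  have [c|c] := ltP t k.+1%:R.
    rewrite (@chainE _ _ k) ?(ltW a) // min_l ?max_r; [|qlra|qlra].
    by rewrite fk; ring.
  rewrite (@chainE _ _ k.+1) ?c // min_r ?max_l; [|qlra|qlra].
  by ring.
have ch : continuous h.
  by have := cf k; have := cf k.+1; rewrite /h => ? ?; cts.
rewrite -hE; last by apply/andP; split; qlra.
apply: cvg_trans (ch t0); apply: near_eq_cvg; near=> t; apply: hE.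
apply/andP; split; near: t; [apply: lt_nbhsr|apply: lt_nbhsl]; qlra.
Unshelve. all: by end_near.
Qed.

Lemma incr_glue (f : R -> R) (a b : R) (m n : nat) :
  a <= m%:R -> n%:R <= b ->
  (forall s t, a <= s -> s < t -> t <= m%:R -> f s < f t) ->
  (forall k s t, (m <= k < n)%N -> k%:R <= s -> s < t -> t <= k.+1%:R -> f s < f t) ->
  (forall s t, n%:R <= s -> s < t -> t <= b -> f s < f t) ->
  (m <= n)%N ->
  forall s t, a <= s -> s < t -> t <= b -> f s < f t.
Proof.
move=> am nb f1 f2 f3 mn.
have H i : (m + i <= n)%N -> forall s t, a <= s -> s < t -> t <= (m + i)%:R -> f s < f t.
  elim: i => [|i IH] mi s t as_ st ti; first by apply: f1; rewrite ?addn0 // in ti *.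
  have mi' : (m + i <= n)%N by apply: leq_trans mi; rewrite leq_add2l.
  have [ti'|ti'] := le_or_lt t (m + i)%:R; first exact: IH.
  have loc u w : (m + i)%:R <= u -> u < w -> w <= (m + i.+1)%:R -> f u < f w.
    by rewrite addnS => *; apply: (f2 (m + i)%N) => //; rewrite leq_addr -addnS.
  have [si|si] := le_or_lt (m + i)%:R s; first exact: loc.
  by apply: (@lt_trans _ _ (f (m + i)%:R)); [exact: IH | exact: loc].
move=> s t as_ st tb.
have Hn := H (n - m)%N; rewrite subnKC // in Hn.
have [tn|tn] := le_or_lt t n%:R; first exact: Hn.
have [sn|sn] := le_or_lt n%:R s; first exact: f3.
apply: (@lt_trans _ _ (f n%:R)); first by apply: Hn.
by apply: f3.
Qed.

End Chain.

Section Interpolation.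
Context {R : realType}.

Lemma interp (u v : nat -> R) (m : nat) :
  (forall i, (i < m)%N -> u i < u i.+1) -> (forall i, (i < m)%N -> v i < v i.+1) ->
  exists (g : R -> R) (k : R), [/\ continuous g, 0 < k,
    forall x y, x < y -> k * (y - x) <= g y - g x
  & forall i, (i <= m)%N -> g (u i) = v i].
Proof.
move=> incu incv.
(* The induction needs [g] explicitly to the right of the last node, where the next linear piece is
   inserted. *)
suff : exists (g : R -> R) (k : R), [/\ continuous g, 0 < k,
    forall x y, x < y -> k * (y - x) <= g y - g x,
    forall i, (i <= m)%N -> g (u i) = v i & forall x, u m <= x -> g x = v m + (x - u m)].
  by case=> g [k [? ? ? ? _]]; exists g, k.
elim: m incu incv => [|m IH] incu incv.
  exists (fun x => v 0%N + (x - u 0%N)), 1; split=> //.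
  - by cts.
  - by move=> x y _; rewrite mul1r; qlra.
  - by case=> // _; rewrite subrr addr0.
have [i im|i im|g [k [cg k0 kg gu gt]]] := IH.
- by apply: incu; rewrite ltnS ltnW.
- by apply: incv; rewrite ltnS ltnW.
have du : 0 < u m.+1 - u m by rewrite subr_gt0 incu.
have dv : 0 < v m.+1 - v m by rewrite subr_gt0 incv.
pose s := (v m.+1 - v m) / (u m.+1 - u m).
have s0 : 0 < s by rewrite divr_gt0.
have sE : s * (u m.+1 - u m) = v m.+1 - v m by rewrite divfK // gt_eqF.
pose G x := g (Num.min x (u m)) + s * (clamp (u m) (u m.+1) x - u m)
  + Num.max 0 (x - u m.+1).
have GL x : x <= u m -> G x = g x.
  move=> xu; rewrite /G min_l // clamp_le //; last qlra.
  by rewrite subrr mulr0 max_l; [ring | qlra].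
have GM x : u m <= x <= u m.+1 -> G x = v m + s * (x - u m).
  move=> /andP[x1 x2]; rewrite /G min_r // clamp_id ?x1 // max_l; last qlra.
  by rewrite gu //; ring.
have GR x : u m.+1 <= x -> G x = v m.+1 + (x - u m.+1).
  move=> x1; rewrite /G min_r ?clamp_ge ?max_r ?gu ?sE //; try qlra.
exists G, (Num.min k (Num.min s 1)); split.
- by rewrite /G; have := @cts_clamp R R (u m) (u m.+1) id (@ctsid R) => ?; cts.
- by rewrite !lt_min k0 s0 ltr01.
- set K := Num.min _ _.
  have K1 : K <= k by rewrite /K ge_min lexx.
  have K2 : K <= s by rewrite /K !ge_min lexx /= orbT.
  have K3 : K <= 1 by rewrite /K !ge_min lexx /= !orbT.
  have a1 x y : x < y -> y <= u m -> K * (y - x) <= G y - G x.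
    move=> xy yu; rewrite !GL //; last qlra.
    by apply: le_trans (kg _ _ xy); rewrite ler_wpM2r //; qlra.
  have a2 x y : x < y -> u m <= x -> y <= u m.+1 -> K * (y - x) <= G y - G x.
    move=> xy xu yu; rewrite !GM; [|apply/andP; split; qlra..].
    have -> : v m + s * (y - u m) - (v m + s * (x - u m)) = s * (y - x) by ring.
    by rewrite ler_wpM2r //; qlra.
  have a3 x y : x < y -> u m.+1 <= x -> K * (y - x) <= G y - G x.
    move=> xy xu; rewrite !GR; [|qlra..].
    have -> : v m.+1 + (y - u m.+1) - (v m.+1 + (x - u m.+1)) = 1 * (y - x) by ring.
    by rewrite ler_wpM2r //; qlra.
  have a4 x y : x < y -> y <= u m.+1 -> K * (y - x) <= G y - G x.
    move=> xy yu; have [c|c] := le_or_lt y (u m); first exact: a1.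
    have [d|d] := le_or_lt (u m) x; first exact: a2.
    have h1 := a1 _ _ d (lexx _); have h2 := a2 _ _ c (lexx _) yu.
    by move: h1 h2; rewrite !mulrBr; qlra.
  move=> x y xy; have [c|c] := le_or_lt y (u m.+1); first exact: a4.
  have [d|d] := le_or_lt (u m.+1) x; first exact: a3.
  have h1 := a4 _ _ d (lexx _); have h2 := a3 _ _ c (lexx _).
  by move: h1 h2; rewrite !mulrBr; qlra.
- move=> i; rewrite leq_eqVlt => /orP[/eqP ->|im]; first by rewrite GR // subrr addr0.
  rewrite GL ?gu //.
  have mono j : (i + j <= m)%N -> u i <= u (i + j)%N.
    elim: j => [|j IHj] ij; first by rewrite addn0.
    apply: le_trans (IHj _) _; first by rewrite (leq_trans _ ij) // leq_add2l.
    by rewrite addnS ltW // incu // ltnS ltnW // -addnS.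
  by have := mono (m - i)%N; rewrite subnKC //; exact.
- exact: GR.
Qed.

End Interpolation.

(** * Uniform bounds from compactness and from finiteness *)

Section Compactness.
Context {R : realType}.

Lemma pos_min (T : topologicalType) (A : set T) (g : T -> R) :
  compact A -> continuous g -> (forall x, A x -> 0 < g x) ->
  exists2 r, 0 < r & forall x, A x -> r <= g x.
Proof.
move=> cA cg g0; have [A0|A0] := pselect (A !=set0); last first.
  by exists 1 => // x Ax; case: A0; exists x.
have [|c] := compact_EVT_min A0 cA (f := g); first exact: continuous_subspaceT.
rewrite inE => Ac gc; exists (g c); first exact: g0.
by move=> x Ax; apply: gc; rewrite inE.
Qed.

Lemma compact_itv (a b : R) : compact [set x | a <= x <= b].
Proof.
have -> : [set x | a <= x <= b] = `[a, b]%classic; last exact: segment_compact.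
by apply/seteqP; split=> x /=; rewrite in_itv.
Qed.

Lemma compact_sub_ge (T : topologicalType) (A : set T) (g : T -> R) (c : R) :
  compact A -> continuous g -> compact (A `&` [set x | c <= g x]).
Proof.
move=> cA cg; apply: compact_closedI => //.
have -> : [set x | c <= g x] = g @^-1` [set y | c <= y] by [].
by apply: closed_comp; [move=> x _; exact: cg | exact: closed_ge].
Qed.

(** On the compact set of pairs whose values differ by at least [e], the distance of the arguments
    is positive and therefore bounded below. *)
Lemma unif_cts (f : R -> R) (a b e : R) : continuous f -> 0 < e ->
  exists2 h, 0 < h & forall s t, a <= s <= b -> a <= t <= b -> `|s - t| < h ->
    `|f s - f t| < e.
Proof.
move=> cf e0.
have cg : continuous (fun p : R * R => `|f p.1 - f p.2|) by cts.
have cA := compact_sub_ge (c := e) (compact_setX (compact_itv (a := a) (b := b))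
  (compact_itv (a := a) (b := b))) cg.
have [||h h0 hh] := pos_min cA (g := fun p => `|p.1 - p.2|); first by cts.
  move=> [s t] /= [_ est]; rewrite normr_gt0 subr_eq0; apply/eqP => E.
  by move: est; rewrite E subrr normr0; qlra.
exists h => // s t sab tab st; rewrite ltNge; apply/negP => est.
by have := hh (s, t) (conj (conj sab tab) est); rewrite leNgt st.
Qed.

Lemma fin_delta (n : nat) (P : nat -> R -> Prop) :
  (forall j d d', 0 < d' -> d' <= d -> P j d -> P j d') ->
  (forall j, (j <= n)%N -> exists2 d, 0 < d & P j d) ->
  exists2 d, 0 < d & forall j, (j <= n)%N -> P j d.
Proof.
move=> mono; elim: n => [|n IH] H.
  by have [d d0 Pd] := H 0%N isT; exists d => // -[].
have [|d d0 Pd] := IH; first by move=> j jn; apply: H; rewrite leqW.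
have [d' d0' Pd'] := H n.+1 (leqnn _).
have m0 : 0 < Num.min d d' by rewrite lt_min d0.
exists (Num.min d d') => // j; rewrite leq_eqVlt => /orP[/eqP ->|jn].
  by apply: mono Pd' => //; rewrite ge_min lexx orbT.
by apply: mono (Pd _ jn) => //; rewrite ge_min lexx.
Qed.

(** Each point of [D] misses one of the two outer thirds of the interval. The length that remains
    depends only on the size of [D]; this is what bounds the number of combing moves in advance. *)
Lemma avoid (D : seq R) (a b : R) : a < b ->
  exists r1 r2, [/\ a <= r1, r2 <= b, r2 - r1 = (b - a) / 3 ^+ size D
    & forall d, d \in D -> d < r1 \/ r2 < d].
Proof.
elim: D a b => [|d D IH] a b ab.
  by exists a, b; split=> //; rewrite expr0 divr1.
have third : (b - a) / 3 / 3 ^+ size D = (b - a) / 3 ^+ size (d :: D).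
  by rewrite /= exprS invfM; ring.
have [dl|dl] := ltP d (b - (b - a) / 3).
  have [|r1 [r2 [h1 h2 h3 h4]]] := IH (b - (b - a) / 3) b; first qlra.
  exists r1, r2; split=> //; first qlra.
    by rewrite h3 -third; congr (_ / _); ring.
  by move=> x; rewrite inE => /orP[/eqP ->|/h4 //]; left; qlra.
have [|r1 [r2 [h1 h2 h3 h4]]] := IH a (a + (b - a) / 3); first qlra.
exists r1, r2; split=> //; first qlra.
  by rewrite h3 -third; congr (_ / _); ring.
by move=> x; rewrite inE => /orP[/eqP ->|/h4 //]; right; qlra.
Qed.

End Compactness.

Section Trapezoid.
Context {R : realType}.

Definition trap (r1 r2 d : R) := clamp 0 1 ((r2 - d) / (r2 - r1)).

Lemma trap1 r1 r2 d : r1 < r2 -> d <= r1 -> trap r1 r2 d = 1.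
Proof.
move=> r12 dr; apply: clamp_ge; rewrite ?ler01 // ler_pdivlMr; qlra.
Qed.

Lemma trap0 r1 r2 d : r1 < r2 -> r2 <= d -> trap r1 r2 d = 0.
Proof.
move=> r12 dr; apply: clamp_le; rewrite ?ler01 // ler_pdivrMr; qlra.
Qed.

Lemma trap01 r1 r2 d : 0 <= trap r1 r2 d <= 1.
Proof. by apply: clamp_itv; exact: ler01. Qed.

Lemma trap_lip r1 r2 d d' : r1 < r2 ->
  `|trap r1 r2 d - trap r1 r2 d'| <= `|d - d'| / (r2 - r1).
Proof.
move=> r12; apply: le_trans (clamp_lip _ _ _ _) _.
rewrite -mulrBl normrM [`|_^-1|]gtr0_norm ?invr_gt0 ?subr_gt0 //.
by rewrite ler_pM2r ?invr_gt0 ?subr_gt0 //; mm.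
Qed.

Lemma cts_trap (T : topologicalType) r1 r2 (f : T -> R) :
  continuous f -> continuous (fun x => trap r1 r2 (f x)).
Proof.
by move=> cf; rewrite /trap; apply: cts_clamp; cts.
Qed.

(** The trapezoid has slope at most [1 / (r2 - r1)], so the bound on [v] leaves the fibres expanding
    by 1/2. In contrast to [push], the whole neighbourhood of radius [r1] is translated rigidly. *)
Lemma iso_bump (v p zeta : R -> R) r1 r2 :
  continuous v -> continuous p -> continuous zeta -> r1 < r2 ->
  (forall x, `|v x| <= (r2 - r1) / 2) ->
  iso (fun q : pt R => (q.1.1, q.1.2 + v q.1.1 *
    (trap r1 r2 `|q.1.2 - p q.1.1| * trap r1 r2 `|q.2 - zeta q.1.1|), q.2)).
Proof.
move=> cv cp cz r12 vb.
pose phi (q : pt R) := q.1.2 + v q.1.1 *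
    (trap r1 r2 `|q.1.2 - p q.1.1| * trap r1 r2 `|q.2 - zeta q.1.1|).
apply: (@iso_mono _ phi (1 / 2)).
- rewrite /phi.
  have ct : continuous (trap r1 r2) by apply: cts_trap; cts.
  by cts.
- qlra.
move=> x y y' z yy'; rewrite /phi /=.
have /andP[u0 u1] := trap01 r1 r2 `|z - zeta x|.
have tl := @trap_lip r1 r2 `|y' - p x| `|y - p x| r12.
move: (trap _ _ `|z - zeta x|) u0 u1 => u u0 u1.
move: (trap _ _ `|y' - p x|) (trap _ _ `|y - p x|) tl => t' t tl.
have {}tl : `|t' - t| <= (y' - y) / (r2 - r1).
  apply: le_trans tl _; rewrite ler_pM2r ?invr_gt0 ?subr_gt0 //.
  by clear -yy'; mm.
have d0 : 0 < r2 - r1 by rewrite subr_gt0.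
have main : `|v x * ((t' - t) * u)| <= (y' - y) / 2.
  rewrite !normrM (ger0_norm u0).
  have -> : (y' - y) / 2 = (r2 - r1) / 2 * ((y' - y) / (r2 - r1) * 1).
    by field; rewrite gt_eqF.
  apply: ler_pM => //; first by rewrite mulr_ge0.
  by apply: ler_pM.
have -> : y' + v x * (t' * u) - (y + v x * (t * u)) =
          (y' - y) + v x * ((t' - t) * u) by ring.
by move: main; rewrite ler_norml => /andP[]; qlra.
Qed.

End Trapezoid.

(** * Combing a zigzag *)

Section Zigzag.
Context {R : realType}.
Implicit Types (w b p zeta vy vz : nat -> R).

Definition between (a b x : R) := (a <= x <= b) || (b <= x <= a).

Definition strand (w : nat -> R) (k : nat) (x : R) := between (w k) (w k.+1) x.

Definition zset (N : nat) (w : nat -> R) (Y Z : nat -> R -> R) : set (pt R) :=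
  [set q | exists i x, [/\ (i <= N)%N, strand w i x & q = (x, Y i x, Z i x)]].

(** Strand [N] is exempt from containment, since it leads back to the outermost wall. The margin 2
    leaves room for a cut-off of width 1 beyond strand [k] and for the initial slope of width at
    most 1 at the wall [w i]. *)
Definition nested (N : nat) (w : nat -> R) := forall i k x,
  (i < k < N)%N -> strand w k x -> strand w i x /\ 2 <= `|x - w i|.

Lemma nested_near N w i k x x' : nested N w -> (i < k < N)%N -> strand w k x' ->
  `|x - x'| <= 1 -> 1 <= `|x - w i|.
Proof.
move=> nw ik sx xx; have [_ h] := nw _ _ _ ik sx.
by have := ler_distD x x' (w i); rewrite distrC in xx; qlra.
Qed.

(* The first [k] strands are straight: strand [i.+1] leaves strand [i] at the
   wall [w i.+1] and then stays at [b i.+1]; the other strands only satisfy the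
   local condition that consecutive ones part in the direction of [y]. *)
Record combed (N : nat) (w : nat -> R) (k : nat) (Y Z : nat -> R -> R)
    (b : nat -> R) (d : R) : Prop := Combed {
  combed_ctsY : forall i, continuous (Y i);
  combed_ctsZ : forall i, continuous (Z i);
  combed_disj : forall i j x, (i < j <= N)%N -> strand w i x -> strand w j x ->
    Y i x = Y j x -> Z i x = Z j x ->
    j = i.+1 /\ x = w j \/ [/\ i = 0%N, j = N & x = w 0%N];
  combed_row0 : (0 < k)%N -> forall x, strand w 0 x -> Y 0%N x = b 0%N /\ Z 0%N x = 0;
  combed_row : forall i x, (i.+1 < k)%N -> strand w i.+1 x ->
    Y i.+1 x = Num.min (b i + `|x - w i.+1|) (b i.+1) /\ Z i.+1 x = 0;
  combed_b : forall i, (i.+1 < k)%N -> b i < b i.+1 <= b i + 1;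
  combed_cone : forall j x, (k <= j.+1 <= N)%N -> strand w j.+1 x ->
    `|x - w j.+1| <= d -> Y j.+1 x = Y j x + `|x - w j.+1| /\ Z j.+1 x = Z j x;
  combed_cone0 : forall x, strand w 0 x -> strand w N x -> `|x - w 0%N| <= d ->
    Y 0%N x = Y N x + `|x - w 0%N| /\ Z 0%N x = Z N x;
  combed_d : 0 < d <= 1 }.

Lemma betweenl (a b : R) : between a b a.
Proof. by rewrite /between lexx andbT /=; exact: le_total. Qed.

Lemma betweenr (a b : R) : between a b b.
Proof. by rewrite /between lexx andbT /=; exact: le_total. Qed.

Lemma combed_static N w k Y Z b d i x : combed N w k Y Z b d -> (i < k)%N ->
  strand w i x -> 1 <= `|x - w i| -> Y i x = b i /\ Z i x = 0.
Proof.
move=> C ik si x1; case: i ik si x1 => [|i] ik si x1.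
  exact: (combed_row0 C).
have [-> ->] := combed_row C ik si; split=> //.
by have /andP[_ h] := combed_b C ik; rewrite min_r //; qlra.
Qed.

(** The straight strands lie at distance at least [r2] from the moving one, where the bump vanishes.
    The later strands are moved somehow, and only their cones matter: at the later walls the
    distances from the moving strand avoid the interval from [r1] to [r2], so near such a wall the
    bump factor is constant, and both strands that meet there are translated by the same vector. *)
Lemma zmove N w k Y Z b d (p zeta vy vz : R -> R) (r1 r2 e : R)
    (P : pt R -> pt R) :
  nested N w -> combed N w k Y Z b d -> (0 < k < N)%N ->
  continuous p -> continuous zeta -> continuous vy -> continuous vz ->
  (forall x, strand w k x -> p x = Y k x /\ zeta x = Z k x) ->
  0 < r1 -> r1 < r2 ->
  (forall j, (k <= j < N)%N ->
     (`|Y j.+1 (w j.+1) - p (w j.+1)| < r1 \/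
      r2 < `|Y j.+1 (w j.+1) - p (w j.+1)|) /\
     (`|Z j.+1 (w j.+1) - zeta (w j.+1)| < r1 \/
      r2 < `|Z j.+1 (w j.+1) - zeta (w j.+1)|)) ->
  (forall x, vy x != 0 \/ vz x != 0 ->
     (exists2 x', strand w k x' & `|x - x'| <= 1) /\
     forall i, (i < k)%N -> r2 <= Num.max `|b i - p x| `|zeta x|) ->
  0 < e -> (forall x, `|x - w k| <= e -> vy x = 0 /\ vz x = 0) ->
  iso P ->
  (forall x y z, let L := trap r1 r2 `|y - p x| * trap r1 r2 `|z - zeta x| in
     P (x, y, z) = (x, y + vy x * L, z + vz x * L)) ->
  exists Y' Z' d', [/\ combed N w k Y' Z' b d', P @` zset N w Y Z = zset N w Y' Z'
    & forall x, strand w k x -> Y' k x = Y k x + vy x /\ Z' k x = Z k x + vz x].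
Proof.
move=> nw C /andP[k0 kN] cp cz cvy cvz pk r10 r12 av supp e0 ve iP PE.
have cY : forall i, continuous (Y i) := combed_ctsY C.
have cZ : forall i, continuous (Z i) := combed_ctsZ C.
pose L i x := trap r1 r2 `|Y i x - p x| * trap r1 r2 `|Z i x - zeta x|.
pose Y' i x := Y i x + vy x * L i x.
pose Z' i x := Z i x + vz x * L i x.
have PY i x : P (x, Y i x, Z i x) = (x, Y' i x, Z' i x) by rewrite PE.
have v0 x : (vy x != 0 \/ vz x != 0) \/ (vy x = 0 /\ vz x = 0).
  have [|] := eqVneq (vy x) 0; last by left; left.
  by have [|] := eqVneq (vz x) 0; [right | left; right].
have fixv i x : vy x = 0 /\ vz x = 0 -> Y' i x = Y i x /\ Z' i x = Z i x.
  by rewrite /Y' /Z' => -[-> ->]; rewrite !mul0r !addr0.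
have fixrow i x : (i < k)%N -> strand w i x -> Y' i x = Y i x /\ Z' i x = Z i x.
  move=> ik si; have [vn|/fixv//] := v0 x.
  have [[x' sx' xx'] mx] := supp _ vn.
  have ikN : (i < k < N)%N by rewrite ik.
  have x1 := nested_near nw ikN sx' xx'.
  have [Yb Zb] := combed_static C ik si x1.
  have L0 : L i x = 0.
    rewrite /L Yb Zb sub0r normrN; move: (mx _ ik); rewrite le_max => /orP[m|m].
      by rewrite trap0 // mul0r.
    by rewrite (@trap0 _ _ _ `|zeta x|) // mulr0.
  by rewrite /Y' /Z' L0 !mulr0 !addr0.
have /andP[d0 d1] := combed_d C.
have cL i : continuous (L i).
  rewrite /L; have ct : continuous (trap r1 r2) by apply: cts_trap; cts.
  by have := cY i; have := cZ i => ? ?; cts.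
(* near the wall [w j.+1] both trapezoids are locally constant *)
have loc (f g : R -> R) (c : R) : continuous f -> continuous g ->
    (`|f c - g c| < r1 \/ r2 < `|f c - g c|) ->
    exists2 dl, 0 < dl & exists t, forall x (u : R), `|x - c| <= dl ->
      u = f x -> trap r1 r2 `|u - g x| = t.
  move=> cf cg; have cn : continuous (fun x => `|f x - g x|) by cts.
  have cond (Q : R -> Prop) : (\forall x \near c, Q x) ->
      exists2 dl, 0 < dl & forall x, `|x - c| <= dl -> Q x.
    move=> /nbhs_ballP[dl /= dl0 dlQ]; exists (dl / 2); first by rewrite divr_gt0.
    move=> x xc; apply: dlQ; rewrite /ball /= distrC.
    by apply: le_lt_trans xc _; rewrite ltr_pdivrMr //; qlra.
  case=> lt.
    have [dl dl0 dlQ] := cond _ (@cvgr_lt _ _ _ _ _ _ (cn c) _ lt).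
    exists dl => //; exists 1 => x u xc ->; apply: trap1 => //.
    exact/ltW/dlQ.
  have [dl dl0 dlQ] := cond _ (@cvgr_gt _ _ _ _ _ _ (cn c) _ lt).
  exists dl => //; exists 0 => x u xc ->; apply: trap0 => //.
  exact/ltW/dlQ.
pose Q j dl := (k <= j < N)%N -> forall x, strand w j.+1 x ->
  `|x - w j.+1| <= dl -> L j.+1 x = L j x /\ `|x - w j.+1| <= d.
have [j u u' u0 uu' QQ|j jN|dl dl0 Qdl] := @fin_delta R N Q.
- by move=> jkN x sx xu; apply: QQ => //; qlra.
- have [jkN|jkN] := boolP (k <= j < N)%N; last first.
    by exists 1 => // jk; rewrite jk in jkN.
  have [a1 a2] := av _ jkN.
  have /andP[kj jN'] := jkN.
  have ww : strand w j.+1 (w j.+1) by exact: betweenl.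
  have [||Yw Zw] := combed_cone C (j := j) (x := w j.+1) _ ww.
  + by rewrite jN' andbT leqW.
  + by rewrite subrr normr0 ltW.
  rewrite subrr normr0 addr0 in Yw.
  have [t1 t10 [T1 h1]] := loc _ _ _ (cY j.+1) cp a1.
  have [t2 t20 [T2 h2]] := loc _ _ _ (cZ j.+1) cz a2.
  rewrite Yw in a1; rewrite Zw in a2.
  have [t3 t30 [T3 h3]] := loc _ _ _ (cY j) cp a1.
  have [t4 t40 [T4 h4]] := loc _ _ _ (cZ j) cz a2.
  have E13 : T1 = T3.
    have <- := h1 (w j.+1) (Y j.+1 (w j.+1)); rewrite ?subrr ?normr0 ?(ltW t10) //.
    by rewrite Yw; apply: h3; rewrite ?subrr ?normr0 ?(ltW t30).
  have E24 : T2 = T4.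
    have <- := h2 (w j.+1) (Z j.+1 (w j.+1)); rewrite ?subrr ?normr0 ?(ltW t20) //.
    by rewrite Zw; apply: h4; rewrite ?subrr ?normr0 ?(ltW t40).
  exists (Num.min d (Num.min (Num.min t1 t2) (Num.min t3 t4))).
    by rewrite !lt_min d0 t10 t20 t30 t40.
  move=> _ x sx; rewrite !le_min => /and3P[xd /andP[x1 x2] /andP[x3 x4]].
  by rewrite /L (h1 x) // (h2 x) // (h3 x) // (h4 x) // E13 E24.
(* The bound 1/2 keeps the cone at [w 0] out of the support of the move, which by nesting stays at
   distance at least 1 from that wall. *)
exists Y', Z', (Num.min (Num.min dl d) (Num.min e (1 / 2))); split.
- split.
  + by move=> i; rewrite /Y'; have := cY i; have := cL i => ? ?; cts.
  + by move=> i; rewrite /Z'; have := cZ i; have := cL i => ? ?; cts.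
  (* The move is injective and preserves x, so a coincidence of two strands after it was one before
     it. *)
  + move=> i j x ij si sj EY EZ; apply: (combed_disj C ij si sj).
      have [_ [Pi [_ PK _]]] := iso_homeo iP.
      have := congr1 Pi (PY i x); rewrite PK EY EZ -PY PK => -[]; exact.
    have [_ [Pi [_ PK _]]] := iso_homeo iP.
    have := congr1 Pi (PY i x); rewrite PK EY EZ -PY PK => -[]; exact.
  + move=> _ x sx; have [-> ->] := fixrow 0%N x k0 sx.
    exact: (combed_row0 C).
  + move=> i x ik sx; have [-> ->] := fixrow _ _ ik sx.
    exact: (combed_row C).
  + exact: (combed_b C).
  + move=> j x jk sx; rewrite !le_min => /andP[/andP[xdl xd] /andP[xe _]].
    have [EY EZ] := combed_cone C jk sx xd.
    move/andP: jk => [kj jN].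
    (* At the wall [w k] itself, where the moving strand leaves its predecessor, the move vanishes
       by assumption; at later walls the bump factors of both strands agree. *)
    move: kj; rewrite leq_eqVlt => /orP[/eqP kE|kj].
      have vx : vy x = 0 /\ vz x = 0 by apply: ve; rewrite kE.
      by rewrite !(fixv _ _ vx).1 !(fixv _ _ vx).2.
    have [|LE _] := Qdl j (ltnW jN) _ x sx xdl; first by rewrite -ltnS kj.
    by rewrite /Y' /Z' EY EZ LE; split=> //; ring.
  + move=> x s0 sN; rewrite !le_min => /andP[/andP[xdl xd] /andP[xe x2]].
    have vx : vy x = 0 /\ vz x = 0.
      have [vn|//] := v0 x; have [[x' sx' xx'] _] := supp _ vn.
      have kN' : (0 < k < N)%N by rewrite k0.
      by have := nested_near nw kN' sx' xx'; qlra.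
    by rewrite !(fixv _ _ vx).1 !(fixv _ _ vx).2; apply: (combed_cone0 C).
  + rewrite !lt_min !ge_min dl0 d0 e0 d1 /=; qlra.
- apply/seteqP; split=> [_ [_ [i [x [iN sx ->]]] <-]|_ [i [x [iN sx ->]]]].
    by exists i, x; rewrite PY.
  by exists (x, Y i x, Z i x); [exists i, x | rewrite PY].
- move=> x sx; have [pE zE] := pk _ sx.
  by rewrite /Y' /Z' /L pE zE !subrr normr0 !trap1 ?(ltW r10) // !mulr1.
Qed.

End Zigzag.

(** * Drawing a strand back to its first wall *)

Section Combing.
Context {R : realType}.
Lemma min_lip (s s' t : R) : `|Num.min s t - Num.min s' t| <= `|s - s'|.
Proof. by clear; mm. Qed.

Lemma far_shift (b A B D rho : R) : `|B - A| < rho ->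
  rho + rho <= Num.max `|b - A| `|D| -> rho <= Num.max `|b - B| `|D|.
Proof.
move=> BA; rewrite !le_max => /orP[h|h]; apply/orP; [left|right].
  have := ler_distD B b A; qlra.
have := normr_ge0 (B - A); qlra.
Qed.

Lemma descent (d l h A : R) : 0 < h -> d < l -> 0 <= A ->
  [/\ d <= Num.max d (l - (A + h / 2)) <= l, d <= Num.max d (l - A) <= l,
      Num.max d (l - (A + h / 2)) <= Num.max d (l - A)
    & `|Num.max d (l - (A + h / 2)) - Num.max d (l - A)| < h].
Proof. by clear => h0 dl A0; split; mmcase; qlra. Qed.

Variables (N : nat) (w : nat -> R).
Hypothesis nw : nested N w.

(** Half the length of the interval that [avoid] leaves between [rho / 2] and [rho] for two
    distances at each of the [N - k] later walls; the last half is the velocity bound of [iso_bump].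
    The value is independent of the present course of the later strands, so finitely many moves of
    this size suffice. *)
Definition step (k : nat) (rho : R) := (rho - rho / 2) / 3 ^+ (2 * (N - k)) / 2.

Lemma step_gt0 k rho : 0 < rho -> 0 < step k rho.
Proof. by move=> r0; rewrite /step !divr_gt0 ?exprn_gt0 //; qlra. Qed.

Lemma step_lt k rho : 0 < rho -> step k rho <= rho.
Proof.
move=> r0; rewrite /step; have : (rho - rho / 2) / 3 ^+ (2 * (N - k)) <= rho - rho / 2.
  by rewrite ler_pdivrMr ?exprn_gt0 // ler_peMr ?exprn_ege1 //; qlra.
qlra.
Qed.

(** The radii of the bump are chosen here, depending on where the later strands happen to be. [dir]
    selects the coordinate: y if true, and otherwise z, by conjugation with [swap_yz]. *)
Lemma move_strand (dir : bool) k Y Z b d (p zeta v : R -> R) (rho e : R) :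
  combed N w k Y Z b d -> (0 < k < N)%N ->
  continuous p -> continuous zeta -> continuous v ->
  (forall x, strand w k x -> p x = Y k x /\ zeta x = Z k x) ->
  0 < rho -> (forall x, `|v x| <= step k rho) ->
  (forall x, v x != 0 ->
     (exists2 x', strand w k x' & `|x - x'| <= 1) /\
     forall i, (i < k)%N -> rho <= Num.max `|b i - p x| `|zeta x|) ->
  0 < e -> (forall x, `|x - w k| <= e -> v x = 0) ->
  exists P Y' Z' d', [/\ iso P, combed N w k Y' Z' b d',
    P @` zset N w Y Z = zset N w Y' Z'
    & forall x, strand w k x -> Y' k x = Y k x + (if dir then v x else 0) /\
        Z' k x = Z k x + (if dir then 0 else v x)].
Proof.
move=> C kN cp cz cv pk r0 vb supp e0 ve.
pose D := flatten [seq [:: `|Y j.+1 (w j.+1) - p (w j.+1)|;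
                          `|Z j.+1 (w j.+1) - zeta (w j.+1)|] | j <- iota k (N - k)].
have sD : size D = (2 * (N - k))%N.
  rewrite /D; elim: (N - k)%N {1}k => [|m IH] i /=; first by rewrite muln0.
  by rewrite IH mulnS.
have [|r1 [r2 [h1 h2 h3 h4]]] := @avoid R D (rho / 2) rho; first qlra.
have DD j : (k <= j < N)%N -> `|Y j.+1 (w j.+1) - p (w j.+1)| \in D /\
    `|Z j.+1 (w j.+1) - zeta (w j.+1)| \in D.
  move=> /andP[kj jN].
  have ji : j \in iota k (N - k).
    by rewrite mem_iota kj subnKC // ltnW //; case/andP: kN.
  split; apply/flattenP.
    exists [:: `|Y j.+1 (w j.+1) - p (w j.+1)|; `|Z j.+1 (w j.+1) - zeta (w j.+1)|].
      by apply/mapP; exists j.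
    by rewrite !inE eqxx.
  exists [:: `|Y j.+1 (w j.+1) - p (w j.+1)|; `|Z j.+1 (w j.+1) - zeta (w j.+1)|].
    by apply/mapP; exists j.
  by rewrite !inE eqxx orbT.
have s0 := step_gt0 k r0.
rewrite sD in h3.
have r12h : (r2 - r1) / 2 = step k rho by rewrite h3.
have r12 : r1 < r2 by qlra.
have r10 : 0 < r1 by qlra.
have supp' x : v x != 0 -> (exists2 x', strand w k x' & `|x - x'| <= 1) /\
     forall i, (i < k)%N -> r2 <= Num.max `|b i - p x| `|zeta x|.
  by move=> /supp[h5 h6]; split=> // i /h6; qlra.
have av j (kj : (k <= j < N)%N) : (`|Y j.+1 (w j.+1) - p (w j.+1)| < r1 \/
      r2 < `|Y j.+1 (w j.+1) - p (w j.+1)|) /\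
     (`|Z j.+1 (w j.+1) - zeta (w j.+1)| < r1 \/
      r2 < `|Z j.+1 (w j.+1) - zeta (w j.+1)|).
  by have [i1 i2] := DD j kj; split; exact: h4.
have iB (q1 q2 : R -> R) : continuous q1 -> continuous q2 ->
    iso (fun q : pt R => (q.1.1, q.1.2 + v q.1.1 *
    (trap r1 r2 `|q.1.2 - q1 q.1.1| * trap r1 r2 `|q.2 - q2 q.1.1|), q.2)).
  by move=> c1 c2; apply: iso_bump => // x; rewrite r12h.
case: dir.
  have [x|x|x y z|Y' [Z' [d' [C' PK vk]]]] := @zmove _ _ _ _ _ _ _ _ p zeta v
      (fun=> 0) r1 r2 e _ nw C kN cp cz cv (@ctsC R R 0) pk r10 r12 av _ e0 _ (iB _ _ cp cz).
  + by case=> [/supp' //|]; rewrite eqxx.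
  + by move=> /ve.
  + by rewrite /= mul0r addr0.
  by exists (fun q : pt R => (q.1.1, q.1.2 + v q.1.1 *
    (trap r1 r2 `|q.1.2 - p q.1.1| * trap r1 r2 `|q.2 - zeta q.1.1|), q.2)), Y', Z', d'; split=> //; exact: iB.
have iB' := iso_swap_yz (iB _ _ cz cp).
have [x|x|x y z|Y' [Z' [d' [C' PK vk]]]] := @zmove _ _ _ _ _ _ _ _ p zeta
      (fun=> 0) v r1 r2 e _ nw C kN cp cz (@ctsC R R 0) cv pk r10 r12 av _ e0 _ iB'.
+ by case=> [|/supp' //]; rewrite eqxx.
+ by move=> /ve.
+ by rewrite /swap_yz /= mul0r addr0 (mulrC (trap _ _ `|z - _|)).
by do 4 eexists; split; [exact: iB'| exact: C'| exact: PK| exact: vk].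
Qed.

(** At stage [s] the strand follows its old course over the length [s] from the wall [w k] and from
    there on keeps the values of y and z that it has reached. The earlier strands are constant
    points [(b i, 0)] over the whole strand, so values that miss them at one x miss them at every x.
    Letting [s] decrease from the full length to [d] leaves only the initial cone followed by a
    horizontal segment. *)
Lemma comb_step k Y Z b d : combed N w k Y Z b d -> (0 < k < N)%N ->
  1 < `|w k.+1 - w k| ->
  exists P Y' Z' b' d', [/\ iso P, combed N w k.+1 Y' Z' b' d'
    & P @` zset N w Y Z = zset N w Y' Z'].
Proof.
move=> C kN wk; have /andP[k0 kN'] := kN.
pose l := `|w k.+1 - w k|.
have l0 : 0 < l by apply: lt_trans wk.
have wn : w k.+1 - w k != 0 by rewrite -normr_gt0.
pose u := (w k.+1 - w k) / l.
have uu : u * u = 1.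
  rewrite /u mulrACA -invfM -expr2 -expr2 /l real_normK ?num_real //.
  by rewrite divff // sqrf_eq0.
have wE : w k.+1 = w k + u * l by rewrite /u divfK ?gt_eqF //; ring.
have u1 : u = 1 \/ u = -1.
  have /eqP : (u - 1) * (u + 1) = 0 by rewrite mulrDr mulrBl uu; ring.
  by rewrite mulf_eq0 => /orP[/eqP|/eqP] h; [left|right]; qlra.
have nu (x : R) : `|u * x| = `|x|.
  by case: u1 => ->; rewrite ?mul1r // mulN1r normrN.
have strP x : strand w k x <-> 0 <= u * (x - w k) <= l.
  rewrite /strand /between wE; case: u1 => ->; split.
  - by case/orP=> /andP[? ?]; apply/andP; split; qlra.
  - by move=> /andP[? ?]; apply/orP; left; apply/andP; split; qlra.
  - by case/orP=> /andP[? ?]; apply/andP; split; qlra.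
  - by move=> /andP[? ?]; apply/orP; right; apply/andP; split; qlra.
have /andP[d0 d1] := combed_d C.
have kE : k.-1.+1 = k by rewrite prednK.
have cY : continuous (Y k) by exact: (combed_ctsY C).
have cZ : continuous (Z k) by exact: (combed_ctsZ C).
pose m s := w k + u * s.
have mI s : 0 <= s <= l -> strand w k (m s).
  by move=> sl; apply/strP; rewrite /m addrC addKr mulrA uu mul1r.
have stat i x : (i < k)%N -> strand w k x -> Y i x = b i /\ Z i x = 0.
  move=> ik sx; have ikN : (i < k < N)%N by rewrite ik.
  have [si x2] := nw ikN sx; apply: (combed_static C ik) => //; qlra.
have start s : 0 <= s <= l -> s <= d -> Y k (m s) = b k.-1 + s /\ Z k (m s) = 0.
  move=> /andP[s0 sl] sd; have sI : strand w k (m s) by apply: mI; rewrite s0.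
  have kk : (k <= k.-1.+1 <= N)%N by rewrite kE leqnn ltnW.
  have := combed_cone C kk; rewrite kE => /(_ _ sI).
  have -> : `|m s - w k| = s by rewrite /m addrC addKr nu ger0_norm.
  move=> /(_ sd)[-> ->].
  have km : (k.-1 < k)%N by rewrite ltn_predL.
  by have [-> ->] := stat _ _ km sI.
have dl : d < l by apply: le_lt_trans wk.
have cm : continuous m by rewrite /m; cts.
have cYm : continuous (fun s => Y k (m s)) by cts.
have cZm : continuous (fun s => Z k (m s)) by cts.
pose far i s := Num.max `|b i - Y k (m s)| `|Z k (m s)|.
have cfar i : continuous (far i) by rewrite /far; cts.
(* Beyond its cone the course of the strand stays at a positive distance from each of the finitely
   many points [(b i, 0)]. *)
have [i r r' r0 rr H ik s sdl|i ik|rho2 rho20 farP] :=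
  @fin_delta R k.-1 (fun i r => (i < k)%N -> forall s, d <= s <= l -> r <= far i s).
- exact: le_trans rr (H ik s sdl).
- have [|r r0 hr] := pos_min (compact_itv (a := d) (b := l)) (cfar i); last by exists r.
  move=> s /= /andP[ds sl]; have s0 : 0 < s := lt_le_trans d0 ds.
  have sI : strand w k (m s) by apply: mI; rewrite (ltW s0).
  have ik' : (i < k)%N by rewrite -kE ltnS.
  have ikN : (i < k < N)%N by rewrite ik'.
  have [si _] := nw ikN sI; have [Yb Zb] := stat _ _ ik' sI.
  rewrite lt_max !normr_gt0 subr_eq0 -negb_and; apply/negP => /andP[/eqP bY /eqP bZ].
  have [|||[_ ms]|[_ kN1 _]] := combed_disj C (i := i) (j := k) _ si sI; rewrite ?Yb ?Zb //.
  + by rewrite ik' ltnW.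
  + move: ms; rewrite /m => /eqP; rewrite -subr_eq0 addrC addKr.
    by rewrite -normr_eq0 nu normr_eq0 gt_eqF.
  + by rewrite kN1 ltnn in kN'.
(* Half of the distance is kept in reserve: between the y-move and the z-move of one stage the
   strand has the new y and the old z, which is no point of its course but is closer than [rho] to
   one; [far_shift] pays for this. *)
pose rho := rho2 / 2.
have rho0 : 0 < rho by rewrite divr_gt0.
pose st := step k rho; have st0 : 0 < st by apply: step_gt0.
have st1 : st <= rho by apply: step_lt.
have {}farP i s : (i < k)%N -> d <= s <= l -> rho + rho <= far i s.
  move=> ik sdl; have := farP i _ ik s sdl; rewrite -ltnS kE => /(_ ik).
  by apply: le_trans; rewrite /rho; qlra.
have [hy hy0 hyP] := unif_cts 0 l cYm st0.
have [hz hz0 hzP] := unif_cts 0 l cZm st0.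
pose h := Num.min hy hz; have h0 : 0 < h by rewrite lt_min hy0.
pose c x := clamp 0 l (u * (x - w k)).
have c0l x : 0 <= c x <= l by apply: clamp_itv; exact: ltW.
pose GY s x := Y k (m (Num.min s (c x))).
pose GZ s x := Z k (m (Num.min s (c x))).
(* Cuts the velocity off within distance 1 beyond the far wall. At the near wall no cut-off is
   needed, because all stages agree there. *)
pose chi x := Num.max 0 (1 - Num.max 0 (u * (x - w k) - l)).
have cc : continuous c by apply: cts_clamp; cts.
have cGY s : continuous (GY s) by rewrite /GY; cts.
have cGZ s : continuous (GZ s) by rewrite /GZ; cts.
have cchi : continuous chi by rewrite /chi; cts.
have chi01 x : 0 <= chi x <= 1 by rewrite /chi; clear; apply/andP; split; mm.
have chi1 x : strand w k x -> chi x = 1.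
  by move=> /strP /andP[_ h1]; rewrite /chi; clear -h1; mm.
have minI s x : d <= s <= l -> 0 <= Num.min s (c x) <= l.
  move: (c0l x); move: (c x) => t; clear -d0 => /andP[t0 tl] /andP[ds sl].
  by apply/andP; split; mm.
have near_s s s' x : d <= s <= l -> d <= s' <= l -> `|s' - s| < h ->
    `|GY s' x - GY s x| < st /\ `|GZ s' x - GZ s x| < st.
  move=> sl sl' ss; rewrite /GY /GZ.
  have : `|Num.min s' (c x) - Num.min s (c x)| < h.
    exact: le_lt_trans (min_lip _ _ _) ss.
  rewrite lt_min => /andP[h1 h2]; split.
    by apply: hyP => //; exact: minI.
  by apply: hzP => //; exact: minI.
have supp s s' x : d <= s' <= l -> s' <= s ->
    chi x != 0 -> Num.min s (c x) != Num.min s' (c x) ->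
    [/\ exists2 x', strand w k x' & `|x - x'| <= 1, d <= Num.min s (c x) <= l
     & d <= Num.min s' (c x) <= l].
  move=> /andP[ds' s'l] s's chin cn.
  have ct : s' < c x.
    by rewrite ltNge; apply: contra cn => cs; rewrite !min_r //; apply: le_trans s's.
  have /andP[_ cl] := c0l x.
  have tl : u * (x - w k) < l + 1.
    by rewrite ltNge; apply: contra chin => tl; apply/eqP; rewrite /chi; clear -tl; mm.
  have t0 : 0 < u * (x - w k).
    rewrite ltNge; apply/negP => tl0.
    by move: ct; rewrite /c clamp_le ?(ltW l0) // => ct; clear -ct ds' d0; qlra.
  split; [|by apply/andP; split; clear -ds' s's ct cl s'l; mm..].
  have [tl'|tl'] := le_or_lt (u * (x - w k)) l.
    exists x; last by rewrite subrr normr0.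
    by apply/strP; rewrite tl' ltW.
  exists (m l); first by apply: mI; rewrite lexx ltW.
  have -> : x - m l = u * (u * (x - w k) - l).
    by rewrite mulrBr mulrA uu mul1r /m; ring.
  by rewrite nu ger0_norm; clear -tl tl'; qlra.
have fixd s s' x : d <= s -> d <= s' -> `|x - w k| <= d ->
    Num.min s (c x) = Num.min s' (c x).
  move=> ds ds'; rewrite -nu => xd.
  have cd : c x <= d.
    rewrite /c /clamp ge_max (ltW d0) ge_min; apply/orP; left.
    exact: le_trans (ler_norm _) xd.
  by rewrite !min_r //; clear -cd ds ds'; qlra.
have iter n : let s := Num.max d (l - n%:R * (h / 2)) in
  exists P Y' Z' d', [/\ iso P, combed N w k Y' Z' b d',
    P @` zset N w Y Z = zset N w Y' Z'
    & forall x, strand w k x -> Y' k x = GY s x /\ Z' k x = GZ s x].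
  elim: n => [|n [P [Y1 [Z1 [d1' [iP C1 PE EG]]]]]] s.
    exists (fun p => p), Y, Z, d; split=> //; first exact: iso_id.
      by rewrite image_id.
    move=> x /strP sx; rewrite /GY /GZ /s mul0r subr0 (max_r (ltW dl)).
    rewrite /c clamp_id // min_r; last by case/andP: sx.
    by rewrite /m mulrA uu mul1r subrKC.
  set s0 := Num.max d _ in EG.
  have nS : n.+1%:R * (h / 2) = n%:R * (h / 2) + h / 2.
    by rewrite -natr1 mulrDl mul1r.
  have nh : 0 <= n%:R * (h / 2) by rewrite mulr_ge0 // divr_ge0 // ltW.
  have := descent h0 dl nh; rewrite -nS -/s -/s0 => -[sI sI0 ss ssh].
  pose v1 x := chi x * (GY s x - GY s0 x).
  pose v2 x := chi x * (GZ s x - GZ s0 x).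
  have vb1 x : `|v1 x| <= st.
    have [/ltW a _] := near_s _ _ x sI0 sI ssh.
    have /andP[c1 c2] := chi01 x; rewrite /v1 normrM (ger0_norm c1).
    by apply: le_trans (ler_piMl _ c2) a.
  have vb2 x : `|v2 x| <= st.
    have [_ /ltW a] := near_s _ _ x sI0 sI ssh.
    have /andP[c1 c2] := chi01 x; rewrite /v2 normrM (ger0_norm c1).
    by apply: le_trans (ler_piMl _ c2) a.
  have sup1 x : v1 x != 0 -> (exists2 x', strand w k x' & `|x - x'| <= 1) /\
      forall i, (i < k)%N -> rho <= Num.max `|b i - GY s0 x| `|GZ s0 x|.
    rewrite mulf_eq0 negb_or => /andP[c1 c2].
    have [|ex m1 m2] := supp s0 s x sI ss c1.
      by apply: contra c2 => /eqP E; rewrite /GY E subrr.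
    by split=> // i ik; have := farP i _ ik m1; move: rho0; rewrite /far; clear; qlra.
  have sup2 x : v2 x != 0 -> (exists2 x', strand w k x' & `|x - x'| <= 1) /\
      forall i, (i < k)%N -> rho <= Num.max `|b i - GY s x| `|GZ s0 x|.
    rewrite mulf_eq0 negb_or => /andP[c1 c2].
    have [|ex m1 m2] := supp s0 s x sI ss c1.
      by apply: contra c2 => /eqP E; rewrite /GZ E subrr.
    split=> // i ik; have := farP i _ ik m1.
    have [ys _] := near_s _ _ x sI0 sI ssh.
    exact: far_shift (lt_le_trans ys st1).
  have ve1 x : `|x - w k| <= d -> v1 x = 0.
    move=> xd; rewrite /v1 /GY (fixd s s0) ?subrr ?mulr0 //.
      by case/andP: sI.
    by case/andP: sI0.
  have ve2 x : `|x - w k| <= d -> v2 x = 0.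
    move=> xd; rewrite /v2 /GZ (fixd s s0) ?subrr ?mulr0 //.
      by case/andP: sI.
    by case/andP: sI0.
  have cv1 : continuous v1 by rewrite /v1; have := cGY s; have := cGY s0 => ? ?; cts.
  have cv2 : continuous v2 by rewrite /v2; have := cGZ s; have := cGZ s0 => ? ?; cts.
  have pk1 x : strand w k x -> GY s0 x = Y1 k x /\ GZ s0 x = Z1 k x.
    by move=> /EG[-> ->].
  have [P2 [Y2 [Z2 [d2 [iP2 C2 PE2 E2]]]]] := move_strand true C1 kN (cGY s0) (cGZ s0)
    cv1 pk1 rho0 vb1 sup1 d0 ve1.
  have pk2 x : strand w k x -> GY s x = Y2 k x /\ GZ s0 x = Z2 k x.
    move=> sx; have [-> ->] := E2 x sx; have [-> ->] := EG x sx.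
    by rewrite /v1 chi1 // addr0; split=> //; ring.
  have [P3 [Y3 [Z3 [d3 [iP3 C3 PE3 E3]]]]] := move_strand false C2 kN (cGY s) (cGZ s0)
    cv2 pk2 rho0 vb2 sup2 d0 ve2.
  exists (fun p => P3 (P2 (P p))), Y3, Z3, d3; split=> //.
  - exact: (iso_comp iP3 (iso_comp iP2 iP)).
  - by rewrite -PE3 -PE2 -PE !image_comp.
  - move=> x sx; have [-> ->] := E3 x sx; have [<- <-] := pk2 x sx.
    by rewrite /v2 chi1 // addr0; split=> //; ring.
pose n := (Num.truncn (l / (h / 2))).+1.
have hn : l <= n%:R * (h / 2).
  by rewrite -ler_pdivrMr ?divr_gt0 //; apply/ltW; exact: Num.Theory.truncnS_gt.
have [P [Y' [Z' [d' [iP C' PE EG]]]]] := iter n.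
rewrite (max_l (_ : _ <= d)) in EG; last by qlra.
(* The strand now stops rising where the retraction stopped, at height [d] above its predecessor;
   [d <= 1] gives the bound on consecutive levels. *)
pose b' i := if i == k then b k.-1 + d else b i.
have b'E i : (i < k)%N -> b' i = b i by rewrite /b' => ik; rewrite ltn_eqF.
exists P, Y', Z', b', d'; split=> //; split.
- exact: (combed_ctsY C').
- exact: (combed_ctsZ C').
- exact: (combed_disj C').
- by move=> _ x sx; rewrite b'E //; apply: (combed_row0 C').
- move=> i x; rewrite ltnS leq_eqVlt => /orP[/eqP iE|ik] sx; last first.
    by rewrite !b'E ?(ltnW ik) //; apply: (combed_row C').
  have ki : k.-1 = i by rewrite -iE.
  rewrite iE in sx *; have [-> ->] := EG _ sx.
  rewrite (_ : b' i = b k.-1); last by rewrite b'E -?iE // ki.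
  rewrite {1}/b' eqxx /GY /GZ.
  have /strP sx' := sx; rewrite /c clamp_id //.
  have xu : u * (x - w k) = `|x - w k| by rewrite -nu ger0_norm //; case/andP: sx'.
  rewrite xu in sx' *; have /andP[x0 xl] := sx'.
  have m1 : 0 <= Num.min d `|x - w k| <= l by rewrite le_min x0 ge_min xl orbT ltW.
  have m2 : Num.min d `|x - w k| <= d by rewrite ge_min lexx.
  have [-> ->] := start _ m1 m2.
  split=> //; move: `|x - w k| => t; clear; mm.
- move=> i; rewrite ltnS leq_eqVlt => /orP[/eqP iE|ik]; last first.
    by rewrite !b'E ?(ltnW ik) //; apply: (combed_b C').
  rewrite (_ : b' i = b k.-1); last by rewrite b'E -?iE.
  by rewrite iE /b' eqxx; qlra.
- move=> j x /andP[kj jN]; apply: (combed_cone C').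
  by rewrite jN andbT ltnW.
- exact: (combed_cone0 C').
- exact: (combed_d C').
Qed.

Lemma comb_all Y Z b d : (forall k, (0 < k < N)%N -> 1 < `|w k.+1 - w k|) ->
  (0 < N)%N -> combed N w 1 Y Z b d ->
  exists P Y' Z' b' d', [/\ iso P, combed N w N Y' Z' b' d'
    & P @` zset N w Y Z = zset N w Y' Z'].
Proof.
move=> wl N0 C.
have : forall m, (m < N)%N -> exists P Y' Z' b' d', [/\ iso P,
    combed N w m.+1 Y' Z' b' d' & P @` zset N w Y Z = zset N w Y' Z'].
  elim=> [|m IH] mN.
    by exists (fun p => p), Y, Z, b, d; split=> //; [exact: iso_id|rewrite image_id].
  have [P [Y1 [Z1 [b1 [d1 [iP C1 PE]]]]]] := IH (ltnW mN).
  have [|P2 [Y2 [Z2 [b2 [d2 [iP2 C2 PE2]]]]]] := comb_step C1 mN; first exact: wl.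
  exists (fun p => P2 (P p)), Y2, Z2, b2, d2; split=> //; first exact: iso_comp.
  by rewrite -PE2 -PE image_comp.
by move/(_ N.-1); rewrite prednK // => /(_ (leqnn _)).
Qed.

End Combing.

(** * Normal form of a crossing curve *)

Section Slide.
Context {R : realType}.
Implicit Types x y s : R.

(* The graph of [a] over [Y0, Y1] stays outside the strip X0 < x < X1 near its
   two ends, so it meets the strip in a compact piece. *)
Record spans (a : R -> R) (X0 X1 Y0 Y1 d : R) : Prop := Spans {
  spans_cts : continuous a;
  spans_lt : Y0 < Y1;
  spans_d : 0 < d;
  spans0 : a Y0 = X0;
  spans1 : a Y1 = X1;
  spansL : forall y, Y0 < y <= Y0 + d -> a y < X0;
  spansR : forall y, Y1 - d <= y < Y1 -> X1 < a y }.

Lemma spans_weaken a X0 X1 Y0 Y1 d d' : spans a X0 X1 Y0 Y1 d ->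
  0 < d' <= d -> spans a X0 X1 Y0 Y1 d'.
Proof.
move=> [ca YY d0 a0 a1 aL aR] /andP[d'0 d'd]; split=> //.
  by move=> y /andP[y1 y2]; apply: aL; rewrite y1; qlra.
by move=> y /andP[y1 y2]; apply: aR; rewrite y2 andbT; qlra.
Qed.

Lemma spans_inside a X0 X1 Y0 Y1 d y : spans a X0 X1 Y0 Y1 d -> X0 <= X1 ->
  Y0 <= y <= Y1 -> X0 < a y < X1 -> Y0 + d <= y <= Y1 - d.
Proof.
move=> S XX /andP[y0 y1] /andP[h0 h1].
have y0' : Y0 < y.
  by rewrite lt_neqAle y0 andbT; apply/eqP => E; rewrite -E (spans0 S) ltxx in h0.
have y1' : y < Y1.
  by rewrite lt_neqAle y1 andbT; apply/eqP => E; rewrite E (spans1 S) ltxx in h1.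
apply/andP; split; rewrite leNgt; apply/negP => c.
  by have := @spansL _ _ _ _ _ _ S y; rewrite y0' (ltW c) => /(_ isT); qlra.
by have := @spansR _ _ _ _ _ _ S y; rewrite y1' (ltW c) => /(_ isT); qlra.
Qed.

(** Inside the strip the arc only uses levels between [Y0 + d] and [Y1 - d], a compact range. On the
    boundary of the strip the moving graph is pinned at [Y0] or [Y1], hence away from these levels,
    so the closed strip may be used for the minimum. *)
Lemma gap (a zeta : R -> R) (p H : R * R -> R) X0 X1 Y0 Y1 d :
  spans a X0 X1 Y0 Y1 d -> X0 < X1 ->
  continuous zeta -> continuous p -> continuous H ->
  (forall s, p (s, X0) = Y0) -> (forall s, p (s, X1) = Y1) ->
  (forall s y, 0 <= s <= 1 -> Y0 <= y <= Y1 -> X0 < a y < X1 ->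
     p (s, a y) = y -> H (s, a y) = zeta y -> False) ->
  exists2 r, 0 < r & forall s y, 0 <= s <= 1 -> Y0 <= y <= Y1 -> X0 < a y < X1 ->
     r <= Num.max `|y - p (s, a y)| `|zeta y - H (s, a y)|.
Proof.
move=> S XX cz cp cH p0 p1 av; have ca := spans_cts S; have d0 := spans_d S.
pose f (q : R * R) := Num.max `|q.2 - p (q.1, a q.2)| `|zeta q.2 - H (q.1, a q.2)|.
have cf : continuous f.
  have cq : continuous (fun q : R * R => (q.1, a q.2)) by cts.
  by have := ctscomp cq cp; have := ctscomp cq cH; rewrite /f => ? ?; cts.
have c1 : continuous (fun q : R * R => a q.2) by cts.
have c2 : continuous (fun q : R * R => - a q.2) by cts.
have cA := compact_sub_ge (c := - X1) (compact_sub_ge (c := X0)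
  (compact_setX (compact_itv (a := 0) (b := 1))
   (compact_itv (a := Y0 + d) (b := Y1 - d))) c1) c2.
have [|r r0 rP] := pos_min cA cf.
  move=> [s y] /= [[[s01 yd] ya] ya'].
  have ay : X0 <= a y <= X1 by move: ya'; rewrite lerN2 ya.
  rewrite /f lt_max /= !normr_gt0 !subr_eq0 -negb_and.
  apply/negP => /andP[/eqP h1 /eqP h2].
  have /andP[b1 b2] := yd; have /andP[b3 b4] := ay.
  have y01 : Y0 <= y <= Y1 by apply/andP; split; qlra.
  apply: (av s y) => //; apply/andP; split; rewrite lt_neqAle.
    by rewrite b3 andbT; apply/eqP => E; rewrite -E p0 in h1; qlra.
  by rewrite b4 andbT; apply/eqP => E; rewrite E p1 in h1; qlra.
exists r => // s y s01 y01 ay; apply: (rP (s, y)) => /=.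
have /andP[b3 b4] := ay.
by rewrite lerN2 (ltW b3) (ltW b4) (spans_inside S (ltW XX) y01 ay).
Qed.

Lemma cts_bounded (f : R -> R) a b : a <= b -> continuous f ->
  exists V, forall x, `|f (clamp a b x)| <= V.
Proof.
move=> ab cf.
have [|c] := @EVT_max R (fun x => `|f x|) a b ab.
  by apply: continuous_subspaceT; cts.
move=> _ h; exists `|f c| => x; apply: h.
by rewrite in_itv /=; exact: clamp_itv.
Qed.

(** Both graphs agree at the ends of the strip, so the clamped velocity vanishes outside it, and
    only the part of the arc inside the strip has to be avoided; there [gap] supplies the radius for
    [push]. *)
Lemma slide (a zeta p0 p1 H : R -> R) X0 X1 Y0 Y1 d :
  spans a X0 X1 Y0 Y1 d -> X0 < X1 ->
  continuous zeta -> continuous p0 -> continuous p1 -> continuous H ->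
  p0 X0 = Y0 -> p1 X0 = Y0 -> p0 X1 = Y1 -> p1 X1 = Y1 ->
  (forall s y, 0 <= s <= 1 -> Y0 <= y <= Y1 -> X0 < a y < X1 ->
     p0 (a y) + s * (p1 (a y) - p0 (a y)) = y -> H (a y) = zeta y -> False) ->
  exists P, [/\ iso P, forall x, X0 <= x <= X1 -> P (x, p0 x, H x) = (x, p1 x, H x)
    & forall y, Y0 <= y <= Y1 -> P (a y, y, zeta y) = (a y, y, zeta y)].
Proof.
move=> S XX cz cp0 cp1 cH p00 p10 p01 p11 av.
pose c := @clamp R X0 X1.
have [||s|s|r r0 rP] := @gap a zeta (fun q => p0 q.2 + q.1 * (p1 q.2 - p0 q.2))
    (fun q => H q.2) X0 X1 Y0 Y1 d S XX cz _ _ _ _ av.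
- by cts.
- by cts.
- by rewrite /= p00 p10; ring.
- by rewrite /= p01 p11; ring.
have cc : continuous c by apply: cts_clamp; cts.
have cv : continuous (fun x => p1 x - p0 x) by cts.
have [V vV] := cts_bounded (ltW XX) cv.
have [|||P [iP Pp Pf]] := @push _ (fun x => p0 (c x)) (fun x => p1 (c x) - p0 (c x))
    (fun x => H (c x)) V r _ _ _ vV r0; [by cts|by cts|by cts|].
exists P; split=> //.
  by move=> x x01; have := Pp x; rewrite /c clamp_id // subrKC.
move=> y y01; apply: Pf.
have [x0|x0] := le_or_lt (a y) X0.
  by left; rewrite /c clamp_le // ?(ltW XX) // p00 p10 subrr.
have [x1|x1] := le_or_lt X1 (a y).
  by left; rewrite /c clamp_ge // ?(ltW XX) // p01 p11 subrr.
right=> s s01; rewrite /c clamp_id ?(ltW x0) ?(ltW x1) //.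
have := rP s y s01 y01; rewrite x0 x1 => /(_ isT) /=.
by rewrite opprD addrA.
Qed.

Lemma slide_z (a zeta b H0 H1 : R -> R) X0 X1 Y0 Y1 d :
  spans a X0 X1 Y0 Y1 d -> X0 < X1 ->
  continuous zeta -> continuous b -> continuous H0 -> continuous H1 ->
  b X0 = Y0 -> b X1 = Y1 -> H0 X0 = H1 X0 -> H0 X1 = H1 X1 ->
  (forall s y, 0 <= s <= 1 -> Y0 <= y <= Y1 -> X0 < a y < X1 ->
     b (a y) = y -> H0 (a y) + s * (H1 (a y) - H0 (a y)) = zeta y -> False) ->
  exists P, [/\ iso P, forall x, X0 <= x <= X1 -> P (x, b x, H0 x) = (x, b x, H1 x)
    & forall y, Y0 <= y <= Y1 -> P (a y, y, zeta y) = (a y, y, zeta y)].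
Proof.
move=> S XX cz cb cH0 cH1 b0 b1 H00 H11 av.
pose c := @clamp R X0 X1.
have [||s|s|r r0 rP] := @gap a zeta (fun q => b q.2)
    (fun q => H0 q.2 + q.1 * (H1 q.2 - H0 q.2)) X0 X1 Y0 Y1 d S XX cz _ _ _ _ av.
- by cts.
- by cts.
- by [].
- by [].
have cc : continuous c by apply: cts_clamp; cts.
have cv : continuous (fun x => H1 x - H0 x) by cts.
have [V vV] := cts_bounded (ltW XX) cv.
have [|||P [iP Pp Pf]] := @push _ (fun x => H0 (c x)) (fun x => H1 (c x) - H0 (c x))
    (fun x => b (c x)) V r _ _ _ vV r0; [by cts|by cts|by cts|].
exists (fun q => swap_yz (P (swap_yz q))); split=> //; first exact: iso_swap_yz.
  move=> x x01; have := Pp x; rewrite /c clamp_id // subrKC /swap_yz /=.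
  by move=> ->.
move=> y y01; rewrite /swap_yz /= Pf //.
have [x0|x0] := le_or_lt (a y) X0.
  by left; rewrite /c clamp_le // ?(ltW XX) // H00 subrr.
have [x1|x1] := le_or_lt X1 (a y).
  by left; rewrite /c clamp_ge // ?(ltW XX) // H11 subrr.
right=> s s01; rewrite /c clamp_id ?(ltW x0) ?(ltW x1) //.
have := rP s y s01 y01; rewrite x0 x1 => /(_ isT) /=.
by rewrite maxC opprD addrA.
Qed.

(* A curve made of an arc in the plane z = 0 that is a graph over the y-axis
   and of an arc that is a graph over the x-axis. *)
Record crossing (a b h : R -> R) (X0 X1 Y0 Y1 d : R) : Prop := Crossing {
  cross_a : spans a X0 X1 Y0 Y1 d;
  cross_b : spans b Y0 Y1 X0 X1 d;
  cross_h : continuous h;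
  cross_h0 : h X0 = 0;
  cross_h1 : h X1 = 0;
  cross_disj : forall y, Y0 <= y <= Y1 -> X0 < a y < X1 -> h (a y) = 0 ->
    b (a y) <> y }.

Definition cset (a b h : R -> R) (X0 X1 Y0 Y1 : R) : set (pt R) :=
  [set q | (exists2 y, Y0 <= y <= Y1 & q = (a y, y, 0)) \/
           (exists2 x, X0 <= x <= X1 & q = (x, b x, h x))].

Lemma cset_map (P : pt R -> pt R) a b h a' b' h' X0 X1 Y0 Y1 :
  (forall y, Y0 <= y <= Y1 -> P (a y, y, 0) = (a' y, y, 0)) ->
  (forall x, X0 <= x <= X1 -> P (x, b x, h x) = (x, b' x, h' x)) ->
  P @` cset a b h X0 X1 Y0 Y1 = cset a' b' h' X0 X1 Y0 Y1.
Proof.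
move=> Pa Pb; apply/seteqP; split=> [_ [_ [[y yY ->]|[x xX ->]] <-]|_ [[y yY ->]|[x xX ->]]].
- by left; exists y => //; rewrite Pa.
- by right; exists x => //; rewrite Pb.
- by exists (a y, y, 0); [left; exists y | rewrite Pa].
- by exists (x, b x, h x); [right; exists x | rewrite Pb].
Qed.

Lemma cross_move_b a b b' h X0 X1 Y0 Y1 d d' :
  crossing a b h X0 X1 Y0 Y1 d -> spans b' Y0 Y1 X0 X1 d' ->
  (forall s y, 0 <= s <= 1 -> Y0 <= y <= Y1 -> X0 < a y < X1 -> h (a y) = 0 ->
     b (a y) + s * (b' (a y) - b (a y)) = y -> False) ->
  exists P, iso P /\ P @` cset a b h X0 X1 Y0 Y1 = cset a b' h X0 X1 Y0 Y1.
Proof.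
move=> [Sa Sb ch h0 h1 _] Sb' av.
have [|P [iP P1 P2]] := @slide a (fun=> 0) b b' h X0 X1 Y0 Y1 d Sa (spans_lt Sb)
  (@ctsC R R 0) (spans_cts Sb) (spans_cts Sb') ch (spans0 Sb) (spans0 Sb')
  (spans1 Sb) (spans1 Sb').
  by move=> s y s01 yY aX bE hE; apply: (av s y).
by exists P; split=> //; apply: cset_map.
Qed.

Lemma cross_move_h a b h h' X0 X1 Y0 Y1 d :
  crossing a b h X0 X1 Y0 Y1 d -> continuous h' -> h' X0 = 0 -> h' X1 = 0 ->
  (forall s y, 0 <= s <= 1 -> Y0 <= y <= Y1 -> X0 < a y < X1 -> b (a y) = y ->
     h (a y) + s * (h' (a y) - h (a y)) = 0 -> False) ->
  exists P, iso P /\ P @` cset a b h X0 X1 Y0 Y1 = cset a b h' X0 X1 Y0 Y1.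
Proof.
move=> [Sa Sb ch h0 h1 _] ch' h0' h1' av.
have [||s y s01 yY aX bE hE|P [iP P1 P2]] := @slide_z a (fun=> 0) b h h' X0 X1 Y0 Y1 d Sa (spans_lt Sb)
  (@ctsC R R 0) (spans_cts Sb) ch ch' (spans0 Sb) (spans1 Sb).
- by rewrite h0 h0'.
- by rewrite h1 h1'.
- exact: (av s y).
by exists P; split=> //; apply: cset_map.
Qed.

(** [slide] with x and y exchanged: the planar arc moves, and the strand with its height [h] is the
    obstacle. *)
Lemma cross_move_a a a' b h X0 X1 Y0 Y1 d d' :
  crossing a b h X0 X1 Y0 Y1 d -> spans a' X0 X1 Y0 Y1 d' ->
  (forall s x, 0 <= s <= 1 -> X0 <= x <= X1 -> Y0 < b x < Y1 -> h x = 0 ->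
     a (b x) + s * (a' (b x) - a (b x)) = x -> False) ->
  exists P, iso P /\ P @` cset a b h X0 X1 Y0 Y1 = cset a' b h X0 X1 Y0 Y1.
Proof.
move=> [Sa Sb ch h0 h1 _] Sa' av.
have [|P [iP P1 P2]] := @slide b h a a' (fun=> 0) Y0 Y1 X0 X1 d Sb (spans_lt Sa)
  ch (spans_cts Sa) (spans_cts Sa') (@ctsC R R 0) (spans0 Sa) (spans0 Sa')
  (spans1 Sa) (spans1 Sa').
  by move=> s x s01 xX bY aE hE; apply: (av s x).
exists (fun q => swap_xy (P (swap_xy q))); split; first exact: iso_swap_xy.
apply: cset_map => [y yY|x xX]; rewrite /swap_xy /=.
  by rewrite P1.
by rewrite P2.
Qed.

End Slide.

(** * Finitely many zeros of the height, at distinct levels *)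

Section Matching.
Context {R : realType}.
Implicit Types x y : R.

Lemma spans_len (a : R -> R) X0 X1 Y0 Y1 d : spans a X0 X1 Y0 Y1 d -> X0 < X1 ->
  Y0 + d < Y1 - d.
Proof.
move=> S XX; rewrite ltNge; apply/negP => le.
have YY := spans_lt S; have d0 := spans_d S.
have [c|c] := le_or_lt Y1 (Y0 + d).
  by have := @spansL _ _ _ _ _ _ _ S Y1; rewrite YY c (spans1 S) => /(_ isT); qlra.
have h1 := @spansL _ _ _ _ _ _ _ S (Y0 + d).
have h2 := @spansR _ _ _ _ _ _ _ S (Y0 + d).
by rewrite ltrDl d0 lexx in h1; rewrite le c in h2; have := h1 isT; have := h2 isT; qlra.
Qed.

(** Linear interpolation on a fine mesh. Node values close to 0 are replaced by [e / 4], so no node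
    value is 0, and each linear piece has at most one zero. *)
Lemma pl_approx (h : R -> R) A B e : A < B -> continuous h -> 0 < e ->
  exists g : R -> R, exists zs : seq R, [/\ continuous g, g A != 0, g B != 0,
    forall x, A <= x <= B -> `|g x - h x| <= e
  & forall x, A <= x <= B -> g x = 0 -> x \in zs].
Proof.
move=> AB ch e0.
have e4 : 0 < e / 4 by rewrite divr_gt0.
have [dl dl0 dlP] := unif_cts A B ch e4.
pose m := (Num.truncn ((B - A) / dl)).+1.
have m0 : 0 < m%:R :> R by rewrite ltr0n.
pose D := (B - A) / m%:R; have BA : 0 < B - A by qlra.
have D0 : 0 < D by rewrite divr_gt0.
have Dm : D * m%:R = B - A by rewrite divfK // gt_eqF.
have Ddl : D < dl.
  rewrite ltr_pdivrMr // mulrC -ltr_pdivrMr //.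
  exact: Num.Theory.truncnS_gt.
pose s i : R := A + D * i%:R.
pose v i : R := if e / 4 <= `|h (s i)| then h (s i) else e / 4.
have v0 i : v i != 0.
  rewrite /v; case: ifP => [c|_]; last by rewrite gt_eqF.
  by rewrite -normr_gt0; apply: lt_le_trans c.
have vh i : `|v i - h (s i)| <= e / 2.
  rewrite /v; case: ifP => [_|/negbT]; first by rewrite subrr normr0; qlra.
  by rewrite -ltNge; clear -e0; mm.
pose f i t : R := (1 - t) * v i + t * v i.+1.
have cf i : continuous (f i) by rewrite /f; cts.
have ff i : f i 1 = f i.+1 0 by rewrite /f; ring.
pose g x := chain f ((x - A) / D).
have cg : continuous g.
  by have := cts_chain cf ff => ?; rewrite /g; cts.
have piece x : A <= x <= B -> exists i t, [/\ (i < m)%N, 0 <= t <= 1,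
    x = s i + D * t & g x = f i t].
  move=> /andP[Ax xB]; pose u := (x - A) / D.
  have u0 : 0 <= u by rewrite divr_ge0 // ?subr_ge0 // ltW.
  have xE : x = A + D * u by rewrite mulrC divfK ?gt_eqF // subrKC.
  have um : u <= m%:R by rewrite ler_pdivrMr // mulrC Dm; qlra.
  have [c|c] := ltP u m%:R.
    have /andP[k1 k2] := Num.Theory.truncn_itv u0.
    exists (Num.truncn u), (u - (Num.truncn u)%:R); split=> //.
    - by rewrite -(ltr_nat R); apply: le_lt_trans c.
    - by move: k2; rewrite -natr1 => k2; apply/andP; split; qlra.
    - by rewrite {1}xE /s; ring.
  have uE : u = m%:R by qlra.
  have mE : m = m.-1.+1 by [].
  exists m.-1, 1; split=> //; first by rewrite ler01 lexx.
    by rewrite {1}xE /s uE {1}mE -natr1; ring.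
  rewrite /g -/u uE (@chainE_closed _ _ _ m.-1) //.
    by congr (f _ _); rewrite {1}mE -natr1 addrC addKr.
  by rewrite {3}mE lexx ler_nat leqnSn.
have gs i t : (i < m)%N -> 0 <= t <= 1 -> `|f i t - h (s i + D * t)| <= e.
  move=> im /andP[t0 t1].
  have si j : (j <= m)%N -> A <= s j <= B.
    move=> jm; have j0 : 0 <= D * j%:R by rewrite mulr_ge0 // ltW.
    have jm' : D * j%:R <= D * m%:R by rewrite ler_pM2l // ler_nat.
    by rewrite /s; apply/andP; split; qlra.
  have sS : s i.+1 = s i + D by rewrite /s -natr1; ring.
  have xI : A <= s i + D * t <= B.
    have := si _ im; have := si _ (ltnW im); rewrite sS => /andP[a1 a2] /andP[a3 a4].
    have : 0 <= D * t by rewrite mulr_ge0 // ltW.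
    have : D * t <= D * 1 by rewrite ler_pM2l.
    by rewrite mulr1 => *; apply/andP; split; qlra.
  have n1 : `|h (s i) - h (s i + D * t)| < e / 4.
    apply: dlP => //; first exact: si (ltnW im).
    rewrite opprD addrA subrr sub0r normrN normrM !ger0_norm // ?(ltW D0) //.
    by apply: le_lt_trans Ddl; rewrite ler_piMr // ltW.
  have n2 : `|h (s i.+1) - h (s i + D * t)| < e / 4.
    apply: dlP => //; first exact: si.
    have -> : s i.+1 - (s i + D * t) = D * (1 - t) by rewrite sS; ring.
    rewrite normrM !ger0_norm // ?(ltW D0) // ?subr_ge0 //.
    by apply: le_lt_trans Ddl; rewrite ler_piMr // ?(ltW D0) //; qlra.
  have b1 : `|v i - h (s i + D * t)| <= e.
    have := ler_distD (h (s i)) (v i) (h (s i + D * t)); have := vh i; qlra.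
  have b2 : `|v i.+1 - h (s i + D * t)| <= e.
    have := ler_distD (h (s i.+1)) (v i.+1) (h (s i + D * t)); have := vh i.+1; qlra.
  move: b1 b2; rewrite /f; move: (h _) (v i) (v i.+1) => y p q.
  rewrite !ler_norml => /andP[p1 p2] /andP[q1 q2].
  have -> : (1 - t) * p + t * q - y = (1 - t) * (p - y) + t * (q - y) by ring.
  have t1' : 0 <= 1 - t by qlra.
  have h1 := ler_wpM2l t1' p1; have h2 := ler_wpM2l t1' p2.
  have h3 := ler_wpM2l t0 q1; have h4 := ler_wpM2l t0 q2.
  by apply/andP; split; qlra.
have gs0 i : (i <= m)%N -> g (s i) = v i.
  move=> im; rewrite /g /s addrC addKr mulrC mulKf ?gt_eqF //.
  rewrite (@chainE _ _ _ i) ?lexx ?ltr_nat ?ltnSn //.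
  by rewrite subrr /f; ring.
pose z i := s i + D * (v i / (v i - v i.+1)).
exists g, [seq z i | i <- iota 0 m]; split=> //.
- have -> : A = s 0%N by rewrite /s mulr0 addr0.
  by rewrite gs0.
- have -> : B = s m by rewrite /s Dm subrKC.
  by rewrite gs0.
- by move=> x /piece[i [t [im t01 -> ->]]]; exact: gs.
- move=> x /piece[i [t [im /andP[t0 t1] xE ->]]] f0.
  apply/mapP; exists i; first by rewrite mem_iota.
  rewrite xE /z; congr (_ + D * _).
  have E : t * (v i - v i.+1) = v i by move: f0; rewrite /f; qlra.
  have n0 : v i - v i.+1 != 0.
    by apply: contra (v0 i) => /eqP c; rewrite -E c mulr0.
  by rewrite -[X in X / _]E mulfK.
Qed.

(** Heights matter only where the projections meet. There the height has absolute value at least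
    some [r], so an approximation within [r / 2] and the segment leading to it never vanish. *)
Lemma reduce_zeros a b h X0 X1 Y0 Y1 d : crossing a b h X0 X1 Y0 Y1 d ->
  exists P h' zs d', [/\ iso P, crossing a b h' X0 X1 Y0 Y1 d',
    P @` cset a b h X0 X1 Y0 Y1 = cset a b h' X0 X1 Y0 Y1
  & forall x, X0 < x < X1 -> h' x = 0 -> x \in (zs : seq R) /\ X0 + d' <= x <= X1 - d'].
Proof.
move=> C; have Sa := cross_a C; have Sb := cross_b C; have ch := cross_h C.
have XX := spans_lt Sb; have YY := spans_lt Sa; have d0 := spans_d Sa.
have AB : X0 + d < X1 - d := spans_len Sb YY.
have cb := spans_cts Sb.
have [||s|s|s y s01 yY aX bE hE|r r0 rP] := @gap _ a (fun=> 0) (fun q => b q.2)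
  (fun q => h q.2) X0 X1 Y0 Y1 d Sa XX (@ctsC R R 0).
- by cts.
- by cts.
- exact: (spans0 Sb).
- exact: (spans1 Sb).
- exact: (cross_disj C yY aX hE).
have r2 : 0 < r / 2 by rewrite divr_gt0.
have [g [zs [cg gA gB gh gz]]] := pl_approx AB ch r2.
pose c x := clamp (X0 + d) (X1 - d) x.
(* Tapers the approximation to 0 at both ends. It equals 1 where the projections can meet, and it is
   positive inside, so it creates no further zero. *)
pose t x := Num.min 1 (Num.min ((x - X0) / d) ((X1 - x) / d)).
pose h' x := g (c x) * t x.
have cc : continuous c by apply: cts_clamp; cts.
have ch' : continuous h' by rewrite /h' /t; cts.
have t0 : t X0 = 0.
  by rewrite /t subrr mul0r (min_l (_ : 0 <= _)) ?min_r // divr_ge0 //; qlra.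
have t1 : t X1 = 0.
  by rewrite /t subrr mul0r (min_r (_ : 0 <= _)) ?min_r // divr_ge0 //; qlra.
have tp x : X0 < x < X1 -> 0 < t x.
  move=> /andP[x0 x1]; rewrite /t !lt_min ltr01 /= !divr_gt0 //; qlra.
have tm x : X0 + d <= x <= X1 - d -> h' x = g x.
  move=> /andP[x0 x1]; rewrite /h' /c clamp_id ?x0 //.
  rewrite /t min_l ?mulr1 // le_min !ler_pdivlMr // !mul1r.
  by apply/andP; split; qlra.
have inM y : Y0 <= y <= Y1 -> X0 < a y < X1 -> b (a y) = y ->
    X0 + d <= a y <= X1 - d.
  move=> /andP[y0 y1] /andP[x0 x1] bE.
  apply/andP; split; rewrite leNgt; apply/negP => cl.
    by have := @spansL _ _ _ _ _ _ _ Sb (a y); rewrite x0 (ltW cl) => /(_ isT); qlra.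
  by have := @spansR _ _ _ _ _ _ _ Sb (a y); rewrite x1 (ltW cl) => /(_ isT); qlra.
have av s y : 0 <= s <= 1 -> Y0 <= y <= Y1 -> X0 < a y < X1 -> b (a y) = y ->
    h (a y) + s * (h' (a y) - h (a y)) = 0 -> False.
  move=> s01 yY aX bE E.
  have M := inM y yY aX bE.
  have := rP 0 y _ yY aX; rewrite lexx ler01 /= bE subrr normr0 sub0r normrN.
  move=> /(_ isT); have := gh _ M; rewrite tm // in E *.
  have E' : h (a y) = - (s * (g (a y) - h (a y))) by qlra.
  move: s01 E' => /andP[s0 s1].
  move: (g _) (h _) => u w E' uw.
  have : `|w| <= `|u - w|.
    by rewrite E' normrN normrM (ger0_norm s0) -E' ler_piMl.
  by rewrite maxEle; case: ifP => _; qlra.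
have h'0 : h' X0 = 0 by rewrite /h' t0 mulr0.
have h'1 : h' X1 = 0 by rewrite /h' t1 mulr0.
have [P [iP PE]] := cross_move_h C ch' h'0 h'1 av.
exists P, h', zs, d; split=> //.
  split=> // y yY aX hE bE; apply: (av 1 y) => //; first by rewrite lexx ler01.
  by rewrite mul1r subrKC.
move=> x xX; rewrite /h' => /eqP; rewrite mulf_eq0 (gt_eqF (tp x xX)) orbF => /eqP gx.
have [c1|c1] := ltP x (X0 + d).
  by move: gA; rewrite -(_ : c x = X0 + d) ?gx ?eqxx // /c clamp_le ?(ltW c1) // ltW.
have [c2|c2] := ltP (X1 - d) x.
  by move: gB; rewrite -(_ : c x = X1 - d) ?gx ?eqxx // /c clamp_ge ?(ltW c2) // ltW.
by rewrite /c clamp_id ?c1 // in gx; split=> //; apply: gz; rewrite ?c1.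
Qed.

(** Clamping to the interval from [A + c / 2] to [B - c / 2] never carries [u] across a level [y]
    that lies [c / 2] further inside, and the extra shift, at most [g / 4], is too small to close a
    gap [g]. *)
Lemma clamp_miss (A B c g u w s y : R) : 0 < g -> g <= c -> A + c <= y <= B - c ->
  0 <= s <= 1 -> `|s * w| <= g / 4 -> g <= `|y - u| ->
  u + s * (clamp (A + c / 2) (B - c / 2) u + w - u) <> y.
Proof.
move=> g0 gc /andP[y0 y1] /andP[s0 s1]; rewrite ler_norml => /andP[sw1 sw2] ru E.
have {}E : u + s * (clamp (A + c / 2) (B - c / 2) u - u) + s * w = y.
  by rewrite -E; ring.
move: E sw1 sw2; move: (s * w) => v E sw1 sw2.
have [c1|c1] := le_or_lt u (A + c / 2).
  rewrite clamp_le // in E; last by clear -y0 y1 g0 gc; qlra.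
  have : s * (A + c / 2 - u) <= A + c / 2 - u by rewrite ler_piMl // subr_ge0.
  by clear -E y0 y1 g0 gc sw1 sw2; qlra.
have [c2|c2] := le_or_lt (B - c / 2) u.
  rewrite clamp_ge // in E; last by clear -y0 y1 g0 gc; qlra.
  have : s * (u - (B - c / 2)) <= u - (B - c / 2) by rewrite ler_piMl // subr_ge0.
  have E' : s * (B - c / 2 - u) = - (s * (u - (B - c / 2))) by ring.
  by rewrite E' in E; clear -E y0 y1 g0 gc sw1 sw2; qlra.
rewrite clamp_id ?(ltW c1) ?(ltW c2) // subrr mulr0 addr0 in E.
move: ru; rewrite -E addrC addKr ler_normr.
by clear -g0 sw1 sw2 => /orP[|] ?; qlra.
Qed.

(** Near the zeros the levels are clamped into the open interval and then sheared by a small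
    [k * x]. A coincidence of the levels of two zeros determines [k], so all but finitely many
    values of [k] separate them. *)
Lemma reduce_levels a b h X0 X1 Y0 Y1 d zs : crossing a b h X0 X1 Y0 Y1 d ->
  (forall x, X0 < x < X1 -> h x = 0 -> x \in (zs : seq R) /\ X0 + d <= x <= X1 - d) ->
  exists P b' d', [/\ iso P, crossing a b' h X0 X1 Y0 Y1 d',
    P @` cset a b h X0 X1 Y0 Y1 = cset a b' h X0 X1 Y0 Y1,
    forall x, X0 < x < X1 -> h x = 0 -> Y0 < b' x < Y1
  & forall x x', X0 < x < X1 -> h x = 0 -> X0 < x' < X1 -> h x' = 0 ->
     b' x = b' x' -> x = x'].
Proof.
move=> C zsP; have Sa := cross_a C; have Sb := cross_b C; have ch := cross_h C.
have XX := spans_lt Sb; have YY := spans_lt Sa; have d0 := spans_d Sa.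
have AB : X0 + d < X1 - d := spans_len Sb YY.
have CD : Y0 + d < Y1 - d := spans_len Sa XX.
have cb := spans_cts Sb.
have [||s|s|s y s01 yY aX bE hE|r r0 rP] := @gap _ a (fun=> 0) (fun q => b q.2)
  (fun q => h q.2) X0 X1 Y0 Y1 d Sa XX (@ctsC R R 0).
- by cts.
- by cts.
- exact: (spans0 Sb).
- exact: (spans1 Sb).
- exact: (cross_disj C yY aX hE).
pose M := Num.max `|X0| `|X1| + 1.
have M0 : 0 < M by rewrite /M; have := normr_ge0 X0; clear; mm.
have xM x : X0 < x < X1 -> `|x| <= M.
  by rewrite /M => /andP[]; clear; mm.
(* Since [M] bounds x, the shear moves no level by more than a quarter of [r] and of [d], as
   [clamp_miss] demands. *)
pose k0 := Num.min r d / (4 * M).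
have rd : 0 < Num.min r d by rewrite lt_min r0.
have k00 : 0 < k0 by rewrite divr_gt0 // mulr_gt0.
pose cl y := clamp (Y0 + d / 2) (Y1 - d / 2) y.
(* Pairs with equal entries contribute the quotient 0, which is harmless. *)
have [|k [k' [k1 k2 k3 kP]]] := @avoid _
  [seq (cl (b p.1) - cl (b p.2)) / (p.2 - p.1) | p <- allpairs pair zs zs] (k0 / 2) k0.
  qlra.
have kk' : k < k'.
  by rewrite -subr_gt0 k3 divr_gt0 ?exprn_gt0 //; qlra.
have kx x : X0 < x < X1 -> `|k * x| <= Num.min r d / 4.
  move=> xX; rewrite normrM (ger0_norm (_ : 0 <= k)); last qlra.
  apply: (@le_trans _ _ (k0 * M)).
    by apply: ler_pM => //; [qlra | qlra | exact: xM].
  by rewrite /k0; have -> : Num.min r d / (4 * M) * M = Num.min r d / 4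
    by field; rewrite gt_eqF.
pose chi x := clamp 0 1 (Num.min ((x - X0) / (d / 2) - 1) ((X1 - x) / (d / 2) - 1)).
pose b' x := b x + chi x * (cl (b x) + k * x - b x).
have d2 : 0 < d / 2 by rewrite divr_gt0.
have cchi : continuous chi by apply: cts_clamp; cts.
have ccl : continuous (fun x => cl (b x)) by apply: cts_clamp.
have cb' : continuous b' by rewrite /b'; cts.
have chi0 x : x <= X0 + d / 2 -> chi x = 0.
  move=> xX; rewrite /chi clamp_le // ?ler01 // ge_min; apply/orP; left.
  by rewrite subr_le0 ler_pdivrMr // mul1r; qlra.
have chi0' x : X1 - d / 2 <= x -> chi x = 0.
  move=> xX; rewrite /chi clamp_le // ?ler01 // ge_min; apply/orP; right.
  by rewrite subr_le0 ler_pdivrMr // mul1r; qlra.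
have chi1 x : X0 + d <= x <= X1 - d -> chi x = 1.
  move=> /andP[x0 x1]; rewrite /chi clamp_ge // ?ler01 // le_min.
  by rewrite !lerBrDr !ler_pdivlMr //; apply/andP; split; qlra.
have Sb' : spans b' Y0 Y1 X0 X1 (d / 2).
  split=> //.
  - by rewrite /b' chi0 ?mul0r ?addr0 ?(spans0 Sb) //; qlra.
  - by rewrite /b' chi0' ?mul0r ?addr0 ?(spans1 Sb) //; qlra.
  - move=> x /andP[x0 x1]; rewrite /b' chi0 // mul0r addr0.
    by apply: (spansL Sb); rewrite x0; qlra.
  - move=> x /andP[x0 x1]; rewrite /b' chi0' // mul0r addr0.
    by apply: (spansR Sb); rewrite x1 andbT; qlra.
have av s y : 0 <= s <= 1 -> Y0 <= y <= Y1 -> X0 < a y < X1 -> h (a y) = 0 ->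
    b (a y) + s * (b' (a y) - b (a y)) = y -> False.
  move=> /andP[s0 s1] yY aX hE.
  have [_ M'] := zsP _ aX hE.
  have := rP 0 y _ yY aX; rewrite lexx ler01 /= hE subrr normr0 => /(_ isT).
  have /andP[y0 y1] := spans_inside Sa (ltW XX) yY aX.
  rewrite /b' chi1 // mul1r; have := kx _ aX; move: (b _) (k * _) => u w wb ru.
  have -> : u + (cl u + w - u) - u = cl u + w - u by ring.
  apply: (@clamp_miss Y0 Y1 d (Num.min r d)) => //.
  - by rewrite ge_min lexx orbT.
  - by apply/andP.
  - by apply/andP.
  - by apply: le_trans wb; rewrite normrM (ger0_norm s0) ler_piMl.
  - apply: le_trans (_ : r <= _); first by rewrite ge_min lexx.
    by move: ru; rewrite maxEle; case: ifP => // _; qlra.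
have [P [iP PE]] := cross_move_b C Sb' av.
exists P, b', (d / 2); split=> //.
- split=> //; first by apply: spans_weaken Sa _; apply/andP; split; qlra.
  + by move: (cross_h0 C).
  + by move: (cross_h1 C).
  move=> y yY aX hE bE; apply: (av 1 y) => //; first by rewrite lexx ler01.
  by rewrite mul1r subrKC.
- move=> x xX hE; have [_ M'] := zsP _ xX hE.
  rewrite /b' chi1 // mul1r subrKC.
  have := kx _ xX; rewrite ler_norml => /andP[w1 w2].
  have dmin : Num.min r d <= d by rewrite ge_min lexx orbT.
  have /andP[c1 c2] : Y0 + d / 2 <= cl (b x) <= Y1 - d / 2.
    by apply: clamp_itv; qlra.
  by apply/andP; split; qlra.
- move=> x x' xX hx xX' hx'; have [z1 M1] := zsP _ xX hx; have [z2 M2] := zsP _ xX' hx'.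
  rewrite /b' !chi1 // !mul1r !subrKC => E.
  apply/eqP; rewrite -subr_eq0; apply/negP => /negP n0.
  have kE : k = (cl (b x) - cl (b x')) / (x' - x).
    have n0' : x' - x != 0 by rewrite -opprB oppr_eq0.
    by apply: (mulIf n0'); rewrite divfK //; qlra.
  have : k \in [seq (cl (b p.1) - cl (b p.2)) / (p.2 - p.1) | p <- allpairs pair zs zs].
    rewrite {1}kE; apply/mapP; exists (x, x') => //.
    by apply/allpairsP; exists (x, x').
  by move=> /kP; qlra.
Qed.

End Matching.

(** * The combinatorial data of a crossing curve *)

Section NormalForm.
Context {R : realType}.
Implicit Types x y : R.

Lemma sorted_points (X0 X1 : R) (zs : seq R) : X0 < X1 -> uniq zs ->
  (forall x, x \in zs -> X0 < x < X1) ->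
  exists u : nat -> R, [/\ u 0%N = X0, u (size zs).+1 = X1,
    forall i, (i <= size zs)%N -> u i < u i.+1,
    forall x, x \in zs -> exists2 i, (0 < i <= size zs)%N & u i = x
  & forall i, (0 < i <= size zs)%N -> u i \in zs].
Proof.
move=> XX uz zX; pose xs := sort <=%O zs.
have sxs : size xs = size zs by rewrite size_sort.
have mxs : xs =i zs by move=> x; rewrite mem_sort.
have srt : sorted <%O (X0 :: rcons xs X1).
  rewrite /= rcons_path path_sortedE; last exact: lt_trans.
  rewrite sort_lt_sorted uz andbT; apply/andP; split.
    by apply/allP => x; rewrite mxs => /zX /andP[].
  have := mem_last X0 xs; rewrite inE => /orP[/eqP -> //|].
  by rewrite mxs => /zX /andP[].
exists (nth X1 (X0 :: rcons xs X1)); split=> //.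
- by rewrite /= -sxs nth_rcons ltnn eqxx.
- move=> i iz; apply: (sorted_ltn_nth lt_trans _ srt) => //; rewrite inE /= size_rcons sxs !ltnS //.
  exact: leqW.
- move=> x; rewrite -mxs => xx; exists (index x xs).+1; first by rewrite /= -sxs index_mem.
  by rewrite /= nth_rcons index_mem xx nth_index.
- move=> [//|i] /= iz; rewrite nth_rcons sxs iz -mxs mem_nth // sxs //.
Qed.

(** Only zeros of [h] obstruct. While the strand moves, its levels at the zeros do not change; while
    the arc moves, it stays on the same side of each zero, since both its ends of motion lie
    there. *)
Lemma cross_match a b h a' b' X0 X1 Y0 Y1 d d' : crossing a b h X0 X1 Y0 Y1 d ->
  spans a' X0 X1 Y0 Y1 d' -> spans b' Y0 Y1 X0 X1 d' ->
  (forall x, X0 < x < X1 -> h x = 0 -> [/\ b' x = b x, Y0 < b x < Y1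
     & a (b x) < x /\ a' (b x) < x \/ x < a (b x) /\ x < a' (b x)]) ->
  exists P : pt R -> pt R, [/\ iso P, crossing a' b' h X0 X1 Y0 Y1 d'
    & P @` cset a b h X0 X1 Y0 Y1 = cset a' b' h X0 X1 Y0 Y1].
Proof.
move=> C Sa' Sb' side.
have [P [iP PE]] : exists P : pt R -> pt R, iso P /\
    P @` cset a b h X0 X1 Y0 Y1 = cset a b' h X0 X1 Y0 Y1.
  apply: (cross_move_b C Sb') => s y s01 yY aX h0.
  have [-> _ _] := side _ aX h0; rewrite subrr mulr0 addr0.
  exact: (cross_disj C).
pose e := Num.min d d'.
have d0 := spans_d (cross_a C); have d0' := spans_d Sa'.
have ed : 0 < e <= d by rewrite /e lt_min d0 d0' ge_min lexx.
have ed' : 0 < e <= d' by rewrite /e lt_min d0 d0' ge_min lexx orbT.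
have C' : crossing a b' h X0 X1 Y0 Y1 e.
  split; [exact: spans_weaken (cross_a C) ed|exact: spans_weaken Sb' ed'|
    exact: cross_h C|exact: cross_h0 C|exact: cross_h1 C|].
  by move=> y yY aX h0; have [-> _ _] := side _ aX h0; exact: (cross_disj C).
have inX x : X0 <= x <= X1 -> Y0 < b' x < Y1 -> X0 < x < X1.
  rewrite !lt_neqAle => /andP[-> ->] bY; rewrite !andbT; apply/andP; split.
    by apply/eqP => E; move: bY; rewrite -E (spans0 Sb') eqxx.
  by apply/eqP => E; move: bY; rewrite E (spans1 Sb') eqxx andbF.
have [Q [iQ QE]] : exists Q : pt R -> pt R, iso Q /\
    Q @` cset a b' h X0 X1 Y0 Y1 = cset a' b' h X0 X1 Y0 Y1.
  apply: (cross_move_a C' Sa') => s x s01 xX bY h0.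
  have [-> _ sd] := side x (inX x xX bY) h0.
  move: (a _) (a' _) sd => A A' sd E; move/andP: s01 => [s0 s1].
  have {}E : x = (1 - s) * A + s * A' by rewrite -E; ring.
  have [s00|s00] := eqVneq s 0; first by rewrite s00 in E; case: sd => -[]; qlra.
  have {s00}s0 : 0 < s by rewrite lt_neqAle eq_sym s00.
  by clear -E s0 s1 sd; case: sd => -[l1 l2]; nra.
exists (fun q => Q (P q)); split; first exact: iso_comp.
- split=> //; [exact: cross_h C|exact: cross_h0 C|exact: cross_h1 C|].
  move=> y yY aX h0 bE.
  have [bb _ sd] := side _ aX h0.
  by move: sd; rewrite -bb bE ltxx => -[[]|[]].
- by rewrite -QE -PE image_comp.
Qed.

Lemma reparam_spans a X0 X1 Y0 Y1 d (f g g' : R -> R) : spans a X0 X1 Y0 Y1 d ->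
  X0 < X1 -> continuous f -> {homo f : x y / x < y} -> {homo g : x y / x < y} ->
  continuous g' ->
  (forall t, Y0 <= t <= Y1 -> g' (g t) = t) ->
  (forall x, g Y0 <= x <= g Y1 -> Y0 <= g' x <= Y1 /\ g (g' x) = x) ->
  exists d', spans (fun y => f (a (g' y))) (f X0) (f X1) (g Y0) (g Y1) d'.
Proof.
move=> S XX cf fm gm cg' gK g'P.
have YY := spans_lt S; have d0 := spans_d S; have dd := spans_len S XX.
have gl x y : g x < g y -> x < y.
  by move=> xy; rewrite ltNge; apply/negP; rewrite le_eqVlt => /orP[/eqP E|/gm]; [rewrite E ltxx in xy|move/lt_trans => /(_ _ xy); rewrite ltxx].
have gle x y : g x <= g y -> x <= y.
  by move=> xy; rewrite leNgt; apply/negP => /gm; rewrite ltNge xy.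
have h1 := gm Y0 (Y0 + d); have h2 := gm (Y1 - d) Y1; have h3 := gm Y0 Y1 YY.
have {}h1 : g Y0 < g (Y0 + d) by apply: h1; qlra.
have {}h2 : g (Y1 - d) < g Y1 by apply: h2; qlra.
have h4 : g (Y0 + d) < g Y1 by apply: gm; qlra.
have h5 : g Y0 < g (Y1 - d) by apply: gm; qlra.
exists (Num.min (g (Y0 + d) - g Y0) (g Y1 - g (Y1 - d))); split.
- by have ca := spans_cts S; have := ctscomp cg' ca => k; have := ctscomp k cf.
- exact: gm.
- by rewrite lt_min !subr_gt0 h1.
- by rewrite gK ?lexx ?(ltW YY) // (spans0 S).
- by rewrite gK ?lexx ?(ltW YY) // (spans1 S).
- move=> y /andP[y1 y2]; have {}y2 : y <= g (Y0 + d).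
    have : Num.min (g (Y0 + d) - g Y0) (g Y1 - g (Y1 - d)) <= g (Y0 + d) - g Y0.
      by rewrite ge_min lexx.
    by qlra.
  have [|yY yE] := g'P y; first by apply/andP; split; qlra.
  rewrite -yE in y1 y2; apply: fm; apply: (spansL S).
  by rewrite (gl _ _ y1) (gle _ _ y2).
- move=> y /andP[y1 y2]; have {}y1 : g (Y1 - d) <= y.
    have : Num.min (g (Y0 + d) - g Y0) (g Y1 - g (Y1 - d)) <= g Y1 - g (Y1 - d).
      by rewrite ge_min lexx orbT.
    by qlra.
  have [|yY yE] := g'P y; first by apply/andP; split; qlra.
  rewrite -yE in y1 y2; apply: fm; apply: (spansR S).
  by rewrite (gl _ _ y2) (gle _ _ y1).
Qed.

Lemma reparam a b h X0 X1 Y0 Y1 d (f g : R -> R) k l :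
  crossing a b h X0 X1 Y0 Y1 d -> continuous f -> continuous g -> 0 < k -> 0 < l ->
  (forall x y, x < y -> k * (y - x) <= f y - f x) ->
  (forall x y, x < y -> l * (y - x) <= g y - g x) ->
  exists P a' b' h' d', [/\ iso P, crossing a' b' h' (f X0) (f X1) (g Y0) (g Y1) d',
    P @` cset a b h X0 X1 Y0 Y1 = cset a' b' h' (f X0) (f X1) (g Y0) (g Y1),
    forall y, Y0 <= y <= Y1 -> a' (g y) = f (a y)
  & (forall x, X0 <= x <= X1 -> b' (f x) = g (b x) /\ h' (f x) = h x) /\
    forall x, f X0 <= x <= f X1 -> exists2 t, X0 <= t <= X1 & f t = x].
Proof.
move=> C cf cg k0 l0 fk gl.
have Sa := cross_a C; have Sb := cross_b C.
have YY := spans_lt Sa; have XX := spans_lt Sb.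
have fm : {homo f : x y / x < y}.
  by move=> x y xy; rewrite -subr_gt0; apply: lt_le_trans (fk _ _ xy); rewrite mulr_gt0 ?subr_gt0.
have gm : {homo g : x y / x < y}.
  by move=> x y xy; rewrite -subr_gt0; apply: lt_le_trans (gl _ _ xy); rewrite mulr_gt0 ?subr_gt0.
have flt x y : f x < f y -> x < y.
  by move=> xy; rewrite ltNge; apply/negP => /(ltW_homo fm); rewrite leNgt xy.
have [f' [cf' f'K f'I f'E]] := inverse_incr (ltW XX) cf (fun s t _ st _ => fm s t st).
have [g' [cg' g'K g'I g'E]] := inverse_incr (ltW YY) cg (fun s t _ st _ => gm s t st).
have [d1 S1] := reparam_spans Sa XX cf fm gm cg' g'K (fun x xx => conj (g'I x) (g'E x xx)).
have [d2 S2] := reparam_spans Sb YY cg gm fm cf' f'K (fun x xx => conj (f'I x) (f'E x xx)).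
have d10 := spans_d S1; have d20 := spans_d S2.
exists (fun q => (f q.1.1, g q.1.2, q.2)), (fun y => f (a (g' y))), (fun x => g (b (f' x))), (fun x => h (f' x)), (Num.min d1 d2); split.
- have i1 : iso (fun q : pt R => (f q.1.1, q.1.2, q.2)).
    apply: (@iso_mono_x _ (fun q => f q.1.1) k) => //; first by cts.
    by move=> x x' y z /fk.
  have i2 : iso (fun q : pt R => (q.1.1, g q.1.2, q.2)).
    apply: (@iso_mono _ (fun q => g q.1.2) l) => //; first by cts.
    by move=> x y y' z /gl.
  exact: (iso_comp i1 i2).
- split.
  + by apply: spans_weaken S1 _; rewrite lt_min d10 d20 ge_min lexx.
  + by apply: spans_weaken S2 _; rewrite lt_min d10 d20 ge_min lexx orbT.
  + exact: ctscomp cf' (cross_h C).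
  + by rewrite f'K ?lexx ?(ltW XX) // (cross_h0 C).
  + by rewrite f'K ?lexx ?(ltW XX) // (cross_h1 C).
  + move=> y yY /andP[fa0 fa1].
    have aX : X0 < a (g' y) < X1 by rewrite (flt _ _ fa0) (flt _ _ fa1).
    have /andP[/ltW aX0 /ltW aX1] := aX.
    rewrite f'K ?aX0 // => h0 E.
    apply: (cross_disj C (g'I y) aX h0).
    apply: (inc_inj (le_mono gm)); rewrite E g'E //.
- apply/seteqP; split=> [_ [_ [[y yY ->]|[x xX ->]] <-]|_ [[y yY ->]|[x xX ->]]] /=.
  + left; exists (g y); last by rewrite g'K.
    by have /andP[y0 y1] := yY; rewrite !(ltW_homo gm).
  + right; exists (f x); last by rewrite f'K.
    by have /andP[x0 x1] := xX; rewrite !(ltW_homo fm).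
  + exists (a (g' y), g' y, 0); last by rewrite /= g'E.
    by left; exists (g' y).
  + exists (f' x, b (f' x), h (f' x)); last by rewrite /= f'E.
    by right; exists (f' x).
- by move=> y yY; rewrite g'K.
- split=> x xX; first by rewrite f'K.
  by exists (f' x); [exact: f'I | exact: f'E].
Qed.

(** There are [r] zeros of the height; [s i] is the rank of the level of the i-th zero, counted
    along x, and [right j] tells whether the arc passes the zero at the j-th level on its right. Any
    pair of graphs with these data can replace the given one: rescaling x and y puts positions and
    levels in place, and [cross_match] does the rest. The new height is not prescribed; it is
    whatever the isotopy carries along. *)
Lemma normal_form a b h X0 X1 Y0 Y1 d : crossing a b h X0 X1 Y0 Y1 d ->
  exists (r : nat) (s : nat -> nat) (right : nat -> bool),
    (forall i, (0 < i <= r)%N -> (0 < s i <= r)%N) /\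
    forall (a' b' : R -> R) (x y : nat -> R) d',
      spans a' (x 0%N) (x r.+1) (y 0%N) (y r.+1) d' ->
      spans b' (y 0%N) (y r.+1) (x 0%N) (x r.+1) d' ->
      (forall i, (i <= r)%N -> x i < x i.+1) ->
      (forall i, (i <= r)%N -> y i < y i.+1) ->
      (forall i, (0 < i <= r)%N -> b' (x i) = y (s i) /\
         if right (s i) then x i < a' (y (s i)) else a' (y (s i)) < x i) ->
      exists (P : pt R -> pt R) h' d'', [/\ iso P,
        crossing a' b' h' (x 0%N) (x r.+1) (y 0%N) (y r.+1) d''
      & P @` cset a b h X0 X1 Y0 Y1 = cset a' b' h' (x 0%N) (x r.+1) (y 0%N) (y r.+1)].
Proof.
move=> C; have [P1 [h1 [zs [d1 [i1 C1 E1 Z1]]]]] := reduce_zeros C.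
have [P2 [b2 [d2 [i2 C2 E2 L2 I2]]]] := reduce_levels C1 Z1.
have XX := spans_lt (cross_b C); have YY := spans_lt (cross_a C).
pose us := undup [seq x <- zs | (X0 < x < X1) && (h1 x == 0)].
have usP x : (x \in us) = (X0 < x < X1) && (h1 x == 0).
  rewrite mem_undup mem_filter; apply: andb_idr => /andP[xX /eqP hx].
  by have [] := Z1 x xX hx.
pose vs := map b2 us.
have [x|u [u0 u1 uinc uex uin]] := sorted_points XX (zs := us) (undup_uniq _).
  by rewrite usP => /andP[].
have [||v [v0 v1 vinc vex vin]] := sorted_points YY (zs := vs).
- rewrite map_inj_in_uniq ?undup_uniq // => x x'.
  rewrite !usP => /andP[xX /eqP hx] /andP[x'X /eqP hx'].
  exact: I2.
- by move=> y /mapP[x]; rewrite usP => /andP[xX /eqP hx] ->; exact: L2.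
rewrite size_map in v1 vinc vex vin; pose r := size us.
have sex i : exists j, (0 < i <= r)%N -> (0 < j <= r)%N /\ v j = b2 (u i).
  have [ir|ir] := boolP (0 < i <= r)%N; last by exists 0%N.
  have [|j jr jE] := vex (b2 (u i)); first by rewrite map_f // uin.
  by exists j.
have [s sP] := choice sex.
pose right j := `[< exists2 i, (0 < i <= r)%N & s i = j /\ u i < a (v j) >].
exists r, s, right; split=> [i ir|a' b' x y d' Sa' Sb' xinc yinc side].
  by have [] := sP i ir.
have [f [k [cf k0 fk fE]]] := @interp R u x r.+1 uinc xinc.
have [g [l [cg l0 gl gE]]] := @interp R v y r.+1 vinc yinc.
have [P3 [a3 [b3 [h3 [d3 [i3 C3 E3 A3 [B3 S3]]]]]]] := reparam C2 cf cg k0 l0 fk gl.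
have fm : {homo f : x y / x < y}.
  by move=> p q pq; rewrite -subr_gt0; apply: lt_le_trans (fk _ _ pq); rewrite mulr_gt0 ?subr_gt0.
have f0 : f X0 = x 0%N by rewrite -u0 fE.
have f1 : f X1 = x r.+1 by rewrite -u1 fE.
have g0 : g Y0 = y 0%N by rewrite -v0 gE.
have g1 : g Y1 = y r.+1 by rewrite -v1 gE.
rewrite f0 f1 g0 g1 in C3 E3 S3.
have [t tX ht|P4 [i4 C4 E4]] := cross_match C3 Sa' Sb'; last first.
  exists (fun q => P4 (P3 (P2 (P1 q)))), h3, d'; split=> //.
    exact: (iso_comp i4 (iso_comp i3 (iso_comp i2 i1))).
  rewrite -E4 -E3 -E2 -E1; apply/seteqP; split=> [_ [q qc <-]|_ [_ [_ [_ [q qc <-] <-] <-] <-]].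
    by exists (P3 (P2 (P1 q))) => //; exists (P2 (P1 q)) => //; exists (P1 q) => //; exists q.
  by exists q.
have /andP[t0 t1] := tX.
have [|z zX zE] := S3 t; first by rewrite !ltW.
have [b3z h3z] := B3 z zX; rewrite zE in b3z h3z.
have {}zX : X0 < z < X1.
  have flt p q : f p < f q -> p < q.
    by move=> pq; rewrite ltNge; apply/negP => /(ltW_homo fm); rewrite leNgt pq.
  by apply/andP; split; apply: flt; rewrite zE ?f0 ?f1.
have hz : h1 z = 0 by rewrite -h3z.
have [|i ir uE] := uex z; first by rewrite usP zX hz eqxx.
have tE : t = x i by rewrite -zE -uE fE //; case/andP: ir => _ /leqW.
have [sr vE] := sP i ir.
have bzE : b2 z = v (s i) by rewrite vE uE.
have gv : g (v (s i)) = y (s i) by rewrite gE //; case/andP: sr => _ /leqW.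
have [b'E sd] := side i ir.
have Lz := L2 z zX hz; have /andP[Lz0 Lz1] := Lz.
have a3E : a3 (y (s i)) = f (a (v (s i))).
  by rewrite -gv A3 // -bzE !ltW.
have gm : {homo g : x y / x < y}.
  by move=> p q pq; rewrite -subr_gt0; apply: lt_le_trans (gl _ _ pq); rewrite mulr_gt0 ?subr_gt0.
rewrite b3z bzE gv tE b'E; split=> //.
  by rewrite -gv -bzE -g0 -g1 !gm.
rewrite a3E -tE -zE -uE.
have [lt|le] := ltP (u i) (a (v (s i))).
  have rt : right (s i) by apply/asboolP; exists i.
  by right; rewrite rt in sd; split; [exact: fm | rewrite uE zE tE].
have ne : a (v (s i)) != u i.
  apply/eqP => E; apply: (cross_disj C2 (y := v (s i))); rewrite ?E ?uE //.
  by rewrite -bzE !ltW.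
have lt : a (v (s i)) < u i by rewrite lt_neqAle ne.
(* Distinct zeros have distinct levels, so a witness for [right (s i)] could only be the zero [i]
   itself. *)
have rt : right (s i) = false.
  apply/negP => /asboolP[j jr [sj ltj]].
  have [_ vj] := sP j jr; have [_ vi] := sP i ir.
  have := uin j jr; have := uin i ir; rewrite !usP => /andP[iX /eqP hi] /andP[jX /eqP hj].
  have uu : u j = u i by apply: I2 => //; rewrite -vj -vi sj.
  by rewrite uu in ltj; move: (lt_trans lt ltj); rewrite ltxx.
by left; rewrite rt in sd; split; [exact: fm | rewrite uE zE tE].
Qed.

End NormalForm.

(** * From a combed zigzag to a crossing curve *)

Section Crossing.
Context {R : realType}.
Implicit Types x y s : R.

Lemma cos_lip (x y : R) : `|cos x - cos y| <= `|x - y|.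
Proof.
wlog xy : x y / y <= x.
  by move=> W; have [/W//|/ltW/W] := le_or_lt y x; rewrite distrC [X in _ <= X]distrC.
have [|c _ ->] := MVT_segment xy (fun c _ => is_derive_cos c).
  by apply: continuous_subspaceT; exact: continuous_cos.
rewrite normrM normrN; apply: ler_piMl; first exact: normr_ge0.
by rewrite ler_norml sin_geN1 sin_le1.
Qed.

Lemma cos_pi_nat (j : nat) : cos (pi * j%:R) = (-1) ^+ j :> R.
Proof.
elim: j => [|j IH]; first by rewrite mulr0 cos0.
by rewrite -natr1 mulrDr mulr1 cosDpi IH exprS mulN1r.
Qed.

(** The increase [G' - G] is split in halves: one pays for the change of the cosine, the other
    remains against the displacement of x. *)
Lemma tilt_ineq (K C x x' G G' c c' : R) : 0 < K -> K * C * pi <= 1 / 2 ->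
  `|x| <= C -> `|c' - c| <= pi * (G' - G) -> G <= G' ->
  0 < (G' - G) / 2 + K * ((x' - x) * c') -> G + K * x * c < G' + K * x' * c'.
Proof.
move=> K0 KC xC cG GG D.
have h : - ((G' - G) / 2) <= K * (x * (c' - c)).
  have h1 : `|x * (c' - c)| <= C * (pi * (G' - G)).
    by rewrite normrM ler_pM.
  have h2 : K * (C * (pi * (G' - G))) <= (G' - G) / 2.
    have -> : K * (C * (pi * (G' - G))) = K * C * pi * (G' - G) by ring.
    have -> : (G' - G) / 2 = 1 / 2 * (G' - G) by ring.
    by apply: ler_wpM2r => //; rewrite subr_ge0.
  have := ler_wpM2l (ltW K0) h1; have := ler_norm (- (x * (c' - c))); rewrite normrN => h3 h4.
  have := ler_wpM2l (ltW K0) h3; qlra.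
have -> : G' + K * x' * c' = G + K * x * c + ((G' - G) / 2 + K * ((x' - x) * c'))
   + ((G' - G) / 2 + K * (x * (c' - c))) by field.
qlra.
Qed.

(** The last strand has index [m.+1], and strands 0 to [m] are straight. Even strands run to the
    right and odd ones to the left, so an even [m] lets the arc end as it begins, on a strand that
    runs to the right. *)
Record final (m : nat) (w : nat -> R) (Y Z : nat -> R -> R) (b : nat -> R) (d : R)
    : Prop := Final {
  final_combed : combed m.+1 w m.+1 Y Z b d;
  final_wall : forall j, (j <= m)%N -> 2 < (-1) ^+ j * (w j.+1 - w j);
  final_even : ~~ odd m;
  final_close : w m.+2 = w 0%N;
  final_lt : w 0%N + 1 < w m.+1 }.

Lemma combed_level m w Y Z b d j x  (F : final m w Y Z b d) : (j <= m)%N -> strand w j x ->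
  Y j x = Num.min (b j.-1 + `|x - w j|) (b j) /\ Z j x = 0.
Proof.
case: j => [|j] jm sx; last exact: (combed_row (final_combed F)).
have [-> ->] := combed_row0 (final_combed F) (ltn0Sn m) sx; split=> //.
by rewrite min_r // lerDl.
Qed.

Lemma combed_flat m w Y Z b d j  (F : final m w Y Z b d) : (j <= m)%N -> b j.-1 <= b j <= b j.-1 + 1.
Proof.
case: j => [|j] jm /=; first by rewrite lexx lerDl ler01.
by have /andP[/ltW -> ->] := combed_b (final_combed F) (jm : (j.+1 < m.+1)%N).
Qed.

Lemma wall_gap m w Y Z b d j  (F : final m w Y Z b d) : (j <= m)%N -> 2 < `|w j.+1 - w j|.
Proof.
move=> jm; apply: lt_le_trans (final_wall F jm) _; apply: le_trans (ler_norm _) _.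
by rewrite normrM normrX normrN1 expr1n mul1r.
Qed.

Lemma combed_end m w Y Z b d j  (F : final m w Y Z b d) : (j <= m)%N -> Y j (w j.+1) = b j.
Proof.
move=> jm; have [-> _] := combed_level F jm (betweenr _ _).
have := wall_gap F jm; have /andP[_] := combed_flat F jm.
by move=> h1 h2; rewrite min_r //; qlra.
Qed.

Lemma combed_start m w Y Z b d j  (F : final m w Y Z b d) : (j <= m)%N -> Y j (w j) = b j.-1.
Proof.
move=> jm; have [-> _] := combed_level F jm (betweenl _ _).
by rewrite subrr normr0 addr0 min_l //; case/andP: (combed_flat F jm).
Qed.

Lemma last_strand m w Y Z b d x  (F : final m w Y Z b d) : strand w m.+1 x = (w 0%N <= x <= w m.+1).
Proof.
rewrite /strand /between (final_close F) orbC; have w0N := final_lt F; case: (boolP (_ <= x <= _)) => //= _.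
by apply/negP => /andP[h1 h2]; qlra.
Qed.

Lemma first_cone m w Y Z b d x  (F : final m w Y Z b d) : w 0%N <= x <= w 0%N + d ->
  Y m.+1 x = b 0%N - (x - w 0%N) /\ Z m.+1 x = 0.
Proof.
move=> /andP[x0 xd]; have /andP[d0 d1] := combed_d (final_combed F).
have w1 := final_wall F (leq0n m); rewrite expr0 mul1r in w1.
have s0 : strand w 0 x by apply/orP; left; apply/andP; split; qlra.
have lt := final_lt F; have sN : strand w m.+1 x by rewrite (last_strand _ F) x0; qlra.
have n : `|x - w 0%N| = x - w 0%N by rewrite ger0_norm // subr_ge0.
have [|E1 E2] := combed_cone0 (final_combed F) s0 sN; first by rewrite n; qlra.
have [L0 L1] := combed_row0 (final_combed F) (ltn0Sn m) s0.
by split; [rewrite L0 n in E1; qlra | rewrite -E2].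
Qed.

Lemma last_cone m w Y Z b d x  (F : final m w Y Z b d) : w m.+1 - d <= x <= w m.+1 ->
  Y m.+1 x = b m + (w m.+1 - x) /\ Z m.+1 x = 0.
Proof.
move=> /andP[x0 xd]; have /andP[d0 d1] := combed_d (final_combed F).
have lt := final_lt F; have sN : strand w m.+1 x by rewrite (last_strand _ F) xd andbT; qlra.
have n : `|x - w m.+1| = w m.+1 - x by rewrite ler0_norm ?opprB // subr_le0.
have [||E1 E2] := combed_cone (final_combed F) (j := m) _ sN; rewrite ?leqnn ?n //; first by qlra.
have g := final_wall F (leqnn m); rewrite -signr_odd (negbTE (final_even F)) expr0 mul1r in g.
have sm : strand w m x by apply/orP; left; apply/andP; split; qlra.
have [Ym Zm] := combed_level F (leqnn m) sm.
have /andP[_ f2] := combed_flat F (leqnn m).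
rewrite n in E1; rewrite E1 E2 Zm Ym min_r; first by split=> //; rewrite addrC.
by apply: le_trans f2 _; rewrite lerD2l; apply: le_trans (ler_norm _); qlra.
Qed.

(** The strand on which the k-th path lies: path 0 and path [m.+2] are the two half cones on the
    last strand, and beyond them the path is constant. *)
Definition piece (m k : nat) := if (0 < k <= m.+1)%N then k.-1 else m.+1.

(* The curve without the middle part of the last strand: half a cone at each
   end of the horizontal strands. *)
Definition px (m : nat) (w : nat -> R) (d : R) (k : nat) (s : R) : R :=
  if k is j.+1 then
    if (j <= m)%N then w j + s * (w j.+1 - w j)
    else if j == m.+1 then w m.+1 - s * (d / 2) else w m.+1 - d / 2
  else w 0%N + (1 - s) * (d / 2).

Definition py m w d (Y : nat -> R -> R) k s := Y (piece m k) (px m w d k s).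

Lemma px_glue m w d k : px m w d k 1 = px m w d k.+1 0.
Proof.
case: k => [|j]; rewrite /px /=; first by rewrite subrr !mul0r !addr0.
have [jm|jm|->] := ltngtP j m; rewrite ?(ltnW jm) ?jm.
- by rewrite mul1r mul0r addr0 subrKC.
- rewrite [j.+1 == _](gtn_eqF (jm : (m.+1 < j.+1)%N)).
  by case: eqP => _ //; rewrite mul1r.
- by rewrite eqxx mul1r mul0r subr0 subrKC.
Qed.

Lemma piece_row m j : (j <= m)%N -> piece m j.+1 = j.
Proof. by move=> jm; rewrite /piece /= ltnS jm. Qed.

Lemma piece_last m k : (m < k.-1)%N -> piece m k = m.+1.
Proof. by case: k => // k; rewrite /piece /= ltnS => mk; rewrite leqNgt mk. Qed.

Lemma py_glue m w Y Z b d k  (F : final m w Y Z b d) : py m w d Y k 1 = py m w d Y k.+1 0.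
Proof.
have /andP[d0 d1] := combed_d (final_combed F).
rewrite /py px_glue; case: k => [|j].
  rewrite piece_row //; rewrite /px /= mul0r addr0 /piece /=.
  have [|-> _] := first_cone (x := w 0%N) F; first by apply/andP; split; qlra.
  by rewrite subrr subr0 -[b 0%N]/(b 0.-1) (combed_start F).
have [jm|jm|->] := ltngtP j m.
- rewrite !piece_row ?(ltnW jm) // /px jm mul0r addr0.
  by rewrite (combed_end F) ?(ltnW jm) // (combed_start F).
- by rewrite (piece_last (k := j.+1)) // (piece_last (k := j.+2)) // leqW.
- rewrite piece_row // piece_last // /px ltnn eqxx mul0r subr0 (combed_end F) //.
  have [|-> _] := last_cone (x := w m.+1) F; first by apply/andP; split; qlra.
  by rewrite subrr addr0.
Qed.

Lemma px_cts m w d k : continuous (px m w d k).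
Proof.
case: k => [|j]; rewrite /px; first by cts.
by case: (j <= m)%N; [cts | case: (j == m.+1); cts].
Qed.

Lemma py_cts m w Y Z b d k  (F : final m w Y Z b d) : continuous (py m w d Y k).
Proof.
have cY0 : forall i, continuous (Y i) := combed_ctsY (final_combed F).
have cY := cY0 (piece m k).
have cx := @px_cts m w d k; exact: (ctscomp cx cY).
Qed.

Lemma px_strand m w Y Z b d k s  (F : final m w Y Z b d) : (k <= m.+2)%N -> 0 <= s <= 1 ->
  strand w (piece m k) (px m w d k s) /\ Z (piece m k) (px m w d k s) = 0.
Proof.
have /andP[d0 d1] := combed_d (final_combed F).
have lt := final_lt F; move=> km /andP[s0 s1].
have b1 : 0 <= s * (d / 2) <= d / 2.
  by rewrite mulr_ge0 ?ler_piMl //; qlra.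
have b2 : 0 <= (1 - s) * (d / 2) <= d / 2.
  by rewrite mulr_ge0 ?ler_piMl //; qlra.
case: k km => [_|j]; first rewrite /piece /=.
  have [|_ ->] := first_cone (x := w 0%N + (1 - s) * (d / 2)) F.
    by apply/andP; split; qlra.
  by split=> //; rewrite (last_strand _ F); apply/andP; split; qlra.
rewrite ltnS leq_eqVlt => /orP[/eqP->|].
  rewrite piece_last // /px ltnn eqxx.
  have [|_ ->] := last_cone (x := w m.+1 - s * (d / 2)) F.
    by apply/andP; split; qlra.
  by split=> //; rewrite (last_strand _ F); apply/andP; split; qlra.
rewrite ltnS => jm; rewrite piece_row // /px jm.
suff sj : strand w j (w j + s * (w j.+1 - w j)) by split=> //; have [] := combed_level F jm sj.
rewrite /strand /between; have [g|g] := le_or_lt 0 (w j.+1 - w j); apply/orP; [left|right].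
  have : 0 <= s * (w j.+1 - w j) <= w j.+1 - w j by rewrite mulr_ge0 // ler_piMl.
  by move=> /andP[? ?]; apply/andP; split; qlra.
have : 0 <= s * (w j - w j.+1) <= w j - w j.+1 by rewrite mulr_ge0 ?ler_piMl //; qlra.
by move=> /andP[? ?]; apply/andP; split; qlra.
Qed.

Lemma px_row m w Y Z b d j x  (F : final m w Y Z b d) : (j <= m)%N -> strand w j x -> exists2 s, 0 <= s <= 1 & px m w d j.+1 s = x.
Proof.
move=> jm sx; rewrite /px jm; have g := wall_gap F jm.
have nz : w j.+1 - w j != 0 by rewrite -normr_gt0; qlra.
exists ((x - w j) / (w j.+1 - w j)); last by rewrite divfK // subrKC.
move: sx; rewrite /strand /between; case/orP => /andP[h1 h2].
  have p : 0 < w j.+1 - w j by rewrite lt_neqAle eq_sym nz; qlra.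
  by rewrite divr_ge0 ?ler_pdivrMr ?mul1r ?(ltW p) ?subr_ge0 //; qlra.
have p : w j.+1 - w j < 0 by rewrite lt_neqAle nz; qlra.
by rewrite ler_ndivlMr // mul0r ler_ndivrMr // mul1r; qlra.
Qed.

(** Where a strand has slope 1 or -1, [g] grows at least [k] times as fast as x changes, and
    [K < k / 2] makes the tilt the weaker effect. *)
Lemma tilt_diag (g : R -> R) (k K x x' y y' : R) : 0 < k ->
  (forall x y : R, x < y -> k * (y - x) <= g y - g x) -> 0 < K < k / 2 ->
  y < y' -> `|x' - x| = y' - y ->
  g y <= g y' /\ 0 < (g y' - g y) / 2 + K * ((x' - x) * cos (pi * g y')).
Proof.
move=> k0 gk /andP[K0 Kk] yy xE; have h := gk _ _ yy.
have k1 : 0 < k * (y' - y) by rewrite mulr_gt0 ?subr_gt0.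
split; first by qlra.
have c1 : `|(x' - x) * cos (pi * g y')| <= y' - y.
  by rewrite normrM xE ler_piMr ?subr_ge0 ?(ltW yy) // ler_norml cos_geN1 cos_le1.
have h1 := ler_norm (- ((x' - x) * cos (pi * g y'))); rewrite normrN in h1.
have h2 := ler_wpM2l (ltW K0) (le_trans h1 c1).
have h3 : K * (y' - y) < k / 2 * (y' - y) by rewrite ltr_pM2r ?subr_gt0.
have h4 : k / 2 * (y' - y) = k * (y' - y) / 2 by field.
by qlra.
Qed.

(** Cones are handled by [tilt_diag]. On the horizontal part of strand [j] the rescaled level is
    [j], and the cosine there is [(-1) ^+ j], the direction in which the strand runs; so the tilt
    makes it rise. *)
Lemma piece_lt m w Y Z b d (g : R -> R) (kk K : R) k (s t : R) (F : final m w Y Z b d) :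
  0 < kk -> (forall x y : R, x < y -> kk * (y - x) <= g y - g x) ->
  (forall j, (j <= m)%N -> g (b j) = j%:R) -> 0 < K < kk / 2 ->
  (k <= m.+2)%N -> 0 <= s -> s < t -> t <= 1 ->
  g (py m w d Y k s) <= g (py m w d Y k t) /\
  0 < (g (py m w d Y k t) - g (py m w d Y k s)) / 2 +
      K * ((px m w d k t - px m w d k s) * cos (pi * g (py m w d Y k t))).
Proof.
move=> kk0 gk gb K0k km s0 st t1.
have /andP[d0 d1] := combed_d (final_combed F); have lt := final_lt F.
have e0 : 0 < (t - s) * (d / 2) by rewrite mulr_gt0 //; qlra.
have bs : 0 <= s * (d / 2) <= d / 2 by rewrite mulr_ge0 ?ler_piMl //; qlra.
have bt : 0 <= t * (d / 2) <= d / 2 by rewrite mulr_ge0 ?ler_piMl //; qlra.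
case: k km => [_|j].
  have p0 (r : R) : px m w d 0 r = w 0%N + (1 - r) * (d / 2) by [].
  rewrite /py /piece !p0 /=.
  have [|-> _] := first_cone (x := w 0%N + (1 - s) * (d / 2)) F.
    by apply/andP; split; qlra.
  have [|-> _] := first_cone (x := w 0%N + (1 - t) * (d / 2)) F.
    by apply/andP; split; qlra.
  apply: (@tilt_diag g kk) => //; first by qlra.
  by rewrite ler0_norm; qlra.
rewrite ltnS leq_eqVlt => /orP[/eqP->|].
  rewrite /py piece_last // /px ltnn eqxx.
  have [|-> _] := last_cone (x := w m.+1 - s * (d / 2)) F.
    by apply/andP; split; qlra.
  have [|-> _] := last_cone (x := w m.+1 - t * (d / 2)) F.
    by apply/andP; split; qlra.
  apply: (@tilt_diag g kk) => //; first by qlra.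
  by rewrite ler0_norm; qlra.
rewrite ltnS => jm; rewrite /py piece_row //.
have h (u : R) : 0 <= u <= 1 -> Y j (px m w d j.+1 u) =
    Num.min (b j.-1 + u * `|w j.+1 - w j|) (b j).
  move=> /andP[u0 u1].
  have [|st' _] := px_strand (k := j.+1) (s := u) F (leqW (jm : (j.+1 <= m.+1)%N)); first by rewrite u0.
  rewrite piece_row // in st'; have [-> _] := combed_level F jm st'.
  by rewrite /px jm addrAC subrr add0r normrM (ger0_norm u0).
rewrite !h; try by apply/andP; split; qlra.
have E : px m w d j.+1 t - px m w d j.+1 s = (t - s) * (w j.+1 - w j).
  by rewrite /px jm; ring.
have gap := wall_gap F jm; have ts : 0 < t - s by qlra.
have L0 : 0 < (t - s) * `|w j.+1 - w j| by rewrite mulr_gt0 //; qlra.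
have [c|c] := leP (b j.-1 + t * `|w j.+1 - w j|) (b j).
  have c' : b j.-1 + s * `|w j.+1 - w j| <= b j by qlra.
  rewrite (min_l c').
  apply: (@tilt_diag g kk) => //; first by qlra.
  by rewrite E normrM (gtr0_norm ts); ring.
(* Only the cosine at the later point enters, so it does not matter whether the earlier point is
   still on the cone. *)
rewrite E gb // cos_pi_nat; set y := Num.min _ _.
have yb : y <= b j by rewrite /y ge_min lexx orbT.
have gy : g y <= j%:R.
  move: yb; rewrite le_eqVlt -gb // => /orP[/eqP -> //|yb].
  have := gk _ _ yb; have : 0 < kk * (b j - y) by rewrite mulr_gt0 ?subr_gt0.
  by qlra.
split=> //; have wj := final_wall F jm.
have : 0 < K * ((t - s) * (w j.+1 - w j) * (-1) ^+ j).
  have -> : K * ((t - s) * (w j.+1 - w j) * (-1) ^+ j) =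
    K * ((t - s) * ((-1) ^+ j * (w j.+1 - w j))) by ring.
  have /andP[K0 _] := K0k; have p : 0 < (-1) ^+ j * (w j.+1 - w j) by qlra.
  by rewrite mulr_gt0 // mulr_gt0.
by qlra.
Qed.

End Crossing.

Section FinalCrossing.
Context {R : realType}.
Implicit Types x y s t : R.

Lemma shift_itv k (t : R) : k%:R <= t <= k.+1%:R -> 0 <= t - k%:R <= 1.
Proof. by rewrite -natr1 => /andP[? ?]; apply/andP; split; qlra. Qed.

Lemma chain_pxE m w Y Z b d k (t : R) : final m w Y Z b d -> k%:R <= t <= k.+1%:R ->
  chain (px m w d) t = px m w d k (t - k%:R) /\
  chain (py m w d Y) t = py m w d Y k (t - k%:R).
Proof.
move=> F tk; split; apply: chainE_closed => //; first exact: px_glue.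
exact: (@py_glue _ _ _ _ _ _ _ k F).
Qed.

(** The tilt is y to [g y + K * x * cos (pi * g y)], where [g] sends the level [b j] to [j].
    Clamping x to the range of the curve bounds the perturbation on the whole space. *)
Lemma final_tilt m w Y Z b d (F : final m w Y Z b d) :
  exists tau : R -> R -> R,
  [/\ iso (fun q : pt R => (q.1.1, tau q.1.1 q.1.2, q.2)),
     continuous (fun q : R * R => tau q.1 q.2),
     forall x, injective (tau x),
     forall x x' y y' : R, w 0%N <= x <= w m.+1 -> y < y' -> `|x' - x| = y' - y ->
       w 0%N <= x' <= w m.+1 -> tau x y < tau x' y'
   & forall s t, 0 <= s -> s < t -> t <= m.+3%:R ->
       tau (chain (px m w d) s) (chain (py m w d Y) s) <
       tau (chain (px m w d) t) (chain (py m w d Y) t)].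
Proof.
have [C wb] : exists C : R, forall j, (j <= m.+1)%N -> `|w j| <= C.
  elim: (m.+1) => [|n [C IH]]; first by exists `|w 0%N| => -[].
  exists (Num.max C `|w n.+1|) => j; rewrite leq_eqVlt le_max => /orP[/eqP->|/IH->//].
  by rewrite lexx orbT.
have C0 : 0 <= C := le_trans (normr_ge0 _) (wb 0%N isT).
have xC k s : (k <= m.+2)%N -> 0 <= s <= 1 -> `|px m w d k s| <= C.
  move=> km s01; have [sx _] := px_strand F km s01.
  move: (px m w d k s) sx => x.
  have st j : (j <= m)%N -> strand w j x -> `|x| <= C.
    move=> jm; have := wb j (leqW jm); have := wb j.+1 jm.
    rewrite !ler_norml => /andP[? ?] /andP[? ?] /orP[|] /andP[? ?];
      by apply/andP; split; qlra.
  rewrite /piece; case: ifP => [/andP[k0 k1]|_]; first by apply: st; case: k k0 k1 {km s01}.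
  rewrite (last_strand _ F); have := wb 0%N isT; have := wb m.+1 (leqnn _).
  rewrite !ler_norml => /andP[? ?] /andP[? ?] /andP[? ?]; by apply/andP; split; qlra.
have incb i : (i < m)%N -> b i < b i.+1.
  by move=> im; have /andP[] := combed_b (final_combed F) (im : (i.+1 < m.+1)%N).
have [g [kk [cg kk0 gk gE]]] := @interp R b (fun i => i%:R) m incb
  (fun i _ => etrans (ltr_nat R i i.+1) (ltnSn i)).
have pi0 : 0 < pi :> R := pi_gt0 R.
(* The first bound is for the cones, the second one keeps the tilt expanding along y. [C + 1] avoids
   a division by 0. *)
pose K := Num.min (kk / 4) (1 / (2 * (C + 1) * pi)).
have K0 : 0 < K.
  by rewrite lt_min !divr_gt0 // !mulr_gt0 //; qlra.
have K0k : 0 < K < kk / 2.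
  have : K <= kk / 4 by rewrite ge_min lexx.
  by rewrite K0; qlra.
have KC : K * C * pi <= 1 / 2.
  have C1 : 0 < (C + 1) * pi by rewrite mulr_gt0 //; qlra.
  have h : K <= 1 / (2 * (C + 1) * pi) by rewrite ge_min lexx orbT.
  have -> : K * C * pi = K * (C * pi) by ring.
  apply: le_trans (_ : K * ((C + 1) * pi) <= _).
    by rewrite ler_pM2l // ler_pM2r //; qlra.
  by rewrite -ler_pdivlMr //; apply: le_trans h _; rewrite -[2 * _ * _]mulrA invfM mulrA.
pose tau (x y : R) := g y + K * clamp (- C) C x * cos (pi * g y).
have tauE (x y : R) : `|x| <= C -> tau x y = g y + K * x * cos (pi * g y).
  by rewrite ler_norml => xx; rewrite /tau clamp_id.
have gm (x y : R) : x < y -> g x < g y.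
  move=> xy; have := gk _ _ xy; have : 0 < kk * (y - x) by rewrite mulr_gt0 ?subr_gt0.
  by qlra.
have tlip (y y' : R) : y < y' ->
    `|cos (pi * g y') - cos (pi * g y)| <= pi * (g y' - g y).
  move=> yy; apply: le_trans (cos_lip _ _) _.
  by rewrite -mulrBr normrM (gtr0_norm pi0) ger0_norm // subr_ge0 ltW ?gm.
have taum (x y y' : R) : y < y' -> kk / 2 * (y' - y) <= tau x y' - tau x y.
  move=> yy; have h1 := gk _ _ yy; rewrite /tau; set X := clamp _ _ _.
  have XC : `|X| <= C by rewrite ler_norml clamp_itv //; qlra.
  have h2 : `|X * (cos (pi * g y') - cos (pi * g y))| <= C * (pi * (g y' - g y)).
    by rewrite normrM ler_pM // tlip.
  have h3 := ler_norm (- (X * (cos (pi * g y') - cos (pi * g y)))); rewrite normrN in h3.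
  have h4 := ler_wpM2l (ltW K0) (le_trans h3 h2).
  have h5 : K * (C * (pi * (g y' - g y))) <= (g y' - g y) / 2.
    have -> : K * (C * (pi * (g y' - g y))) = K * C * pi * (g y' - g y) by ring.
    have -> : (g y' - g y) / 2 = 1 / 2 * (g y' - g y) by ring.
    by apply: ler_wpM2r => //; rewrite subr_ge0 ltW ?gm.
  have h6 : kk / 2 * (y' - y) = kk * (y' - y) / 2 by field.
  by qlra.
have ccos : continuous (cos : R -> R) := @continuous_cos R.
have taui (x y y' : R) : tau x y = tau x y' -> y = y'.
  have lt (z z' : R) : z < z' -> tau x z < tau x z'.
    move=> zz; have := taum x _ _ zz; have : 0 < kk / 2 * (z' - z).
      by rewrite mulr_gt0 ?subr_gt0 //; qlra.
    by qlra.
  by move=> E; have [/lt|/lt|//] := ltgtP y y'; rewrite E ltxx.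
pose P (q : pt R) : pt R := (q.1.1, tau q.1.1 q.1.2, q.2).
have iP : iso P.
  apply: (@iso_mono _ (fun q => tau q.1.1 q.1.2) (kk / 2)); first by rewrite /tau /clamp; cts.
    by qlra.
  by move=> x y y' z /taum.
pose cx := chain (px m w d); pose cy := chain (py m w d Y).
pose u (t : R) := tau (cx t) (cy t).
have cE k t := @chain_pxE m w Y Z b d k t F.
have umono (s t : R) : 0 <= s -> s < t -> t <= m.+3%:R -> u s < u t.
  move: s t; apply: (@incr_glue _ u 0 m.+3%:R 0 m.+3) => //.
  - by move=> ? ? h1 h2 h3; qlra.
  - move=> k s t km ks st tk; rewrite /u /cx /cy.
    have ks' : k%:R <= s <= k.+1%:R by rewrite ks; qlra.
    have kt' : k%:R <= t <= k.+1%:R by rewrite tk andbT; qlra.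
    have [-> ->] := cE _ _ ks'; have [-> ->] := cE _ _ kt'.
    have S := shift_itv ks'; have T := shift_itv kt'.
    rewrite !tauE; try by apply: xC.
    have /andP[s0 _] := S; have /andP[_ t1] := T.
    have st' : s - k%:R < t - k%:R by rewrite ltrD2r.
    have [G1 G2] := piece_lt F kk0 gk gE K0k km s0 st' t1.
    apply: (tilt_ineq K0 KC) => //; first exact: xC.
    apply: le_trans (cos_lip _ _) _.
    by rewrite -mulrBr normrM (gtr0_norm pi0) ger0_norm // subr_ge0.
  - by move=> ? ? h1 h2 h3; qlra.
have XC (x : R) : w 0%N <= x <= w m.+1 -> `|x| <= C.
  have := wb 0%N isT; have := wb m.+1 (leqnn _).
  by rewrite !ler_norml => /andP[? ?] /andP[? ?] /andP[? ?]; apply/andP; split; qlra.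
exists tau; split; [exact: iP|by rewrite /tau /clamp; cts|by move=> x y y'; exact: taui| |exact: umono].
move=> x x' y y' xI yy xE x'I; rewrite !tauE ?XC //.
have [G1 G2] := tilt_diag kk0 gk K0k yy xE.
by apply: (tilt_ineq K0 KC) => //; [exact: XC | exact: tlip].
Qed.

Lemma chain_px0 m w (d t : R) : 0 <= t <= 1 ->
  chain (px m w d) t = w 0%N + (1 - t) * (d / 2).
Proof.
move=> t01; rewrite (@chainE_closed _ _ _ 0 t) //; last exact: px_glue.
by rewrite subr0.
Qed.

Lemma chain_px1 m w (d t : R) : m.+2%:R <= t <= m.+3%:R ->
  chain (px m w d) t = w m.+1 - (t - m.+2%:R) * (d / 2).
Proof.
move=> t01; rewrite (@chainE_closed _ _ _ m.+2 t) //; last exact: px_glue.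
by rewrite /px ltnn eqxx.
Qed.

Lemma chain_strand m w Y Z b d t (F : final m w Y Z b d) :
  let cx := @chain R R (px m w d) in let cy := @chain R R (py m w d Y) in
  0 <= t <= m.+3%:R -> exists i, [/\ (i <= m.+1)%N, strand w i (cx t),
    cy t = Y i (cx t) /\ Z i (cx t) = 0 & i = m.+1 -> cx t <= w 0%N + d / 2 \/ w m.+1 - d / 2 <= cx t].
Proof.
have /andP[d0 d1] := combed_d (final_combed F).
move=> cx cy /andP[t0 t1].
  have [k km tk] : exists2 k, (k <= m.+2)%N & k%:R <= t <= k.+1%:R.
    have [tE|tE] := eqVneq t m.+3%:R.
      by exists m.+2 => //; rewrite tE lexx andbT ler_nat.
    have {tE}t1 : t < m.+3%:R by rewrite lt_neqAle tE.
    have /andP[h1 h2] := Num.Theory.truncn_itv t0.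
    exists (Num.truncn t); last by rewrite h1 ltW.
    by rewrite -ltnS -(ltr_nat R); exact: le_lt_trans h1 t1.
  have [xE yE] := chain_pxE F tk; have s01 := shift_itv tk.
  have [st Z0] := px_strand F km s01.
  exists (piece m k); rewrite /cx /cy xE yE; split=> //.
    by rewrite /piece; case: ifP => // /andP[]; case: (k) => //= k' _; rewrite ltnS => /leqW.
  have /andP[s0 s1] := s01.
  case: k km tk xE yE s01 st Z0 s0 s1 => [|j] km tk xE yE s01 st Z0 s0 s1 iE.
    left; rewrite -[px _ _ _ _ _]/(w 0%N + (1 - (t - 0)) * (d / 2)).
    have : 0 <= (t - 0) * (d / 2) by rewrite mulr_ge0 //; qlra.
    by qlra.
  have jE : j = m.+1.
    apply/eqP; rewrite eqn_leq -ltnS km /= ltnNge; apply/negP => jm.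
    by rewrite piece_row // in iE; rewrite iE ltnn in jm.
  right; rewrite /px jE ltnn eqxx.
  have : (t - j.+1%:R) * (d / 2) <= d / 2 by rewrite ler_piMl //; qlra.
  by rewrite jE; qlra.
Qed.

Lemma chain_onto m w Y Z b d i x (F : final m w Y Z b d) : (i <= m)%N -> strand w i x ->
  exists2 t : R, 0 <= t <= m.+3%:R &
    chain (px m w d) t = x /\ chain (py m w d Y) t = Y i x.
Proof.
have /andP[d0 d1] := combed_d (final_combed F).
  move=> im sx; have [s s01 sE] := px_row F im sx; have /andP[s0 s1] := s01.
  have ts : i.+1%:R <= i.+1%:R + s <= i.+2%:R by rewrite -[i.+2%:R]natr1; apply/andP; split; qlra.
  exists (i.+1%:R + s).
    apply/andP; split; first by have := ler0n R i.+1; qlra.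
    have : i.+2%:R <= m.+3%:R :> R by rewrite ler_nat !ltnS; exact: leqW.
    by have /andP[] := ts; qlra.
  have [-> ->] := chain_pxE F ts; rewrite addrC addKr /py piece_row //.
    by rewrite sE.
Qed.

Lemma chain_onto0 m w Y Z b d x (F : final m w Y Z b d) : w 0%N <= x -> x <= w 0%N + d / 2 ->
  exists2 t : R, 0 <= t <= m.+3%:R &
    chain (px m w d) t = x /\ chain (py m w d Y) t = Y m.+1 x.
Proof.
have /andP[d0 d1] := combed_d (final_combed F).
have m23 : m.+3%:R = m.+2%:R + 1 :> R by rewrite natr1.
have m2 : 1 <= m.+2%:R :> R by rewrite ler1n.
  move=> x0 x1; pose t := 1 - (x - w 0%N) / (d / 2).
  have t01 : 0 <= t <= 1.
    have : 0 <= (x - w 0%N) / (d / 2) <= 1.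
      by rewrite divr_ge0 ?ler_pdivrMr ?mul1r //; qlra.
    by move=> /andP[? ?]; rewrite /t; apply/andP; split; qlra.
  exists t; first by have /andP[-> ?] := t01 => /=; qlra.
  have [|-> ->] := chain_pxE (k := 0%N) (t := t) F; first by [].
  suff E : px m w d 0 (t - 0%:R) = x by rewrite /py E.
  by rewrite -[px _ _ _ _ _]/(w 0%N + (1 - (t - 0)) * (d / 2)) /t; field; rewrite gt_eqF.
Qed.

Lemma chain_onto1 m w Y Z b d x (F : final m w Y Z b d) : w m.+1 - d / 2 <= x -> x <= w m.+1 ->
  exists2 t : R, 0 <= t <= m.+3%:R &
    chain (px m w d) t = x /\ chain (py m w d Y) t = Y m.+1 x.
Proof.
have /andP[d0 d1] := combed_d (final_combed F).
have m23 : m.+3%:R = m.+2%:R + 1 :> R by rewrite natr1.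
have m2 : 1 <= m.+2%:R :> R by rewrite ler1n.
  move=> x0 x1; pose s := (w m.+1 - x) / (d / 2).
  have /andP[s0 s1] : 0 <= s <= 1.
    by rewrite /s divr_ge0 ?ler_pdivrMr ?mul1r //; qlra.
  have ts : m.+2%:R <= m.+2%:R + s <= m.+3%:R by rewrite m23; apply/andP; split; qlra.
  exists (m.+2%:R + s); first by have /andP[? ->] := ts; rewrite andbT; qlra.
  have [-> ->] := chain_pxE F ts.
  suff E : px m w d m.+2 (m.+2%:R + s - m.+2%:R) = x by rewrite /py E piece_last.
  by rewrite addrC addKr /px ltnn eqxx /s; field; rewrite gt_eqF.
Qed.

Lemma final_image m w Y Z b d (F : final m w Y Z b d) (tau : R -> R -> R) (v : R -> R)
    (X0 X1 Y0 Y1 : R) :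
  let cx := @chain R R (px m w d) in let cy := @chain R R (py m w d Y) in
  X0 = w 0%N + d / 2 -> X1 = w m.+1 - d / 2 ->
  (forall y, Y0 <= y <= Y1 -> tau (cx (v y)) (cy (v y)) = y /\ 0 <= v y <= m.+3%:R) ->
  (forall t : R, 0 <= t <= m.+3%:R -> exists2 y, Y0 <= y <= Y1 & v y = t) ->
  (fun q => (q.1.1, tau q.1.1 q.1.2, q.2)) @` zset m.+1 w Y Z =
  cset (fun y => cx (v y)) (fun x => tau x (Y m.+1 x)) (Z m.+1) X0 X1 Y0 Y1.
Proof.
move=> cx cy X0E X1E tauE vonto.
have /andP[d0 d1] := combed_d (final_combed F).
have onarc i x z : (exists2 t : R, 0 <= t <= m.+3%:R & cx t = x /\ cy t = Y i x) -> z = 0 ->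
    cset (fun y => cx (v y)) (fun x => tau x (Y m.+1 x)) (Z m.+1) X0 X1 Y0 Y1 (x, tau x (Y i x), z).
  move=> [t tI [xE yE]] ->; have [y yI vE] := vonto t tI.
  by left; exists y => //; have [E _] := tauE y yI; rewrite vE xE yE in E; rewrite vE xE E.
apply/seteqP; split=> [_ [_ [i [x [im sx ->]]] <-]|q] /=.
  move: im; rewrite leq_eqVlt => /orP[/eqP iE|im].
    rewrite {}iE in sx *; move: sx; rewrite (last_strand _ F) => /andP[x0 x1].
    have /orP[xl|xl] := le_total x X0.
      apply: onarc; first by apply: (chain_onto0 F) => //; rewrite -X0E.
      by have [|_ ->] := first_cone (x := x) F; first by rewrite x0; rewrite X0E in xl; qlra.
    have /orP[xr|xr] := le_total X1 x.
      apply: onarc; first by apply: (chain_onto1 F) => //; rewrite -X1E.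
      by have [|_ ->] := last_cone (x := x) F; first by rewrite x1 andbT; rewrite X1E in xr; qlra.
    by right; exists x; rewrite ?xl.
  apply: onarc; first exact: (chain_onto F).
  by have [] := combed_level F im sx.
case=> [[y yI ->]|[x /andP[x0 x1] ->]].
  have [vE vI] := tauE y yI; have [i [im sx [yE zE] _]] := chain_strand F vI.
  exists (cx (v y), Y i (cx (v y)), Z i (cx (v y))); first by exists i, (cx (v y)).
  by rewrite /= zE -yE vE.
exists (x, Y m.+1 x, Z m.+1 x) => //; exists m.+1, x; split=> //.
by rewrite (last_strand _ F); rewrite X0E X1E in x0 x1; apply/andP; split; qlra.
Qed.

Lemma final_disjoint m w Y Z b d (t : R) (F : final m w Y Z b d) :
  let cx := @chain R R (px m w d) in let cy := @chain R R (py m w d Y) in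
  0 <= t <= m.+3%:R -> w 0%N + d / 2 < cx t < w m.+1 - d / 2 -> Z m.+1 (cx t) = 0 ->
  Y m.+1 (cx t) <> cy t.
Proof.
move=> cx cy tI /andP[x0 x1] h0 E; have /andP[d0 d1] := combed_d (final_combed F).
have [i [im sx [yE zE] iN]] := chain_strand F tI.
have im' : (i < m.+1)%N by rewrite ltn_neqAle im andbT; apply/eqP => /iN[]; rewrite -/cx; qlra.
have sN : strand w m.+1 (cx t) by rewrite (last_strand _ F); apply/andP; split; qlra.
have ij : (i < m.+1 <= m.+1)%N by rewrite im' leqnn.
have Eq : Y i (cx t) = Y m.+1 (cx t) by rewrite -yE E.
have Zq : Z i (cx t) = Z m.+1 (cx t) by rewrite zE h0.
by have [[_ xE]|[_ _ xE]] := combed_disj (final_combed F) ij sx sN Eq Zq; rewrite -/cx in xE; qlra.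
Qed.

Lemma final_spans m w Y Z b d (F : final m w Y Z b d) (tau : R -> R -> R) (X0 X1 e : R) :
  continuous (fun q : R * R => tau q.1 q.2) ->
  (forall x x' y y' : R, w 0%N <= x <= w m.+1 -> y < y' -> `|x' - x| = y' - y ->
     w 0%N <= x' <= w m.+1 -> tau x y < tau x' y') ->
  X0 = w 0%N + d / 2 -> X1 = w m.+1 - d / 2 -> 0 < e -> e <= d / 2 ->
  spans (fun x => tau x (Y m.+1 x)) (tau X0 (Y m.+1 X0)) (tau X1 (Y m.+1 X1)) X0 X1 e.
Proof.
move=> ctau diag -> -> e0 ed.
have /andP[d0 d1] := combed_d (final_combed F); have lt := final_lt F.
have cone0 (x : R) : w 0%N <= x <= w 0%N + d -> Y m.+1 x = b 0%N - (x - w 0%N) by move=> /(first_cone F)[].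
have cone1 (x : R) : w m.+1 - d <= x <= w m.+1 -> Y m.+1 x = b m + (w m.+1 - x) by move=> /(last_cone F)[].
split=> //.
- have cY0 : forall i, continuous (Y i) := combed_ctsY (final_combed F).
  exact: (ctscomp (ctspair (@ctsid R) (cY0 m.+1)) ctau).
- by qlra.
- move=> x /andP[x0 x1].
  have y0 : Y m.+1 (w 0%N + d / 2) = b 0%N - (w 0%N + d / 2 - w 0%N) by apply: cone0; apply/andP; split; qlra.
  have y1 : Y m.+1 x = b 0%N - (x - w 0%N) by apply: cone0; apply/andP; split; qlra.
  by apply: diag; [apply/andP; split|rewrite y0 y1|rewrite y0 y1 ltr0_norm|apply/andP; split]; qlra.
- move=> x /andP[x0 x1].
  have y0 : Y m.+1 (w m.+1 - d / 2) = b m + (w m.+1 - (w m.+1 - d / 2)) by apply: cone1; apply/andP; split; qlra.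
  have y1 : Y m.+1 x = b m + (w m.+1 - x) by apply: cone1; apply/andP; split; qlra.
  by apply: diag; [apply/andP; split|rewrite y0 y1|rewrite y0 y1 ltr0_norm|apply/andP; split]; qlra.
Qed.

(** The curve is cut in the middle of the two cones of the last strand and not at the walls: the arc
    and the last strand then continue each other in a straight line before the tilt, and near the
    cuts both run outside the rectangle, as [spans] demands. The arc is reparametrized by its tilted
    y-coordinate. *)
Lemma final_crossing m w Y Z b d (F : final m w Y Z b d) :
  exists (P : pt R -> pt R) a c h X0 X1 Y0 Y1 d', [/\ iso P, crossing a c h X0 X1 Y0 Y1 d'
    & P @` zset m.+1 w Y Z = cset a c h X0 X1 Y0 Y1].
Proof.
have [tau [iP ctau taui diag umono]] := final_tilt F.
have ccx := cts_chain (@px_cts R m w d) (@px_glue R m w d).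
have ccy := cts_chain (fun k => @py_cts _ _ _ _ _ _ _ k F) (fun k => @py_glue _ _ _ _ _ _ _ k F).
have cx0 := @chain_px0 m w d; have cx1 := @chain_px1 m w d.
have /andP[d0 d1] := combed_d (final_combed F); have lt := final_lt F.
have [X0 X0E] : exists X0 : R, X0 = w 0%N + d / 2 by eexists.
have [X1 X1E] : exists X1 : R, X1 = w m.+1 - d / 2 by eexists.
have disj t := @final_disjoint _ _ _ _ _ _ t F.
have [y0E y1E] : chain (py m w d Y) 0 = Y m.+1 (chain (px m w d) 0) /\
    chain (py m w d Y) m.+3%:R = Y m.+1 (chain (px m w d) m.+3%:R).
  have [|-> ->] := chain_pxE (k := 0%N) (t := 0) F; first by rewrite lexx ler01.
  have [|-> ->] := chain_pxE (k := m.+2) (t := m.+3%:R) F; first by rewrite lexx ler_nat leqnSn.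
  by rewrite /py (piece_last (k := m.+2)).
have img := @final_image _ _ _ _ _ _ F tau.
rewrite -X0E -X1E in disj.
move: (@chain R R (px m w d)) (@chain R R (py m w d Y)) img ccx ccy cx0 cx1 disj y0E y1E umono.
move=> cx cy img ccx ccy cx0 cx1 disj y0E y1E umono.
pose u t := tau (cx t) (cy t).
have cu : continuous u by exact: (ctscomp (ctspair ccx ccy) ctau).
have {}umono : forall s t, 0 <= s -> s < t -> t <= m.+3%:R -> u s < u t by exact: umono.
have m0 : 0 <= m.+3%:R :> R by exact: ler0n.
have [u' [cu' u'K u'I u'E]] := inverse_incr m0 cu umono.
have m23 : m.+3%:R = m.+2%:R + 1 :> R by rewrite natr1.
have m2 : 1 <= m.+2%:R :> R by rewrite ler1n.
have [e eE] : exists e : R, e = Num.min (d / 2) (Num.min (u 1 - u 0) (u m.+3%:R - u m.+2%:R)) by eexists.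
have e0 : 0 < e.
  by rewrite eE !lt_min !subr_gt0 !umono //; qlra.
have [ed ea eb] : [/\ e <= d / 2, e <= u 1 - u 0 & e <= u m.+3%:R - u m.+2%:R].
  by rewrite eE !ge_min !lexx ?orbT.
have u13 : u 1 < u m.+3%:R by apply: umono => //; qlra.
have u02 : u 0 < u m.+2%:R by apply: umono => //; qlra.
have u01 : u 0 < u m.+3%:R by apply: umono => //; rewrite ltr0n.
have Sa : spans (fun y => cx (u' y)) X0 X1 (u 0) (u m.+3%:R) e.
  split=> //.
  - exact: ctscomp cu' ccx.
  - by rewrite u'K ?lexx // cx0 ?lexx ?ler01 //; rewrite X0E; field.
  - rewrite u'K ?lexx ?ler0n // cx1 ?lexx ?m23; last by qlra.
    by rewrite X1E; field.
  - move=> y /andP[y0 y1].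
    have yI : u 0 <= y <= u m.+3%:R by apply/andP; split; qlra.
    have uE := u'E y yI; have /andP[t0 t1] := u'I y.
    move: (u' y) uE t0 t1 => t uE t0 t1.
    have t0' : 0 < t.
      by rewrite lt_neqAle t0 andbT; apply/eqP => E; rewrite -uE -E ltxx in y0.
    have t1' : t <= 1.
      rewrite leNgt; apply/negP => h; have := umono 1 t ler01 h t1; rewrite uE; qlra.
    rewrite cx0 ?t0 // X0E; have : 0 < t * (d / 2) by rewrite mulr_gt0 //; qlra.
    by qlra.
  - move=> y /andP[y0 y1].
    have yI : u 0 <= y <= u m.+3%:R by apply/andP; split; qlra.
    have uE := u'E y yI; have /andP[t0 t1] := u'I y.
    move: (u' y) uE t0 t1 => t uE t0 t1.
    have t1' : t < m.+3%:R.
      by rewrite lt_neqAle t1 andbT; apply/eqP => E; rewrite -uE E ltxx in y1.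
    have t0' : m.+2%:R <= t.
      rewrite leNgt; apply/negP => tm; have := umono t _ t0 tm; rewrite uE; qlra.
    rewrite cx1 ?t0' // X1E; have : (t - m.+2%:R) * (d / 2) < d / 2.
      by rewrite gtr_pMl; qlra.
    by qlra.
have cxX0 : cx 0 = X0 by rewrite cx0 ?lexx ?ler01 // X0E subr0 mul1r.
have cxX1 : cx m.+3%:R = X1.
  rewrite cx1 ?lexx ?m23; first by rewrite X1E; congr (_ - _); rewrite addrC addKr mul1r.
  by rewrite andbT lerDl ler01.
have tau0 : tau X0 (Y m.+1 X0) = u 0 by rewrite /u y0E cxX0.
have tau1 : tau X1 (Y m.+1 X1) = u m.+3%:R by rewrite /u y1E cxX1.
have Sb : spans (fun x => tau x (Y m.+1 x)) (u 0) (u m.+3%:R) X0 X1 e.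
  by rewrite -tau0 -tau1; exact: (final_spans F).
have inA (t : R) : 0 <= t <= m.+3%:R -> exists2 y, u 0 <= y <= u m.+3%:R & u' y = t.
  move=> /[dup] tI /andP[t0 t1]; exists (u t); last by rewrite u'K.
  apply/andP; split.
    by move: t0; rewrite le_eqVlt => /orP[/eqP <-//|t0]; apply/ltW/umono.
  by move: t1; rewrite le_eqVlt => /orP[/eqP ->//|t1]; apply/ltW/umono.
exists (fun q => (q.1.1, tau q.1.1 q.1.2, q.2)), (fun y => cx (u' y)), (fun x => tau x (Y m.+1 x)), (Z m.+1), X0, X1, (u 0), (u m.+3%:R), e.
clear ccx ccy cx0 cx1 cu cu' umono m0 m23 m2 eE e0 ed ea eb u13 u02 u01 cxX0 cxX1 tau0 tau1 y0E y1E diag ctau.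
split; first exact: iP.
- clear inA lt img; split; [exact: Sa|exact: Sb| | | |]; clear Sa Sb.
  + have cZ0 : forall i, continuous (Z i) := combed_ctsZ (final_combed F).
    exact: cZ0.
  + by have [|_ //] := first_cone (x := X0) F; rewrite X0E; apply/andP; split; qlra.
  + by have [|_ //] := last_cone (x := X1) F; rewrite X1E; apply/andP; split; qlra.
  + move=> y yI xI h0 E; apply: (disj _ (u'I y) xI h0).
    by apply: (taui (cx (u' y))); rewrite E -{1}(u'E y yI).
- exact: img X0E X1E (fun y yI => conj (u'E y yI) (u'I y)) inA.
Qed.

End FinalCrossing.

(** * The potholder *)

Section Carries.
Context {R : realType}.

(** In the coordinates [X] and [Y] the closed curve consists of the graph over x, run backwards for
    parameters from [al] to [be], and of the planar arc, which passes through the closing parameter.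
    Each part is embedded, so a double point has one passage on each part, and comparing heights
    there is unambiguous. *)
Lemma lift_cset (c : R -> R * R) (X Y : R * R -> R) (al be : R) a b h X0 X1 Y0 Y1 d :
  crossing a b h X0 X1 Y0 Y1 d ->
  iso (fun q : pt R => (X q.1, Y q.1, q.2)) ->
  continuous (fun t => X (c t)) -> c 0 = c 1 -> 0 < al -> al < be -> be < 1 ->
  X (c al) = X1 -> X (c be) = X0 ->
  (forall t, al <= t <= be -> X0 <= X (c t) <= X1 /\ Y (c t) = b (X (c t))) ->
  (forall x, X0 <= x <= X1 -> exists2 t, al <= t <= be & X (c t) = x) ->
  (forall s t, al <= s <= be -> al <= t <= be -> X (c s) = X (c t) -> s = t) ->
  (forall t, 0 <= t <= 1 -> t <= al \/ be <= t -> Y0 <= Y (c t) <= Y1 /\ X (c t) = a (Y (c t))) ->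
  (forall y, Y0 <= y <= Y1 -> exists t, [/\ 0 <= t <= 1, t <= al \/ be <= t & Y (c t) = y]) ->
  (forall s t, 0 <= s < 1 -> 0 <= t < 1 -> s <= al \/ be <= s -> t <= al \/ be <= t ->
     Y (c s) = Y (c t) -> s = t) ->
  exists (P : pt R -> pt R) over h', [/\ iso P, realizes c over h'
    & P @` cset a b h X0 X1 Y0 Y1 = Defs.lift c h'].
Proof.
move=> C iQ cX c01 al0 albe be1 Xal Xbe Bb Bo Bi Aa Ao Ai.
have ab := ltW albe; have h0 := cross_h0 C; have h1 := cross_h1 C.
(* On the arc the clamped parameter is an end of the graph, where [h] is 0. *)
pose h' t := h (X (c (clamp al be t))).
have ch' : continuous h'.
  have cc : continuous (clamp al be) by apply: cts_clamp; cts.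
  exact: ctscomp (ctscomp cc cX) (cross_h C).
have hA t : t <= al \/ be <= t -> h' t = 0.
  by rewrite /h' => -[tA|tA]; [rewrite clamp_le // Xal | rewrite clamp_ge // Xbe].
have hB t : al <= t <= be -> h' t = h (X (c t)) by move=> tB; rewrite /h' clamp_id.
have side t : (al < t < be) \/ (t <= al \/ be <= t).
  by have [?|?] := leP t al; [right; left|have [?|?] := leP be t; [right; right|left]].
have wk t : al < t < be -> al <= t <= be by move=> /andP[? ?]; rewrite !ltW.
have AB s t : 0 <= s < 1 -> s <= al \/ be <= s -> al < t < be -> c s = c t -> h' s != h' t.
  move=> /andP[s0 s1] sA tB st; rewrite hA // hB ?wk //; apply/eqP => hx.
  have [|yY xE] := Aa s _ sA; first by rewrite s0 ltW.
  have [xX yE] := Bb t (wk _ tB); rewrite st in xE yY.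
  have /andP[t1 t2] := tB.
  apply: (cross_disj C yY); rewrite -?xE ?yE //.
  move: xX; rewrite !le_eqVlt => /andP[/orP[/eqP E|->] /orP[/eqP E'|->]] //.
  - by have := Bi be t _ (wk _ tB); rewrite Xbe lexx ab => /(_ isT E) E2; rewrite E2 ltxx in t2.
  - by have := Bi be t _ (wk _ tB); rewrite Xbe lexx ab => /(_ isT E) E2; rewrite E2 ltxx in t2.
  - by have := Bi al t _ (wk _ tB); rewrite Xal lexx ab => /(_ isT (esym E')) E2; rewrite E2 ltxx in t1.
have dbl s t : 0 <= s < 1 -> 0 <= t < 1 -> s < t -> c s = c t ->
    (s <= al \/ be <= s) /\ al < t < be \/ (t <= al \/ be <= t) /\ al < s < be.
  move=> s01 t01 st cst; have [sB|sA] := side s; have [tB|tA] := side t.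
  - by move: st; rewrite (Bi s t) ?wk ?cst // ltxx.
  - by right.
  - by left.
  - by move: st; rewrite (Ai s t) ?cst // ltxx.
(* No triple points: the two passages through a point are determined by it, so [over] below may be
   defined by the existence of a suitable pair. *)
have uniq s t s' t' : 0 <= s < 1 -> 0 <= t < 1 -> 0 <= s' < 1 -> 0 <= t' < 1 ->
    s < t -> s' < t' -> c s = c t -> c s' = c t' -> c s = c s' -> s = s' /\ t = t'.
  move=> s01 t01 s01' t01' st st' ct ct' cs.
  have [[A1 B1]|[A1 B1]] := dbl s t s01 t01 st ct; have [[A2 B2]|[A2 B2]] := dbl s' t' s01' t01' st' ct'.
  - by split; [apply: Ai => //; rewrite cs|apply: Bi; rewrite ?wk // -ct cs ct'].
  - have E1 : s = t' by apply: Ai => //; rewrite cs ct'.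
    have E2 : t = s' by apply: Bi; rewrite ?wk // -ct cs.
    by move: st; rewrite E1 E2 ltNge (ltW st').
  - have E1 : t = s' by apply: Ai => //; rewrite -ct cs.
    have E2 : s = t' by apply: Bi; rewrite ?wk // cs ct'.
    by move: st; rewrite E1 E2 ltNge (ltW st').
  - by split; [apply: Bi; rewrite ?wk // cs|apply: Ai => //; rewrite -ct cs ct'].
have [P [iP PQ QP]] := iso_inv iQ.
pose over p := `[< exists s t, [/\ 0 <= s < 1, 0 <= t < 1, s < t, c s = p /\ c t = p & h' t < h' s] >].
exists P, over, h'; split=> //.
- split; first exact: continuous_subspaceT.
    by rewrite !hA //; [right; apply: ltW|left; apply: ltW].
  move=> s t; rewrite !in_itv /= => s01 t01 st cst; case: ifPn => [/asboolP[s' [t' [s01' t01' st' [cs' ct'] lt]]]|nov].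
    have [||-> ->//] := uniq s t s' t' s01 t01 s01' t01' st st' cst _ _; by rewrite cs' // ct'.
  rewrite lt_neqAle; apply/andP; split.
    have [[A1 B1]|[A1 B1]] := dbl s t s01 t01 st cst; first exact: AB.
    by rewrite eq_sym AB.
  by rewrite leNgt; apply: contra nov => lt; apply/asboolP; exists s, t.
- apply/seteqP; split=> [_ [_ [[y yY ->]|[x xX ->]] <-]|_ [t t01 <-]].
  + have [t [t01 tA yE]] := Ao y yY; exists t; first by rewrite /= in_itv.
    have [_ xE] := Aa t t01 tA; rewrite hA // -yE -xE; exact/esym/(PQ (c t, 0)).
  + have [t tB xE] := Bo x xX; exists t.
      by rewrite /= in_itv /=; have /andP[? ?] := tB; apply/andP; split; qlra.
    have [_ yE] := Bb t tB; rewrite hB // -xE -yE; exact/esym/(PQ (c t, _)).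
  + rewrite /= in_itv /= in t01; have [tB|tA] := side t.
      exists (X (c t), Y (c t), h' t); last exact: (PQ (c t, _)).
      have [xX yE] := Bb t (wk _ tB); right; exists (X (c t)) => //.
      by rewrite yE hB // wk.
    exists (X (c t), Y (c t), h' t); last exact: (PQ (c t, _)).
    have [yY xE] := Aa t t01 tA; left; exists (Y (c t)) => //.
    by rewrite xE hA.
Qed.

End Carries.

(** * The potholder as a periodic chain of pieces *)

Section Pieces.
Context {R : realType}.
Notation lo := (1 / 2 : R).
Notation hi n := (n.*2.+1%:R + 1 / 2 : R).

Lemma size_pairs T (f g : nat -> T) s :
  size (flatten [seq [:: f j; g j] | j <- s]) = (size s).*2.
Proof. by elim: s => //= j s ->. Qed.

Lemma nth_pairs T (x0 : T) (f g : nat -> T) s k : (k < size s)%N ->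
  nth x0 (flatten [seq [:: f j; g j] | j <- s]) k.*2 = f (nth 0%N s k) /\
  nth x0 (flatten [seq [:: f j; g j] | j <- s]) k.*2.+1 = g (nth 0%N s k).
Proof. by elim: s k => //= j s IH [|k] //= /IH. Qed.

Lemma nth_pairs_cases T (x0 : T) (f g : nat -> T) s k :
  (k < size (flatten [seq [:: f j; g j] | j <- s]))%N ->
  exists j, nth x0 (flatten [seq [:: f j; g j] | j <- s]) k = f j \/
            nth x0 (flatten [seq [:: f j; g j] | j <- s]) k = g j.
Proof.
by elim: s k => [|j s IH] [|[|k]] //= kl; [exists j; left|exists j; right|exact: IH].
Qed.

Definition pieces (n : nat) : seq (R -> R * R) :=
  flatten [seq [:: Defs.row n j; row_cap n j] | j <- iota 1 n.*2.+1] ++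
  flatten [seq [:: Defs.column n i; column_cap n i] | i <- rev (iota 1 n.*2.+1)].

(** Indices are taken modulo the number of pieces because the arc formed by the rows starts within
    the last piece, the cap around the lower left corner, and runs through the closing point. *)
Definition pc n (k : nat) : R -> R * R := nth (fun=> 0) (pieces n) (k %% size (pieces n)).

Definition curve n (u : R) : R * R := chain (pc n) u.

Lemma size_pieces n : size (pieces n) = n.*2.+1.*2.*2.
Proof. by rewrite size_cat !size_pairs size_rev size_iota; lia. Qed.

Lemma potholderE n t : potholder n t = curve n (n.*2.+1.*2.*2%:R * t).
Proof. by rewrite -size_pieces. Qed.

Lemma pcD n k : pc n (k + n.*2.+1.*2.*2) = pc n k.
Proof. by rewrite /pc size_pieces modnDr. Qed.

Lemma pc_row n j : (j < n.*2.+1)%N ->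
  pc n j.*2 = Defs.row n j.+1 /\ pc n j.*2.+1 = row_cap n j.+1.
Proof.
move=> jN; rewrite /pc size_pieces !modn_small; try lia.
have [|E1 E2] := nth_pairs (fun=> 0) (@Defs.row R n) (row_cap n) (s := iota 1 n.*2.+1) (k := j).
  by rewrite size_iota.
split; rewrite /pieces nth_cat size_pairs size_iota ifT ?E1 ?E2 ?nth_iota //; lia.
Qed.

Lemma pc_column n i : (i < n.*2.+1)%N ->
  pc n (n.*2.+1.*2 + i.*2) = Defs.column n (n.*2.+1 - i) /\
  pc n (n.*2.+1.*2 + i.*2).+1 = column_cap n (n.*2.+1 - i).
Proof.
move=> iN; rewrite /pc size_pieces !modn_small; try lia.
have [|E1 E2] := nth_pairs (fun=> 0) (@Defs.column R n) (column_cap n) (s := rev (iota 1 n.*2.+1)) (k := i).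
  by rewrite size_rev size_iota.
have E : nth 0%N (rev (iota 1 n.*2.+1)) i = (n.*2.+1 - i)%N.
  by rewrite nth_rev ?size_iota // nth_iota; lia.
by split; rewrite /pieces nth_cat size_pairs size_iota ifF ?[(_ + i.*2).+1]addnS -?addnS ?addKn ?E1 ?E2 ?E //; lia.
Qed.

Lemma row0 n j : Defs.row n j 0 = (if odd j then lo else hi n, j%:R).
Proof.
by rewrite /Defs.row /segment; case: odd; rewrite subr0 scale1r scale0r addr0.
Qed.

Lemma row1 n j : Defs.row n j 1 = (if odd j then hi n else lo, j%:R).
Proof.
by rewrite /Defs.row /segment; case: odd; rewrite subrr scale1r scale0r add0r.
Qed.

Lemma column0 n i : Defs.column n i 0 = (i%:R, if odd i then hi n else lo).
Proof.
by rewrite /Defs.column /segment; case: odd; rewrite subr0 scale1r scale0r addr0.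
Qed.

Lemma column1 n i : Defs.column n i 1 = (i%:R, if odd i then lo else hi n).
Proof.
by rewrite /Defs.column /segment; case: odd; rewrite subrr scale1r scale0r add0r.
Qed.

Lemma arc0 (p : R * R) a b : Defs.arc p a b 0 = (p.1 + cos a / 2, p.2 + sin a / 2).
Proof. by rewrite /Defs.arc subr0 mul1r mul0r addr0. Qed.

Lemma arc1 (p : R * R) a b : Defs.arc p a b 1 = (p.1 + cos b / 2, p.2 + sin b / 2).
Proof. by rewrite /Defs.arc subrr mul1r mul0r add0r. Qed.

Lemma cos_3pihalf : cos (pi + pi / 2) = 0 :> R.
Proof. by rewrite addrC cosDpi cos_pihalf oppr0. Qed.

Lemma sin_3pihalf : sin (pi + pi / 2) = -1 :> R.
Proof. by rewrite addrC sinDpi sin_pihalf. Qed.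

Definition trigE := (cosN, sinN, cos_pihalf, sin_pihalf, cos_3pihalf, sin_3pihalf,
  cospi, sinpi, cos0, sin0).

Lemma row_cap0 n j : row_cap n j 0 = (if odd j then hi n else lo, j%:R).
Proof.
rewrite /row_cap; case: eqP => [->|_]; last case: odd; rewrite arc0 /= ?odd_double /= ?trigE.
- by congr (_, _); ring.
- by congr (_, _); ring.
- by congr (_, _); ring.
Qed.

Lemma row_cap1 n j : (j < n.*2.+1)%N ->
  row_cap n j 1 = (if odd j then hi n else lo, j.+1%:R).
Proof.
move=> jN; rewrite /row_cap ltn_eqF //; case: odd; rewrite arc1 /= ?trigE -natr1.
- by congr (_, _); field.
- by congr (_, _); field.
Qed.

Lemma row_capN n : row_cap n n.*2.+1 1 = (n.*2.+1%:R, hi n).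
Proof. by rewrite /row_cap eqxx arc1 /= !trigE; congr (_, _); field. Qed.

Lemma column_cap0 n i : column_cap n i 0 = (i%:R, if odd i then lo else hi n).
Proof.
rewrite /column_cap; case: eqP => [->|_]; last case: odd; rewrite arc0 /= !trigE.
- by congr (_, _); field.
- by congr (_, _); field.
- by congr (_, _); field.
Qed.

Lemma column_cap1 n i : (0 < i)%N ->
  column_cap n i.+1 1 = (i%:R, if odd i.+1 then lo else hi n).
Proof.
move=> i0; rewrite /column_cap eqSS gtn_eqF //; case: odd; rewrite arc1 /= !trigE -natr1.
- by congr (_, _); field.
- by congr (_, _); field.
Qed.

Lemma column_capN n : column_cap n 1 1 = (lo, 1).
Proof. by rewrite /column_cap eqxx arc1 /= !trigE; congr (_, _); field. Qed.

Lemma pc_glue n k : pc n k 1 = pc n k.+1 0.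
Proof.
set M := n.*2.+1.*2.*2; have -> : pc n k = pc n (k %% M).
  by rewrite /pc size_pieces modn_mod.
have -> : pc n k.+1 = pc n (k %% M).+1.
  by rewrite /pc size_pieces -/M -[k.+1]addn1 -[(_ %% _).+1]addn1 modnDml.
have : (k %% M < M)%N by rewrite ltn_mod.
move: (k %% M)%N => {}k kM.
have kE : k = (odd k + k./2.*2)%N by rewrite odd_double_half.
have [kN|Nk] := ltnP k n.*2.+1.*2.
  have jN : (k./2 < n.*2.+1)%N by rewrite -ltn_double; apply: leq_ltn_trans kN; rewrite {2}kE leq_addl.
  have [E1 E2] := pc_row jN; rewrite kE; case: odd.
    rewrite add1n E2; move: (jN); rewrite leq_eqVlt => /orP[/eqP jN'|{}jN].
      have [//|E _] := @pc_column n 0; rewrite double0 addn0 subn0 in E.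
      by rewrite -[(k./2.*2).+2]doubleS jN' row_capN E column0 /= odd_double.
    rewrite -[(k./2.*2).+2]doubleS; have [-> _] := pc_row jN.
    by rewrite row_cap1 // row0 /=; case: odd.
  by rewrite add0n E1 E2 row1 row_cap0.
have [i iE] : {i | i = (k./2 - n.*2.+1)%N} by exists (k./2 - n.*2.+1)%N.
have iN : (i < n.*2.+1)%N by lia.
have [E1 E2] := pc_column iN.
have {}kE : k = (odd k + (n.*2.+1.*2 + i.*2))%N by lia.
rewrite kE; case: odd; last by rewrite add0n E1 E2 column1 column_cap0.
rewrite add1n E2; move: iN; rewrite leq_eqVlt => /orP[/eqP iN|iN].
  have [|E _] := @pc_row n 0; first by [].
  have -> : (n.*2.+1 - i = 1)%N by lia.
  have -> : ((n.*2.+1.*2 + i.*2).+2 = 0 + n.*2.+1.*2.*2)%N by lia.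
  by rewrite pcD E column_capN row0.
have [E _] := pc_column iN.
have -> : ((n.*2.+1.*2 + i.*2).+2 = n.*2.+1.*2 + i.+1.*2)%N by lia.
have iE' : (n.*2.+1 - i = (n.*2.+1 - i.+1).+1)%N by lia.
rewrite E iE' column_cap1 ?column0; last by lia.
by rewrite /=; case: odd.
Qed.

Lemma pc_cases n k : exists j, pc n k = Defs.row n j \/ pc n k = row_cap n j \/
  pc n k = Defs.column n j \/ pc n k = column_cap n j.
Proof.
have kM : (k %% size (pieces n) < size (pieces n))%N by rewrite ltn_mod size_pieces.
set s1 := flatten [seq [:: @Defs.row R n j; row_cap n j] | j <- iota 1 n.*2.+1].
set s2 := flatten [seq [:: @Defs.column R n j; column_cap n j] | j <- rev (iota 1 n.*2.+1)].
have pE : pieces n = s1 ++ s2 by [].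
move: kM; rewrite /pc pE nth_cat size_cat; move: (k %% _)%N => i.
have [il _|ri iN] := ltnP i (size s1).
  by have [j [->|->]] := nth_pairs_cases (fun=> 0) il; exists j; [left|right; left].
have {}iN : (i - size s1 < size s2)%N by rewrite ltn_subLR.
by have [j [->|->]] := nth_pairs_cases (fun=> 0) iN; exists j; right; right; [left|right].
Qed.

Lemma pc_cts n k : continuous (fun s => (pc n k s).1) /\ continuous (fun s => (pc n k s).2).
Proof.
have ccos : continuous (cos : R -> R) := @continuous_cos R.
have csin : continuous (sin : R -> R) := @continuous_sin R.
have cseg p q : continuous (fun s : R => (segment p q s).1) /\ continuous (fun s : R => (segment p q s).2).
  split.
    by change (continuous (fun s : R => (1 - s) * p.1 + s * q.1)); move: p.1 q.1 => ? ?; cts.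
  by change (continuous (fun s : R => (1 - s) * p.2 + s * q.2)); move: p.2 q.2 => ? ?; cts.
have carc p a b : continuous (fun s : R => (Defs.arc p a b s).1) /\ continuous (fun s : R => (Defs.arc p a b s).2).
  split.
    by change (continuous (fun s : R => p.1 + cos ((1 - s) * a + s * b) / 2)); move: p => [p1 p2] /=; cts.
  by change (continuous (fun s : R => p.2 + sin ((1 - s) * a + s * b) / 2)); move: p => [p1 p2] /=; cts.
have [j [->|[->|[->|->]]]] := pc_cases n k.
- by rewrite /Defs.row; case: odd.
- by rewrite /row_cap; case: eqP => _ //; case: odd.
- by rewrite /Defs.column; case: odd.
- by rewrite /column_cap; case: eqP => _ //; case: odd.
Qed.

Lemma curve_cts n : continuous (fun u => (curve n u).1) /\ continuous (fun u => (curve n u).2).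
Proof.
split; [apply: (@cts_chain R (fun k s => (pc n k s).1))|apply: (@cts_chain R (fun k s => (pc n k s).2))] => k.
- by have [] := pc_cts n k.
- by rewrite pc_glue.
- by have [] := pc_cts n k.
- by rewrite pc_glue.
Qed.

Lemma curveE n k u : k%:R <= u <= k.+1%:R -> curve n u = pc n k (u - k%:R).
Proof. by apply: chainE_closed; exact: pc_glue. Qed.

Lemma curveD n u : 0 <= u -> curve n (u + n.*2.+1.*2.*2%:R) = curve n u.
Proof.
move=> u0; have /andP[h1 h2] := Num.Theory.truncn_itv u0; set k := Num.truncn u in h1 h2.
rewrite (@curveE n k u); last by rewrite h1 ltW.
rewrite (@curveE n (k + n.*2.+1.*2.*2)); last by rewrite -addSn !natrD !lerD2r h1 ltW.
by rewrite pcD natrD opprD addrACA subrr addr0.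
Qed.

End Pieces.

(** * Tilting the rows and columns *)

Section Tilt.
Context {R : realType}.
Notation lo := (1 / 2 : R).
Notation hi n := (n.*2.+1%:R + 1 / 2 : R).
Implicit Types x y : R.

(** The cosine in [tilt] has Lipschitz constant pi and is multiplied by at most [n + 1/2] in
    absolute value; this slope therefore costs at most half of the monotonicity, and it displaces
    every line by less than 1/2. *)
Definition slope n : R := 1 / (2 * pi * n.+1%:R).

(* The rows and columns become sloped, in the directions in which the
   potholder runs along them. *)
Definition tilt n x y := y - slope n * cos (pi * clamp lo (hi n) y) *
  (clamp lo (hi n) x - n.+1%:R).

Lemma hiE n : hi n = n%:R *+ 2 + 3 / 2.
Proof. by rewrite -[n.*2.+1%:R]natr1 -mul2n natrM; field. Qed.

Lemma lo_hi n : lo <= hi n.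
Proof. by rewrite hiE; have := ler0n R n; qlra. Qed.

Lemma slope_gt0 n : 0 < slope n.
Proof. by rewrite divr_gt0 // !mulr_gt0 ?pi_gt0 ?ltr0n. Qed.

Lemma slope_pi n : slope n * pi * (n%:R + 1 / 2) <= 1 / 2.
Proof.
have p0 := pi_gt0 R; have n0 := ler0n R n.
have -> : slope n * pi * (n%:R + 1 / 2) = (n%:R + 1 / 2) / (2 * n.+1%:R).
  by rewrite /slope -[n.+1%:R]natr1; field; rewrite !gt_eqF //; qlra.
by rewrite ler_pdivrMr ?mulr_gt0 ?ltr0n // -[n.+1%:R]natr1; qlra.
Qed.

Lemma slope_lt n : slope n * (n%:R + 1 / 2) < 1 / 2.
Proof.
have p2 := pi_ge2 R; have := slope_pi n; have := slope_gt0 n; have n0 := ler0n R n.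
move: (slope n) => s s0 h; have : 0 < s * (n%:R + 1 / 2) by rewrite mulr_gt0 //; qlra.
move: h; have -> : s * pi * (n%:R + 1 / 2) = pi * (s * (n%:R + 1 / 2)) by ring.
move: (s * _) => t h t0; have := ler_wpM2r (ltW t0) p2; qlra.
Qed.

Lemma clamp_mid n x : `|clamp lo (hi n) x - n.+1%:R| <= n%:R + 1 / 2.
Proof.
have := clamp_itv x (lo_hi n); rewrite hiE -[n.+1%:R]natr1 => /andP[? ?].
by rewrite ler_norml; apply/andP; split; qlra.
Qed.

Lemma slope_mid n x : `|slope n * (clamp lo (hi n) x - n.+1%:R)| < 1 / 2.
Proof.
rewrite normrM (gtr0_norm (slope_gt0 n)).
by apply: le_lt_trans (slope_lt n); rewrite ler_pM2l ?slope_gt0 // clamp_mid.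
Qed.

Lemma tilt_slope n x y y' : y < y' -> 1 / 2 * (y' - y) <= tilt n x y' - tilt n x y.
Proof.
move=> yy; rewrite /tilt; set t := clamp _ _ y; set t' := clamp _ _ y'.
have c : `|cos (pi * t') - cos (pi * t)| <= pi * (y' - y).
  apply: le_trans (cos_lip _ _) _; rewrite -mulrBr normrM gtr0_norm ?pi_gt0 //.
  rewrite ler_pM2l ?pi_gt0 //; apply: le_trans (clamp_lip _ _ _ _) _.
  by rewrite gtr0_norm // subr_gt0.
have m := clamp_mid n x; move: (_ - n.+1%:R) m => w m.
have h : `|slope n * (cos (pi * t') - cos (pi * t)) * w| <= 1 / 2 * (y' - y).
  rewrite 2!normrM (gtr0_norm (slope_gt0 n)).
  apply: le_trans (_ : slope n * (pi * (y' - y)) * (n%:R + 1 / 2) <= _).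
    by apply: ler_pM => //; [rewrite mulr_ge0 // ltW ?slope_gt0|rewrite ler_pM2l ?slope_gt0].
  have -> : slope n * (pi * (y' - y)) * (n%:R + 1 / 2) =
    slope n * pi * (n%:R + 1 / 2) * (y' - y) by ring.
  by rewrite ler_pM2r ?subr_gt0 // slope_pi.
have := ler_norm (slope n * (cos (pi * t') - cos (pi * t)) * w); qlra.
Qed.

Lemma tilt_lt n x y y' : y < y' -> tilt n x y < tilt n x y'.
Proof. by move=> yy; have := tilt_slope n x yy; qlra. Qed.

Lemma tilt_clamp n x x' y : clamp lo (hi n) x = clamp lo (hi n) x' ->
  tilt n x y = tilt n x' y.
Proof. by rewrite /tilt => ->. Qed.

Lemma cos_half (k : nat) : cos (pi * (k%:R + 1 / 2)) = 0 :> R.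
Proof.
elim: k => [|k IH]; first by rewrite add0r mul1r -[pi / 2]/(pi * 2^-1) cos_pihalf.
have -> : pi * (k.+1%:R + 1 / 2) = pi * (k%:R + 1 / 2) + pi :> R by rewrite -natr1; ring.
by rewrite cosDpi IH oppr0.
Qed.

(** The cosine vanishes half way between two rows. These undisturbed levels are the ones to which
    the crossings will be brought. *)
Lemma tilt_half n k x : (k <= n.*2.+1)%N -> tilt n x (k%:R + 1 / 2) = k%:R + 1 / 2.
Proof.
move=> kn; rewrite /tilt clamp_id ?cos_half ?mulr0 ?mul0r ?subr0 //.
by rewrite lerDr ler0n lerD2r ler_nat.
Qed.

Lemma tilt_out n x y : y <= lo \/ hi n <= y -> tilt n x y = y.
Proof.
have c : cos (pi * lo) = 0 :> R by have := cos_half 0; rewrite add0r.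
move=> [yl|yh]; rewrite /tilt.
  by rewrite clamp_le ?lo_hi // c mulr0 mul0r subr0.
by rewrite clamp_ge ?lo_hi // cos_half mulr0 mul0r subr0.
Qed.

Lemma tilt_itv n x y : lo <= y <= hi n -> lo <= tilt n x y <= hi n.
Proof.
move=> /andP[y0 y1].
have e0 : tilt n x lo = lo by apply: tilt_out; left.
have e1 : tilt n x (hi n) = hi n by apply: tilt_out; right.
apply/andP; split; [rewrite -[X in X <= _]e0|rewrite -[X in _ <= X]e1].
  by move: y0; rewrite le_eqVlt => /orP[/eqP-> //|/(tilt_lt n x)/ltW].
by move: y1; rewrite le_eqVlt => /orP[/eqP-> //|/(tilt_lt n x)/ltW].
Qed.

Lemma tilt_nat n j x : (0 < j <= n.*2.+1)%N ->
  tilt n x j%:R = j%:R - (-1) ^+ j * (slope n * (clamp lo (hi n) x - n.+1%:R)).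
Proof.
move=> /andP[j0 jn]; rewrite /tilt (@clamp_id _ _ _ j%:R) ?cos_pi_nat; first by ring.
have : 1 <= j%:R :> R by rewrite ler1n.
have : j%:R <= n.*2.+1%:R :> R by rewrite ler_nat.
by move=> ? ?; apply/andP; split; qlra.
Qed.

Lemma iso_tilt n : iso (fun q : pt R =>
  (tilt n (tilt n q.1.1 q.1.2) q.1.1, tilt n q.1.1 q.1.2, q.2)).
Proof.
have ccos : continuous (cos : R -> R) := @continuous_cos R.
have i1 : iso (fun q : pt R => (q.1.1, tilt n q.1.1 q.1.2, q.2)).
  apply: (@iso_mono _ (fun q => tilt n q.1.1 q.1.2) (1 / 2)) => //.
  - by rewrite /tilt /clamp; cts.
  - by move=> x y y' z /(tilt_slope n).
have i2 : iso (fun q : pt R => (tilt n q.1.2 q.1.1, q.1.2, q.2)).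
  apply: (@iso_mono_x _ (fun q => tilt n q.1.2 q.1.1) (1 / 2)) => //.
  - by rewrite /tilt /clamp; cts.
  - by move=> x x' y z /(tilt_slope n).
exact: (iso_comp i2 i1).
Qed.

End Tilt.

(** * Monotonicity along rows, columns and caps *)

Section Runs.
Context {R : realType}.
Notation lo := (1 / 2 : R).
Notation hi n := (n.*2.+1%:R + 1 / 2 : R).
Implicit Types x y s t : R.

(** The tilt of the columns uses the y-coordinate already tilted, so that [tx] and [ty] together are
    a composite of two fibrewise monotone maps, as in [iso_tilt]. *)
Definition tx n (p : R * R) : R := tilt n (tilt n p.1 p.2) p.1.
Definition ty n (p : R * R) : R := tilt n p.1 p.2.

Lemma sin_incr (a b : R) : - (pi / 2) <= a -> a < b -> b <= pi / 2 -> sin a < sin b.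
Proof. by move=> a0 ab b1; rewrite ltr_sin // in_itv /=; apply/andP; split; qlra. Qed.

Lemma cos_decr (a b : R) : 0 <= a -> a < b -> b <= pi -> cos b < cos a.
Proof. by move=> a0 ab b1; rewrite ltr_cos // in_itv /=; apply/andP; split; qlra. Qed.

Lemma sin_incr_left (a b : R) : - (pi + pi / 2) <= b -> b < a -> a <= - (pi / 2) -> sin a < sin b.
Proof.
move=> b0 ba a1; have := @sin_incr (- (a + pi)) (- (b + pi)).
by rewrite !sinN !sinDpi !opprK; apply; qlra.
Qed.

Lemma cos_decr_left (a b : R) : - pi <= b -> b < a -> a <= 0 -> cos b < cos a.
Proof. by move=> b0 ba a1; rewrite -(cosN a) -(cosN b); apply: cos_decr; qlra. Qed.

Lemma cos_le0_left (a : R) : - (pi + pi / 2) <= a <= - (pi / 2) -> cos a <= 0.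
Proof.
move=> /andP[a0 a1]; have := @cos_ge0_pihalf R (a + pi); rewrite cosDpi oppr_ge0; apply.
by apply/andP; split; qlra.
Qed.

Lemma sin_le0_left (a : R) : - pi <= a <= 0 -> sin a <= 0.
Proof.
move=> /andP[a0 a1]; rewrite -oppr_ge0 -sinN; apply: sin_ge0_pi.
by apply/andP; split; qlra.
Qed.

(** This half of the circle lies to the right of the square, where the clamped x is constant, so all
    its points are tilted by the same increasing function of y. The next three lemmas treat the
    other sides. *)
Lemma arc_up_right n (p : R * R) (a b s t : R) (u := fun s => (1 - s) * a + s * b) : p.1 = hi n ->
  - (pi / 2) <= u s -> u s < u t -> u t <= pi / 2 ->
  ty n (Defs.arc p a b s) < ty n (Defs.arc p a b t).
Proof.
move=> p1 h0 h1 h2; rewrite /ty /Defs.arc /= -/(u s) -/(u t).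
rewrite (@tilt_clamp _ n _ (p.1 + cos (u t) / 2)).
  by apply: tilt_lt; rewrite ltrD2l ltr_pM2r // sin_incr.
have [c1 c2] : 0 <= cos (u s) /\ 0 <= cos (u t).
  by split; apply: cos_ge0_pihalf; apply/andP; split; qlra.
by rewrite !clamp_ge ?lo_hi // p1 lerDl divr_ge0.
Qed.

Lemma arc_up_left n (p : R * R) (a b s t : R) (u := fun s => (1 - s) * a + s * b) : p.1 = lo ->
  - (pi + pi / 2) <= u t -> u t < u s -> u s <= - (pi / 2) ->
  ty n (Defs.arc p a b s) < ty n (Defs.arc p a b t).
Proof.
move=> p1 h0 h1 h2; rewrite /ty /Defs.arc /= -/(u s) -/(u t).
rewrite (@tilt_clamp _ n _ (p.1 + cos (u t) / 2)).
  by apply: tilt_lt; rewrite ltrD2l ltr_pM2r // sin_incr_left.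
have [c1 c2] : cos (u s) <= 0 /\ cos (u t) <= 0.
  by split; apply: cos_le0_left; apply/andP; split; qlra.
by rewrite !clamp_le ?lo_hi // p1 gerDl pmulr_lle0.
Qed.

Lemma arc_back_top n (p : R * R) (a b s t : R) (u := fun s => (1 - s) * a + s * b) : p.2 = hi n ->
  0 <= u s -> u s < u t -> u t <= pi ->
  tx n (Defs.arc p a b t) < tx n (Defs.arc p a b s).
Proof.
move=> p2 h0 h1 h2; rewrite /tx /Defs.arc /= -/(u s) -/(u t).
have [c1 c2] : hi n <= p.2 + sin (u s) / 2 /\ hi n <= p.2 + sin (u t) / 2.
  by split; rewrite p2 lerDl divr_ge0 // sin_ge0_pi //; apply/andP; split; qlra.
rewrite (@tilt_out _ n _ (p.2 + sin (u s) / 2)); last by right.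
rewrite (@tilt_out _ n _ (p.2 + sin (u t) / 2)); last by right.
rewrite (@tilt_clamp _ n _ (p.2 + sin (u s) / 2)); last by rewrite !clamp_ge ?lo_hi.
by apply: tilt_lt; rewrite ltrD2l ltr_pM2r // cos_decr.
Qed.

Lemma arc_back_bottom n (p : R * R) (a b s t : R) (u := fun s => (1 - s) * a + s * b) : p.2 = lo ->
  - pi <= u t -> u t < u s -> u s <= 0 ->
  tx n (Defs.arc p a b t) < tx n (Defs.arc p a b s).
Proof.
move=> p2 h0 h1 h2; rewrite /tx /Defs.arc /= -/(u s) -/(u t).
have [c1 c2] : p.2 + sin (u s) / 2 <= lo /\ p.2 + sin (u t) / 2 <= lo.
  by split; rewrite p2 gerDl pmulr_lle0 // sin_le0_left //; apply/andP; split; qlra.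
rewrite (@tilt_out _ n _ (p.2 + sin (u s) / 2)); last by left.
rewrite (@tilt_out _ n _ (p.2 + sin (u t) / 2)); last by left.
rewrite (@tilt_clamp _ n _ (p.2 + sin (u s) / 2)); last by rewrite !clamp_le ?lo_hi.
by apply: tilt_lt; rewrite ltrD2l ltr_pM2r // cos_decr_left.
Qed.

(** The sign [(-1) ^+ j] by which row [j] is sloped changes together with the direction in which it
    is run. *)
Lemma row_up n j s t : (0 < j <= n.*2.+1)%N -> 0 <= s -> s < t -> t <= 1 ->
  ty n (Defs.row n j s) < ty n (Defs.row n j t).
Proof.
move=> jn s0 st t1; have lh : lo < hi n by rewrite hiE; have := ler0n R n; qlra.
have E p q r : (segment (p, j%:R) (q, j%:R) r : R * R) = ((1 - r) * p + r * q, j%:R).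
  by congr (_, _); rewrite /= /GRing.scale /=; ring.
have [m1 [m2 m3]] : s * (hi n - lo) < t * (hi n - lo) /\ (0 <= s * (hi n - lo) /\ t * (hi n - lo) <= hi n - lo).
  by rewrite ltr_pM2r ?subr_gt0 // mulr_ge0 ?ler_piMl // subr_ge0 ltW.
have sl : 0 < slope n :> R := slope_gt0 n.
rewrite /Defs.row; case: ifP => oj; rewrite !E /ty /= !tilt_nat // !(@clamp_id R lo (hi n)); try by apply/andP; split; qlra.
  rewrite -signr_odd oj expr1 !mulN1r !opprK ltrD2l ltr_pM2l // ltrD2r.
  by qlra.
rewrite -signr_odd oj expr0 !mul1r ltrD2l ltrN2 ltr_pM2l // ltrD2r.
by qlra.
Qed.

Lemma column_back n i s t : (0 < i <= n.*2.+1)%N -> 0 <= s -> s < t -> t <= 1 ->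
  tx n (Defs.column n i t) < tx n (Defs.column n i s).
Proof.
move=> jn s0 st t1; have lh : lo < hi n by rewrite hiE; have := ler0n R n; qlra.
have E p q r : (segment (i%:R, p) (i%:R, q) r : R * R) = (i%:R, (1 - r) * p + r * q).
  by congr (_, _); rewrite /= /GRing.scale /=; ring.
have [m1 [m2 m3]] : s * (hi n - lo) < t * (hi n - lo) /\ (0 <= s * (hi n - lo) /\ t * (hi n - lo) <= hi n - lo).
  by rewrite ltr_pM2r ?subr_gt0 // mulr_ge0 ?ler_piMl // subr_ge0 ltW.
have sl : 0 < slope n :> R := slope_gt0 n.
have c y : lo <= y <= hi n -> clamp lo (hi n) (tilt n i%:R y) = tilt n i%:R y.
  by move=> yI; rewrite clamp_id // tilt_itv.
rewrite /Defs.column; case: ifP => oi; rewrite !E /tx /= !tilt_nat // !c; try by apply/andP; split; qlra.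
  rewrite -signr_odd oi expr1 !mulN1r !opprK ltrD2l ltr_pM2l // ltrD2r.
  by apply: tilt_lt; qlra.
rewrite -signr_odd oi expr0 !mul1r ltrD2l ltrN2 ltr_pM2l // ltrD2r.
by apply: tilt_lt; qlra.
Qed.

Lemma row_cap_up n j s t : (j < n.*2.+1)%N -> 0 <= s -> s < t -> t <= 1 ->
  ty n (row_cap n j s) < ty n (row_cap n j t).
Proof.
move=> jn s0 st t1; have p0 := pi_gt0 R; rewrite /row_cap ltn_eqF //.
have m1 : s * pi < t * pi by rewrite ltr_pM2r.
have m2 : 0 <= s * pi by rewrite mulr_ge0 // ltW.
have m3 : t * pi <= pi by rewrite ler_piMl // ltW.
by case: odd; [apply: arc_up_right | apply: arc_up_left] => //; qlra.
Qed.

Lemma column_cap_back n i s t : (1 < i)%N -> 0 <= s -> s < t -> t <= 1 ->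
  tx n (column_cap n i t) < tx n (column_cap n i s).
Proof.
move=> i1 s0 st t1; have p0 := pi_gt0 R; rewrite /column_cap gtn_eqF //.
have m1 : s * pi < t * pi by rewrite ltr_pM2r.
have m2 : 0 <= s * pi by rewrite mulr_ge0 // ltW.
have m3 : t * pi <= pi by rewrite ler_piMl // ltW.
by case: odd; [apply: arc_back_bottom | apply: arc_back_top] => //; qlra.
Qed.

(** The corner cap turns from angle [- pi / 2] to [pi]. It rises until angle [pi / 2], reached at
    time 2/3, and it moves back from angle 0 on, reached at time 1/3. Both coordinates are monotone
    in between, which is why the curve is cut at time 1/2. The lower left corner is symmetric. *)
Lemma last_cap_up n s t : 0 <= s -> s < t -> t <= 2 / 3 ->
  ty n (row_cap n n.*2.+1 s) < ty n (row_cap n n.*2.+1 t).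
Proof.
move=> s0 st t1; have p0 := pi_gt0 R; rewrite /row_cap eqxx.
have m1 : s * pi < t * pi by rewrite ltr_pM2r.
have m2 : 0 <= s * pi by rewrite mulr_ge0 // ltW.
have m3 : t * pi <= 2 / 3 * pi by rewrite ler_pM2r.
by apply: arc_up_right => //; qlra.
Qed.

Lemma last_cap_back n s t : 1 / 3 <= s -> s < t -> t <= 1 ->
  tx n (row_cap n n.*2.+1 t) < tx n (row_cap n n.*2.+1 s).
Proof.
move=> s0 st t1; have p0 := pi_gt0 R; rewrite /row_cap eqxx.
have m1 : s * pi < t * pi by rewrite ltr_pM2r.
have m2 : 1 / 3 * pi <= s * pi by rewrite ler_pM2r.
have m3 : t * pi <= pi by rewrite ler_piMl // ltW.
by apply: arc_back_top => //; qlra.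
Qed.

Lemma first_cap_up n s t : 1 / 3 <= s -> s < t -> t <= 1 ->
  ty n (column_cap n 1 s) < ty n (column_cap n 1 t).
Proof.
move=> s0 st t1; have p0 := pi_gt0 R; rewrite /column_cap eqxx.
have m1 : s * pi < t * pi by rewrite ltr_pM2r.
have m2 : 1 / 3 * pi <= s * pi by rewrite ler_pM2r.
have m3 : t * pi <= pi by rewrite ler_piMl // ltW.
by apply: arc_up_left => //; qlra.
Qed.

Lemma first_cap_back n s t : 0 <= s -> s < t -> t <= 2 / 3 ->
  tx n (column_cap n 1 t) < tx n (column_cap n 1 s).
Proof.
move=> s0 st t1; have p0 := pi_gt0 R; rewrite /column_cap eqxx.
have m1 : s * pi < t * pi by rewrite ltr_pM2r.
have m2 : 0 <= s * pi by rewrite mulr_ge0 // ltW.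
have m3 : t * pi <= 2 / 3 * pi by rewrite ler_pM2r.
by apply: arc_back_bottom => //; qlra.
Qed.

End Runs.

(** * The two monotone arcs of the tilted potholder *)

Section Potholder.
Context {R : realType}.
Notation lo := (1 / 2 : R).
Notation hi n := (n.*2.+1%:R + 1 / 2 : R).

Lemma spans_param (f g : R -> R) u0 u1 e : continuous f -> continuous g ->
  0 < e -> u0 + e <= u1 -> (forall s t, u0 <= s -> s < t -> t <= u1 -> g s < g t) ->
  (forall u, u0 < u <= u0 + e -> f u < f u0) ->
  (forall u, u1 - e <= u < u1 -> f u1 < f u) ->
  exists a d, [/\ spans a (f u0) (f u1) (g u0) (g u1) d,
    forall u, u0 <= u <= u1 -> a (g u) = f u
  & forall y, g u0 <= y <= g u1 -> exists2 u, u0 <= u <= u1 & g u = y].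
Proof.
move=> cf cg e0 ue gm fl fr; have u01 : u0 <= u1 by qlra.
have [g' [cg' g'K g'I g'E]] := inverse_incr u01 cg gm.
have gle s t : u0 <= s -> s <= t -> t <= u1 -> g s <= g t.
  by move=> us; rewrite le_eqVlt => /orP[/eqP->//|st] tu; apply/ltW/gm.
have glt s t : u0 <= s <= u1 -> u0 <= t <= u1 -> g s < g t -> s < t.
  by move=> /andP[? ?] /andP[? ?]; rewrite !ltNge; apply: contra => ts; apply: gle.
have h1 : g u0 < g (u0 + e) by apply: gm; qlra.
have h2 : g (u1 - e) < g u1 by apply: gm; qlra.
have h3 : g (u0 + e) <= g u1 by apply: gle; qlra.
have h4 : g u0 <= g (u1 - e) by apply: gle; qlra.
exists (fun y => f (g' y)), (Num.min (g (u0 + e) - g u0) (g u1 - g (u1 - e))); split.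
- split.
  + exact: ctscomp cg' cf.
  + by apply: gm; qlra.
  + by rewrite lt_min !subr_gt0 h1.
  + by rewrite g'K // lexx.
  + by rewrite g'K // lexx andbT.
  + move=> y /andP[y1 y2]; have {}y2 : y <= g (u0 + e).
      have : Num.min (g (u0 + e) - g u0) (g u1 - g (u1 - e)) <= g (u0 + e) - g u0.
        by rewrite ge_min lexx.
      by qlra.
    have yE : g (g' y) = y by apply: g'E; apply/andP; split; qlra.
    have yI := g'I y; move: (g' y) yI yE => t yI yE; rewrite -yE in y1 y2.
    apply: fl; rewrite (glt u0 t) ?lexx //= leNgt; apply: contraTN y2 => c.
    by rewrite -ltNge; apply: gm; have /andP[? ?] := yI; qlra.
  + move=> y /andP[y1 y2]; have {}y1 : g (u1 - e) <= y.
      have : Num.min (g (u0 + e) - g u0) (g u1 - g (u1 - e)) <= g u1 - g (u1 - e).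
        by rewrite ge_min lexx orbT.
      by qlra.
    have yE : g (g' y) = y by apply: g'E; apply/andP; split; qlra.
    have yI := g'I y; move: (g' y) yI yE => t yI yE; rewrite -yE in y1 y2.
    apply: fr; rewrite (glt t u1) ?lexx ?andbT // leNgt; apply: contraTN y1 => c.
    by rewrite -ltNge; apply: gm; have /andP[? ?] := yI; qlra.
- by move=> u uI; rewrite g'K.
- by move=> y yI; exists (g' y); [exact: g'I | exact: g'E].
Qed.

Section Fixed.
Variable n : nat.
Notation N := n.*2.+1.
Notation H := (N.*2%:R : R).
Notation L := (N.*2.*2%:R : R).

Lemma curve_piece k s : 0 <= s <= 1 -> curve n (k%:R + s) = pc n k s :> R * R.
Proof.
move=> /andP[s0 s1]; rewrite (@curveE _ n k); first by rewrite addrAC subrr add0r.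
by rewrite lerDl s0 -natr1 lerD2l.
Qed.

Lemma pc_first : pc n N.*2.*2.-1 = column_cap n 1 :> (R -> R * R).
Proof.
have [|_ E] := @pc_column R n n.*2; first by lia.
have e1 : (N - n.*2 = 1)%N by lia.
have e2 : ((N.*2 + n.*2.*2).+1 = N.*2.*2.-1)%N by lia.
by rewrite e1 e2 in E.
Qed.

Lemma pc_last : pc n N.*2.-1 = row_cap n N :> (R -> R * R).
Proof.
have [|_ E] := @pc_row R n n.*2; first by lia.
have e : (n.*2.*2.+1 = N.*2.-1)%N by lia.
by rewrite e in E.
Qed.

Lemma first_run_up u v : L - 2 / 3 <= u -> u < v -> v <= L ->
  ty n (curve n u) < ty n (curve n v).
Proof.
have E : L = (N.*2.*2.-1)%:R + 1 by rewrite natr1.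
move=> u0 uv v1; rewrite -(subrKC (N.*2.*2.-1)%:R u) -(subrKC (N.*2.*2.-1)%:R v).
rewrite !curve_piece; try by apply/andP; split; qlra.
by rewrite pc_first; apply: first_cap_up; qlra.
Qed.

Lemma first_run_back u v : L - 1 <= u -> u < v -> v <= L - 1 / 3 ->
  tx n (curve n v) < tx n (curve n u).
Proof.
have E : L = (N.*2.*2.-1)%:R + 1 by rewrite natr1.
move=> u0 uv v1; rewrite -(subrKC (N.*2.*2.-1)%:R u) -(subrKC (N.*2.*2.-1)%:R v).
rewrite !curve_piece; try by apply/andP; split; qlra.
by rewrite pc_first; apply: first_cap_back; qlra.
Qed.

Lemma last_run_up u v : H - 1 <= u -> u < v -> v <= H - 1 / 3 ->
  ty n (curve n u) < ty n (curve n v).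
Proof.
have E : H = (N.*2.-1)%:R + 1 by rewrite natr1.
move=> u0 uv v1; rewrite -(subrKC (N.*2.-1)%:R u) -(subrKC (N.*2.-1)%:R v).
rewrite !curve_piece; try by apply/andP; split; qlra.
by rewrite pc_last; apply: last_cap_up; qlra.
Qed.

Lemma last_run_back u v : H - 2 / 3 <= u -> u < v -> v <= H ->
  tx n (curve n v) < tx n (curve n u).
Proof.
have E : H = (N.*2.-1)%:R + 1 by rewrite natr1.
move=> u0 uv v1; rewrite -(subrKC (N.*2.-1)%:R u) -(subrKC (N.*2.-1)%:R v).
rewrite !curve_piece; try by apply/andP; split; qlra.
by rewrite pc_last; apply: last_cap_back; qlra.
Qed.

(** The rows occupy the times from 0 to [H] and the columns those from [H] to [L]. Here the rows are
    taken one period later, between the midpoints of the two corner caps. *)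
Lemma run_up u v : L - 1 / 2 <= u -> u < v -> v <= L + H - 1 / 2 ->
  ty n (curve n u) < ty n (curve n v).
Proof.
have E : L + H - 1 = (N.*2.*2 + N.*2.-1)%:R by rewrite natrD -[H](natr1 N.*2.-1); ring.
have L0 : 0 <= L - 1 by rewrite subr_ge0 ler1n.
move: u v; apply: (@incr_glue _ (fun u => ty n (curve n u)) _ (L + H - 1 / 2) N.*2.*2 (N.*2.*2 + N.*2.-1)) => //.
- by qlra.
- by rewrite -E; qlra.
- by move=> u v u0 uv v1; apply: first_run_up => //; qlra.
- move=> k u v /andP[k0 k1] uk uv vk.
  have [j jE] : {j | k = (j + N.*2.*2)%N} by exists (k - N.*2.*2)%N; rewrite subnK.
  have kE : k.+1%:R = k%:R + 1 :> R by rewrite natr1.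
  rewrite -(subrKC k%:R u) -(subrKC k%:R v) !curve_piece; try by apply/andP; split; qlra.
  rewrite jE pcD -jE; have jN : (j < N.*2.-1)%N by lia.
  rewrite -(odd_double_half j) in jN *; move: (j./2) jN => i.
  case: odd; rewrite ?add1n ?add0n => iN.
    have [|_ ->] := @pc_row R n i; first by lia.
    by apply: row_cap_up; [lia|qlra|qlra|qlra].
  have [|-> _] := @pc_row R n i; first by lia.
  by apply: row_up; [lia|qlra|qlra|qlra].
- move=> u v; rewrite -E => u0 uv v1.
  have Lp w : 0 <= w - L -> curve n w = curve n (w - L) by move=> w0; rewrite -{1}(subrK L w) curveD.
  have H1 : 1 <= H by rewrite ler1n.
  rewrite (Lp u) ?(Lp v); try qlra.
  by apply: last_run_up; qlra.
- by lia.
Qed.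

Lemma run_back u v : H - 1 / 2 <= u -> u < v -> v <= L - 1 / 2 ->
  tx n (curve n v) < tx n (curve n u).
Proof.
have E : L - 1 = (N.*2.*2.-1)%:R by rewrite -[L](natr1 N.*2.*2.-1); ring.
suff : forall u v, H - 1 / 2 <= u -> u < v -> v <= L - 1 / 2 ->
    - tx n (curve n u) < - tx n (curve n v).
  by move=> h u0 uv v1; rewrite -ltrN2; apply: h.
apply: (@incr_glue _ (fun u => - tx n (curve n u)) _ (L - 1 / 2) N.*2 N.*2.*2.-1) => //.
- by qlra.
- by rewrite -E; qlra.
- by move=> {}u {}v u0 uv v1; rewrite ltrN2; apply: last_run_back => //; qlra.
- move=> k {}u {}v /andP[k0 k1] uk uv vk; rewrite ltrN2.
  have [j jE] : {j | k = (N.*2 + j)%N} by exists (k - N.*2)%N; rewrite subnKC.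
  have kE : k.+1%:R = k%:R + 1 :> R by rewrite natr1.
  rewrite -(subrKC k%:R u) -(subrKC k%:R v) !curve_piece; try by apply/andP; split; qlra.
  have [s0 st t1] : [/\ 0 <= u - k%:R, u - k%:R < v - k%:R & v - k%:R <= 1] by split; qlra.
  move: (u - _) (v - _) s0 st t1 => s t s0 st t1 {uk uv vk kE}.
  rewrite jE; have jN : (j < N.*2.-1)%N by lia.
  rewrite -(odd_double_half j) in jN *; move: (j./2) jN => i.
  case: odd; rewrite ?add1n ?add0n ?addnS => iN.
    have [|_ ->] := @pc_column R n i; first by lia.
    by apply: column_cap_back; [lia|by []|by []|by []].
  have [|-> _] := @pc_column R n i; first by lia.
  by apply: column_back; [lia|by []|by []|by []].
- move=> {}u {}v; rewrite -E => u0 uv v1; rewrite ltrN2.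
  by apply: first_run_back; qlra.
- by lia.
Qed.

End Fixed.
End Potholder.

(** * Placing the crossings on the potholder *)

Section PotholderCarries.
Context {R : realType}.
Notation lo := (1 / 2 : R).
Notation hi n := (n.*2.+1%:R + 1 / 2 : R).

Section Fixed.
Variable n : nat.
Notation N := n.*2.+1.
Notation H := (N.*2%:R : R).
Notation L := (N.*2.*2%:R : R).
Notation FX := (fun u : R => tx n (curve n u)).
Notation FY := (fun u : R => ty n (curve n u)).

Lemma H_ge2 : 2 <= H.
Proof. by rewrite ler_nat. Qed.

Lemma LE : L = H + H.
Proof. by rewrite -addnn natrD. Qed.

Lemma tilt_cts (f g : R -> R) : continuous f -> continuous g ->
  continuous (fun u => tilt n (f u) (g u)).
Proof.
have ccos : continuous (cos : R -> R) := @continuous_cos R.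
by move=> cf cg; rewrite /tilt /clamp; cts.
Qed.

Lemma ty_cts : continuous FY.
Proof. by have [c1 c2] := @curve_cts R n; exact: tilt_cts c1 c2. Qed.

Lemma tx_cts : continuous FX.
Proof. by have [c1 c2] := @curve_cts R n; exact: tilt_cts ty_cts c1. Qed.

Lemma curve_shift w : L <= w -> curve n w = curve n (w - L) :> R * R.
Proof. by move=> w0; rewrite -{1}(subrK L w) curveD // subr_ge0. Qed.

(** The arc of rows increases in the tilted y, so it meets the level [j + 1/2] only here, in the
    middle of a cap; at this level every column thus passes the arc on one side, chosen by the
    parity of [j]. *)
Lemma cap_point j : (0 < j < N)%N -> exists u : R, [/\ L - 1 / 2 < u < L + H - 1 / 2,
  FY u = j%:R + 1 / 2 & FX u = if odd j then hi n + 1 / 2 else lo - 1 / 2].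
Proof.
case: j => // j /andP[_ jN]; have [|_ E] := @pc_row R n j; first by lia.
have e1 : (j.*2.+1)%:R + 2 <= H by rewrite -natrD ler_nat; lia.
have e0 := ler0n R j.*2.+1; have H2 := H_ge2.
exists (j.*2.+1%:R + 1 / 2 + L); split; first by apply/andP; split; qlra.
  rewrite curveD; last by qlra.
  rewrite curve_piece; last by apply/andP; split; qlra.
  rewrite E /row_cap ltn_eqF //; case: odd; rewrite /ty /Defs.arc /=.
    have -> : (1 - 1 / 2) * - (pi / 2) + 1 / 2 * (pi / 2) = 0 :> R by field.
    by rewrite sin0 mul0r addr0 tilt_half // ltnW.
  have -> : (1 - 1 / 2) * - (pi / 2) + 1 / 2 * - (pi + pi / 2) = - pi :> R by field.
  by rewrite sinN sinpi oppr0 mul0r addr0 tilt_half // ltnW.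
rewrite curveD; last by qlra.
rewrite curve_piece; last by apply/andP; split; qlra.
rewrite E /row_cap ltn_eqF //; case: odd; rewrite /tx /Defs.arc /=.
  have -> : (1 - 1 / 2) * - (pi / 2) + 1 / 2 * (pi / 2) = 0 :> R by field.
  by rewrite cos0; apply: tilt_out; right; rewrite lerDl.
have -> : (1 - 1 / 2) * - (pi / 2) + 1 / 2 * - (pi + pi / 2) = - pi :> R by field.
by rewrite cosN cospi mulNr; apply: tilt_out; left; qlra.
Qed.

(** The level is not affected by the tilt, and x is displaced by less than 1/2, so points on
    different columns keep their order whatever their levels are. *)
Lemma column_point i j : (0 < i <= N)%N -> (j <= N)%N -> exists u : R,
  [/\ H - 1 / 2 < u < L - 1 / 2, FY u = j%:R + 1 / 2 & `|FX u - i%:R| < 1 / 2].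
Proof.
move=> iN jN; have /andP[i0 i1] := iN.
have [|E _] := @pc_column R n (N - i); first by lia.
rewrite subKn // in E.
have [s s01 sE] : exists2 s : R, 0 <= s <= 1 & Defs.column n i s = (i%:R, j%:R + 1 / 2).
  have N0 : 0 < N%:R :> R by rewrite ltr0n.
  have j01 : 0 <= (j%:R / N%:R : R) <= 1 by rewrite divr_ge0 // ler_pdivrMr // mul1r ler_nat.
  have jE : N%:R * (j%:R / N%:R) = j%:R :> R by rewrite mulrC divfK // gt_eqF.
  move: (j%:R / N%:R) j01 jE => q /andP[q0 q1] jE.
  rewrite /Defs.column; case: odd; [exists (1 - q)|exists q]; try by apply/andP; split; qlra.
    by congr (_, _); rewrite /= /GRing.scale /= -?jE; ring.
  by congr (_, _); rewrite /= /GRing.scale /= -?jE; ring.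
have e1 : ((N.*2 + (N - i).*2)%:R : R) + 2 <= L by rewrite -natrD ler_nat; lia.
have e2 : H <= (N.*2 + (N - i).*2)%:R by rewrite ler_nat leq_addr.
have /andP[s0 s1] := s01.
exists ((N.*2 + (N - i).*2)%:R + s); split; first by apply/andP; split; qlra.
  by rewrite curve_piece // E sE /ty /= tilt_half.
rewrite curve_piece // E sE /tx /= tilt_half // tilt_nat // addrC addKr normrN normrM.
by have := slope_mid n (j%:R + 1 / 2 : R); rewrite normrX normrN1 expr1n; qlra.
Qed.

(** The margin 1/6 is the time on either side of the middle of a corner cap during which both
    coordinates are monotone. *)
Lemma over_spans : exists a d,
  [/\ spans a (FX (L - 1 / 2)) (FX (H - 1 / 2)) (FY (L - 1 / 2)) (FY (H - 1 / 2)) d,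
    forall u : R, L - 1 / 2 <= u <= L + H - 1 / 2 -> a (FY u) = FX u
  & forall y, FY (L - 1 / 2) <= y <= FY (H - 1 / 2) ->
      exists2 u : R, L - 1 / 2 <= u <= L + H - 1 / 2 & FY u = y].
Proof.
have H2 := H_ge2; have LH := LE.
have E : L + H - 1 / 2 - L = H - 1 / 2 by ring.
have [|||u uI|u uI|a [d [S1 S2 S3]]] := @spans_param R FX FY (L - 1 / 2) (L + H - 1 / 2) (1 / 6) tx_cts ty_cts.
- by [].
- by qlra.
- by move=> s t; exact: run_up.
- by have /andP[? ?] := uI; apply: first_run_back; qlra.
- have /andP[u0 u1] := uI; rewrite (@curve_shift u) 1?(@curve_shift (L + H - 1 / 2)) ?E; try qlra.
  by apply: last_run_back; qlra.
have E2 : curve n (L + H - 1 / 2) = curve n (H - 1 / 2) by rewrite curve_shift ?E //; qlra.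
by rewrite E2 in S1 S3; exists a, d.
Qed.

Lemma under_spans : exists b d,
  [/\ spans b (FY (L - 1 / 2)) (FY (H - 1 / 2)) (FX (L - 1 / 2)) (FX (H - 1 / 2)) d,
    forall u : R, H - 1 / 2 <= u <= L - 1 / 2 -> b (FX u) = FY u
  & forall x, FX (L - 1 / 2) <= x <= FX (H - 1 / 2) ->
      exists2 u : R, H - 1 / 2 <= u <= L - 1 / 2 & FX u = x].
Proof.
have H2 := H_ge2; have LH := LE.
have cN : continuous (fun w : R => - w) by cts.
(* The columns are run from right to left, so time is reversed. *)
have [|||u uI|u uI|b [d [S1 S2 S3]]] := @spans_param R (fun w => FY (- w)) (fun w => FX (- w))
    (- (L - 1 / 2)) (- (H - 1 / 2)) (1 / 6) (ctscomp cN ty_cts) (ctscomp cN tx_cts).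
- by [].
- by qlra.
- by move=> s t s0 st t1; apply: run_back; qlra.
- by have /andP[? ?] := uI; rewrite opprK; apply: first_run_up; qlra.
- by have /andP[? ?] := uI; rewrite opprK; apply: last_run_up; qlra.
rewrite !opprK in S1 S3; exists b, d; split=> // [u /andP[u0 u1]|x /S3[w /andP[w0 w1] wE]].
  by have := S2 (- u); rewrite opprK; apply; apply/andP; split; qlra.
by exists (- w) => //; apply/andP; split; qlra.
Qed.

Lemma potholder_lift a b h d :
  crossing a b h (FX (L - 1 / 2)) (FX (H - 1 / 2)) (FY (L - 1 / 2)) (FY (H - 1 / 2)) d ->
  (forall u : R, L - 1 / 2 <= u <= L + H - 1 / 2 -> a (FY u) = FX u) ->
  (forall y, FY (L - 1 / 2) <= y <= FY (H - 1 / 2) ->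
      exists2 u : R, L - 1 / 2 <= u <= L + H - 1 / 2 & FY u = y) ->
  (forall u : R, H - 1 / 2 <= u <= L - 1 / 2 -> b (FX u) = FY u) ->
  (forall x, FX (L - 1 / 2) <= x <= FX (H - 1 / 2) ->
      exists2 u : R, H - 1 / 2 <= u <= L - 1 / 2 & FX u = x) ->
  exists (P : pt R -> pt R) over h', [/\ iso P, realizes (potholder n) over h'
    & P @` cset a b h (FX (L - 1 / 2)) (FX (H - 1 / 2)) (FY (L - 1 / 2)) (FY (H - 1 / 2)) =
      Defs.lift (potholder n) h'].
Proof.
move=> C a1 a2 b1 b2; have H2 := H_ge2; have LH := LE; have L0 : 0 < L by qlra.
have pE : potholder n = fun t : R => curve n (L * t) by apply/funext => t; exact: potholderE.
rewrite pE; pose al := (H - 1 / 2) / L; pose be := (L - 1 / 2) / L.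
have alE : L * al = H - 1 / 2 by rewrite mulrC divfK // gt_eqF.
have beE : L * be = L - 1 / 2 by rewrite mulrC divfK // gt_eqF.
have Ll s t : (L * s <= L * t) = (s <= t) by rewrite ler_pM2l.
have Lt s t : (L * s < L * t) = (s < t) by rewrite ltr_pM2l.
have L1 : L * 1 = L by rewrite mulr1.
have Li s t : L * s = L * t -> s = t by apply: mulfI; rewrite gt_eqF.
have Lx u : L * (u / L) = u by rewrite mulrC divfK // gt_eqF.
have le_al v : (v / L <= al) = (v <= H - 1 / 2) by rewrite -(Ll _ al) Lx alE.
have ge_al v : (al <= v / L) = (H - 1 / 2 <= v) by rewrite -(Ll al) Lx alE.
have le_be v : (v / L <= be) = (v <= L - 1 / 2) by rewrite -(Ll _ be) Lx beE.
have ge_be v : (be <= v / L) = (L - 1 / 2 <= v) by rewrite -(Ll be) Lx beE.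
have ge_0 v : (0 <= v / L) = (0 <= v) by rewrite -(Ll 0) Lx mulr0.
have le_1 v : (v / L <= 1) = (v <= L) by rewrite -(Ll _ 1) Lx L1.
have B (t : R) : al <= t <= be -> H - 1 / 2 <= L * t <= L - 1 / 2.
  by rewrite -alE -beE !Ll.
(* Parameters before [al] are shifted by one period, which makes the two ends of the parameter
   interval a single run. *)
have A (t : R) : 0 <= t <= 1 -> t <= al \/ be <= t -> exists v : R, [/\ L - 1 / 2 <= v <= L + H - 1 / 2,
    curve n v = curve n (L * t) & v = L * t + L \/ v = L * t /\ be <= t].
  move=> /andP[t0 t1] tA; have Lt0 : 0 <= L * t by rewrite mulr_ge0 // ltW.
  have Lt1 : L * t <= L by rewrite -[X in _ <= X]L1 Ll.
  case: tA => tA; [rewrite -(Ll t) alE in tA|rewrite -(Ll be) beE in tA].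
    by exists (L * t + L); rewrite curveD //; split=> //; [apply/andP; split; qlra|left].
  exists (L * t); split=> //; first by apply/andP; split; qlra.
  by right; rewrite -(Ll be) beE.
have up (u v : R) : L - 1 / 2 <= u <= L + H - 1 / 2 -> L - 1 / 2 <= v <= L + H - 1 / 2 -> FY u = FY v -> u = v.
  move=> /andP[u0 u1] /andP[v0 v1] E; have [l|l|//] := ltgtP u v.
    by have := run_up u0 l v1; rewrite E ltxx.
  by have := run_up v0 l u1; rewrite E ltxx.
have bk (u v : R) : H - 1 / 2 <= u <= L - 1 / 2 -> H - 1 / 2 <= v <= L - 1 / 2 -> FX u = FX v -> u = v.
  move=> /andP[u0 u1] /andP[v0 v1] E; have [l|l|//] := ltgtP u v.
    by have := run_back u0 l v1; rewrite E ltxx.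
  by have := run_back v0 l u1; rewrite E ltxx.
have cX : continuous (fun t => FX (L * t)).
  have cL : continuous (fun t : R => L * t) by cts.
  exact: (ctscomp cL tx_cts).
apply: (@lift_cset _ (fun t => curve n (L * t)) (tx n) (ty n) al be a b h _ _ _ _ d) => //.
- exact: iso_tilt.
- by rewrite mulr0 L1 -[L in RHS]add0r curveD.
- by rewrite divr_gt0 //; qlra.
- by rewrite -Lt alE beE; qlra.
- by rewrite -Lt beE L1; qlra.
- by rewrite alE.
- by rewrite beE.
- move=> t /B uI; split; last by rewrite b1.
  have /andP[u0 u1] := uI; move: (L * t) u0 u1 {uI} => u u0 u1.
  apply/andP; split.
    move: u1; rewrite le_eqVlt => /orP[/eqP->//|u1].
    by apply/ltW/run_back => //; qlra.
  move: u0; rewrite le_eqVlt => /orP[/eqP->//|u0].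
  by apply/ltW/run_back => //; qlra.
- move=> x /b2[u uI uE]; exists (u / L); last by rewrite Lx.
  by rewrite ge_al le_be.
- by move=> s t /B sB /B tB /(bk _ _ sB tB) /Li.
- move=> t t01 /(A t t01)[v [vI vE _]]; rewrite -vE a1 //; split=> //.
  have E2 : curve n (L + H - 1 / 2) = curve n (H - 1 / 2).
    by rewrite curve_shift; [congr curve; ring | qlra].
  rewrite -E2; have /andP[u0 u1] := vI; apply/andP; split.
    move: u0; rewrite le_eqVlt => /orP[/eqP->//|u0].
    by apply/ltW/run_up => //; qlra.
  move: u1; rewrite le_eqVlt => /orP[/eqP->//|u1].
  by apply/ltW/run_up => //; qlra.
- move=> y /a2[u /andP[u0 u1] uE]; have [Lu|uL] := le_or_lt L u.
    exists ((u - L) / L); rewrite ge_0 le_1 le_al Lx -curve_shift //; split=> //.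
      by apply/andP; split; qlra.
    by left; qlra.
  exists (u / L); rewrite ge_0 le_1 ge_be Lx; split=> //.
    by apply/andP; split; qlra.
  by right.
- move=> s t /andP[s0 s1] /andP[t0 t1] sA tA E.
  have [|v [vI vE vs]] := A s _ sA; first by rewrite s0 ltW.
  have [|w [wI wE ws]] := A t _ tA; first by rewrite t0 ltW.
  have vw : v = w by apply: up; rewrite // vE wE.
  have Ls : 0 <= L * s < L by rewrite mulr_ge0 ?(ltW L0) // -[X in _ < X]L1 Lt.
  have Lt' : 0 <= L * t < L by rewrite mulr_ge0 ?(ltW L0) // -[X in _ < X]L1 Lt.
  apply: Li; case: vs ws => [vs|[vs _]] [ws|[ws _]]; qlra.
Qed.

End Fixed.

(** The i-th zero goes to column [i], at the level of a cap chosen by its rank and side. The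
    remaining columns and the other intersections with rows cost nothing, as the height is nonzero
    at all points that are not among these zeros. *)
Lemma potholder_carries a b h X0 X1 Y0 Y1 d : crossing a b h X0 X1 Y0 Y1 d ->
  exists n, (1 <= n)%N /\ exists (P : pt R -> pt R) over h',
    [/\ iso P, realizes (potholder n) over h'
    & P @` cset a b h X0 X1 Y0 Y1 = Defs.lift (potholder n) h'].
Proof.
move=> C; have [r [s [right [sr NF]]]] := normal_form C.
(* With [r <= n] there are [2 * r] caps at hand, one on each side for every level; the maximum with
   1 serves the case of no zeros. *)
pose n := maxn 1 r; exists n; split; first by rewrite leq_max.
have rn : (r <= n)%N by rewrite leq_maxr.
have [a' [da [Sa a1 a2]]] := over_spans n.
have [b' [db [Sb b1 b2]]] := under_spans n.
(* Odd caps lie on the right and even caps on the left; for either choice the caps increase with the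
   rank [k]. *)
pose j k := if right k then k.*2.-1 else k.*2.
have jN k : (0 < k <= r)%N -> (0 < j k < n.*2.+1)%N by rewrite /j; case: ifP => _; lia.
have colP i : exists u : R, (0 < i <= r)%N ->
    [/\ n.*2.+1.*2%:R - 1 / 2 < u < n.*2.+1.*2.*2%:R - 1 / 2, ty n (curve n u) = (j (s i))%:R + 1 / 2
      & `|tx n (curve n u) - i%:R| < 1 / 2].
  have [ir|ir] := boolP (0 < i <= r)%N; last by exists 0.
  have [||u uP] := @column_point n i (j (s i)); last by exists u.
    by lia.
  by have /andP[_ /ltnW] := jN _ (sr i ir).
have [u uP] := choice colP.
have capP k : exists v : R, (0 < k <= r)%N ->
    [/\ n.*2.+1.*2.*2%:R - 1 / 2 < v < n.*2.+1.*2.*2%:R + n.*2.+1.*2%:R - 1 / 2,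
      ty n (curve n v) = (j k)%:R + 1 / 2
      & tx n (curve n v) = if right k then hi n + 1 / 2 else lo - 1 / 2].
  have [kr|kr] := boolP (0 < k <= r)%N; last by exists 0.
  have [v [v1 v2 v3]] := cap_point (jN k kr); exists v => _; split=> //.
  rewrite v3; congr (if _ then _ else _); rewrite /j; case: ifP => _; lia.
have [v vP] := choice capP.
pose X0' : R := tx n (curve n (n.*2.+1.*2.*2%:R - 1 / 2)); pose X1' : R := tx n (curve n (n.*2.+1.*2%:R - 1 / 2)).
pose Y0' : R := ty n (curve n (n.*2.+1.*2.*2%:R - 1 / 2)); pose Y1' : R := ty n (curve n (n.*2.+1.*2%:R - 1 / 2)).
pose x (i : nat) := if i == 0%N then X0' else if i == r.+1 then X1' else tx n (curve n (u i)).
pose y (k : nat) := if k == 0%N then Y0' else if k == r.+1 then Y1' else (j k)%:R + 1 / 2.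
have xE i : (0 < i <= r)%N -> x i = tx n (curve n (u i)).
  by move=> ir; rewrite /x !ifF //; lia.
have yE k : (0 < k <= r)%N -> y k = (j k)%:R + 1 / 2.
  by move=> ir; rewrite /y !ifF //; lia.
have x0 : x 0%N = X0' by []. have y0 : y 0%N = Y0' by [].
have x1 : x r.+1 = X1' by rewrite /x /= eqxx.
have y1 : y r.+1 = Y1' by rewrite /y /= eqxx.
pose e := Num.min da db.
have e1 : 0 < e <= da by rewrite lt_min (spans_d Sa) (spans_d Sb) ge_min lexx.
have e2 : 0 < e <= db by rewrite lt_min (spans_d Sa) (spans_d Sb) ge_min lexx orbT.
have xin i : (0 < i <= r)%N -> X0' < x i < X1'.
  move=> ir; have [/andP[u0 u1] _ _] := uP i ir; rewrite xE //.
  by apply/andP; split; apply: run_back; qlra.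
have yin k : (0 < k <= r)%N -> Y0' < y k < Y1'.
  move=> kr; have [/andP[v0 v1] yv _] := vP k kr; rewrite yE // -yv.
  have E2 : Y1' = ty n (curve n (n.*2.+1.*2.*2%:R + n.*2.+1.*2%:R - 1 / 2)).
    rewrite curve_shift; first by congr (ty n (curve n _)); ring.
    by have := H_ge2 n; qlra.
  by rewrite E2; apply/andP; split; apply: run_up; qlra.
have [||i ir|i ir|i ir|P [h' [d' [iP C' PE]]]] := NF a' b' x y e.
- by rewrite x0 x1 y0 y1; apply: spans_weaken Sa e1.
- by rewrite x0 x1 y0 y1; apply: spans_weaken Sb e2.
- case: i ir => [_|i ir].
    have [r0|r0] := posnP r; first by have := x1; rewrite r0 => ->; exact: spans_lt Sb.
    by have /andP[] := xin 1%N r0.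
  have i1 : (0 < i.+1 <= r)%N by lia.
  have [ir'|ir'] := ltnP i.+1 r; last first.
    have -> : i.+2 = r.+1 by lia.
    by rewrite x1; have /andP[] := xin _ i1.
  have i2 : (0 < i.+2 <= r)%N by lia.
  have [_ _] := uP _ i1; have [_ _] := uP _ i2; rewrite !xE // !ltr_norml.
  have e3 : i.+2%:R = i.+1%:R + 1 :> R by rewrite natr1.
  by move=> /andP[? ?] /andP[? ?]; qlra.
- case: i ir => [_|i ir].
    have [r0|r0] := posnP r; first by have := y1; rewrite r0 => ->; exact: spans_lt Sa.
    by have /andP[] := yin 1%N r0.
  have i1 : (0 < i.+1 <= r)%N by lia.
  have [ir'|ir'] := ltnP i.+1 r; last first.
    have -> : i.+2 = r.+1 by lia.
    by rewrite y1; have /andP[] := yin _ i1.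
  have i2 : (0 < i.+2 <= r)%N by lia.
  by rewrite !yE // ltrD2r ltr_nat /j; case: ifP => _; case: ifP => _; lia.
- have [/andP[u0 u1] Yu Xu] := uP i ir; have si := sr i ir.
  have [/andP[v0 v1] Yv Xv] := vP _ si.
  rewrite xE // yE // b1 ?Yu //; last by apply/andP; split; qlra.
  split=> //; rewrite -Yv a1; last by apply/andP; split; qlra.
  rewrite Xv; have i1 : 1 <= i%:R :> R by rewrite ler1n; case/andP: ir.
  have iN : i%:R <= n.*2.+1%:R :> R.
    by rewrite ler_nat; clear -ir rn; lia.
  by move: Xu; rewrite ltr_norml => /andP[? ?]; case: (right (s i)); qlra.
rewrite x0 x1 y0 y1 in C' PE.
have [Q [over [h'' [iQ rz QE]]]] := potholder_lift C' a1 a2 b1 b2.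
exists (fun q => Q (P q)), over, h''; split=> //; first exact: iso_comp.
by rewrite -QE -PE image_comp.
Qed.

End PotholderCarries.

(** * From polygons to zigzags *)

Section Polygon.
Context {R : realType}.
Implicit Types X Y Z : nat -> R.

Definition lin X (t : R) : R := chain (fun k s => (1 - s) * X k + s * X k.+1) t.

Lemma lin_cts X : continuous (lin X).
Proof.
apply: (@cts_chain R (fun k s => (1 - s) * X k + s * X k.+1)) => k; first by cts.
by rewrite subrr subr0 !mul0r !mul1r add0r addr0.
Qed.

Lemma linE X k t : k%:R <= t <= k.+1%:R ->
  lin X t = (1 - (t - k%:R)) * X k + (t - k%:R) * X k.+1.
Proof.
move=> tk; rewrite /lin (@chainE_closed R _ _ k t) //.
by rewrite subrr subr0 !mul0r !mul1r add0r addr0.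
Qed.

Lemma lin_nat X k : lin X k%:R = X k.
Proof.
rewrite (@linE X k) ?subrr ?subr0 ?mul1r ?mul0r ?addr0 //.
by rewrite lexx ler_nat leqnSn.
Qed.

Lemma linD X Y (a t : R) : lin (fun k => X k + a * Y k) t = lin X t + a * lin Y t.
Proof. by rewrite /lin /chain; ring. Qed.

Lemma truncnP (t : R) : 0 <= t -> exists k : nat, k%:R <= t < k.+1%:R.
Proof. by move=> t0; exists (Num.truncn t); exact: Num.Theory.truncn_itv. Qed.

Lemma lin_shift X k0 t : 0 <= t -> lin (fun k => X (k + k0)%N) t = lin X (t + k0%:R).
Proof.
move=> /truncnP[k /andP[k1 k2]]; rewrite (@linE _ k); last by rewrite k1 ltW.
rewrite (@linE X (k + k0)); last by rewrite -addSn !natrD !lerD2r k1 ltW.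
have -> : t + k0%:R - (k + k0)%:R = t - k%:R by rewrite natrD; ring.
by rewrite addSn.
Qed.

(** Periodic sequences instead of cyclic indices: a change of the starting vertex becomes a shift of
    the index, and parameters may run beyond a period. Injectivity is therefore asked only for
    parameters less than a period apart. *)
Record cpoly (M : nat) X Y Z : Prop := CPoly {
  cpoly_gt0 : (0 < M)%N;
  cpoly_per : forall k, [/\ X (k + M)%N = X k, Y (k + M)%N = Y k & Z (k + M)%N = Z k];
  cpoly_inj : forall s t, 0 <= s -> 0 <= t -> `|s - t| < M%:R ->
    lin X s = lin X t -> lin Y s = lin Y t -> lin Z s = lin Z t -> s = t }.

Definition polyset X Y Z : set (pt R) :=
  [set q | exists2 t, 0 <= t & q = (lin X t, lin Y t, lin Z t)].

Lemma polygonal_poly (L : set (pt R)) : polygonal_knot L ->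
  exists M X Y Z, cpoly M X Y Z /\ L = polyset X Y Z.
Proof.
move=> [m [v [LE vi]]]; pose V k := v (inord (k %% m.+1)).
pose X k : R := (V k).1.1; pose Y k : R := (V k).1.2; pose Z k : R := (V k).2.
have VS k : v (ordS (inord (k %% m.+1))) = V k.+1.
  congr v; apply: val_inj => /=; rewrite !inordK ?ltn_mod //.
  by rewrite -addn1 -[k.+1]addn1 modnDml.
have ptE k t : k%:R <= t <= k.+1%:R ->
    (lin X t, lin Y t, lin Z t) = edge v (inord (k %% m.+1)) (t - k%:R).
  by move=> tk; rewrite !(@linE _ k) // /edge VS.
exists m.+1, X, Y, Z; split; first split=> //.
- by move=> k; rewrite /X /Y /Z /V modnDr.
- move=> s t s0 t0 st EX EY EZ.
  have [k /andP[k1 k2]] := truncnP s0; have [l /andP[l1 l2]] := truncnP t0.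
  have := @vi (inord (k %% m.+1)) (inord (l %% m.+1)) (s - k%:R) (t - l%:R).
  rewrite -!ptE ?k1 ?l1 ?ltW // !in_itv /= EX EY EZ => -[| | // |kl E].
  + by rewrite -natr1 in k2; apply/andP; split; qlra.
  + by rewrite -natr1 in l2; apply/andP; split; qlra.
  have {}kl : k = l %[mod m.+1].
    by have := congr1 val kl; rewrite /= !inordK ?ltn_mod.
  have E2 : s - t = k%:R - l%:R by qlra.
  suff kl' : k = l by rewrite kl' in E2; qlra.
  rewrite E2 in st.
  (* Indices that are congruent modulo the period and differ by less than it are equal. *)
  move: st kl; wlog : k l {k1 k2 l1 l2 E E2} / (l <= k)%N.
    move=> W; have [lk|/ltnW lk] := leqP l k; first exact: W.
    by rewrite distrC => st /esym/(W _ _ lk st).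
  move=> lk; rewrite -natrB // ger0_norm ?ler0n // ltr_nat => st /eqP.
  rewrite eqn_mod_dvd // => /dvdnP[q qE]; move: st; rewrite qE.
  case: q qE => [|q] qE; first by move=> _; lia.
  by rewrite mulSn ltnNge leq_addr.
- rewrite LE; apply/seteqP; split=> [q [i _ [s]]|_ [t t0 ->]].
    rewrite /= in_itv /= => /andP[s0 s1] <-.
    have h : (val i)%:R <= (val i)%:R + s <= (val i).+1%:R.
      by rewrite lerDl s0 -natr1 lerD2l.
    exists ((val i)%:R + s); first by rewrite addr_ge0 ?ler0n.
    have iE : inord (val i %% m.+1) = i by apply: val_inj; rewrite /= modn_small ?inordK.
    rewrite (ptE (val i)) // iE; congr edge.
    by rewrite addrAC subrr add0r.
  have [k /andP[k1 k2]] := truncnP t0; exists (inord (k %% m.+1)) => //.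
  exists (t - k%:R); last by rewrite (ptE k) // k1 ltW.
  by rewrite /= in_itv /=; rewrite -natr1 in k2; apply/andP; split; qlra.
Qed.

(** The moment curve [(1, tau, tau ^+ 2)] leaves finitely many planes through the origin: each
    condition is a nonzero polynomial in [tau], and their product has fewer roots than there are
    natural numbers. *)
Lemma generic_root (s : seq (pt R)) : (forall n, n \in s -> n != 0) ->
  exists tau : R, forall n, n \in s -> n.1.1 + n.1.2 * tau + n.2 * tau ^+ 2 != 0.
Proof.
move=> nz; pose p (n : pt R) : {poly R} := n.1.1%:P + n.1.2 *: 'X + n.2 *: 'X^2.
have pE n x : (p n).[x] = n.1.1 + n.1.2 * x + n.2 * x ^+ 2 by rewrite /p !hornerE.
pose q := \prod_(n <- s) p n.
have q0 : q != 0.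
  rewrite /q; elim: s nz {q} => [|n s IH] nz; first by rewrite big_nil oner_neq0.
  rewrite big_cons mulf_neq0 //; last by apply: IH => k ks; apply: nz; rewrite inE ks orbT.
  have := nz n (mem_head _ _); apply: contraNneq => p0.
  have c0 := congr1 (fun r : {poly R} => r`_0) p0.
  have c1 := congr1 (fun r : {poly R} => r`_1) p0.
  have c2 := congr1 (fun r : {poly R} => r`_2) p0.
  move: c0 c1 c2; rewrite /p /= !coefE /= !mulr0 !mulr1 !addr0 !add0r => c0 c1 c2.
  by case: n c0 c1 c2 {nz p0} => [[n1 n2] n3] /= -> -> ->.
have [x xq] : exists x : R, ~~ root q x.
  apply: contrapT => nx.
  have al : all (root q) [seq (i%:R : R) | i <- iota 0 (size q)].
    by apply/allP => x _; apply: contrapT => /negP h; apply: nx; exists x.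
  have un : uniq [seq (i%:R : R) | i <- iota 0 (size q)].
    by rewrite map_inj_uniq ?iota_uniq // => i j /eqP; rewrite eqr_nat => /eqP.
  by have := max_poly_roots q0 al un; rewrite size_map size_iota ltnn.
exists x => n ns; rewrite -pE; apply: contraNneq xq => h; apply/rootP.
by rewrite /q horner_prod (big_rem n) //= h mul0r.
Qed.

(** The cross product, unless the two vectors are dependent; then it suffices to be orthogonal to a
    nonzero one of them. *)
Lemma exists_normal (u1 u2 u3 w1 w2 w3 : R) : exists n : pt R, [/\ n != 0,
  n.1.1 * u1 + n.1.2 * u2 + n.2 * u3 = 0 & n.1.1 * w1 + n.1.2 * w2 + n.2 * w3 = 0].
Proof.
have nz (a b c : R) : (a, b, c) != 0 :> pt R = [|| a != 0, b != 0 | c != 0].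
  by rewrite -!negb_and; congr (~~ _); apply/eqP/and3P => [[-> -> ->]|[/eqP-> /eqP-> /eqP->]].
pose c := (u2 * w3 - u3 * w2, u3 * w1 - u1 * w3, u1 * w2 - u2 * w1).
have [c0|] := eqVneq c 0; last by exists c; split=> //=; ring.
have [c1 c2 c3] : [/\ u2 * w3 - u3 * w2 = 0, u3 * w1 - u1 * w3 = 0 & u1 * w2 - u2 * w1 = 0].
  by case: c0.
have [u10|u10] := eqVneq u1 0; have [u20|u20] := eqVneq u2 0; last first.
- by exists (u2, - u1, 0); rewrite nz u20 /=; split=> //; rewrite ?orbT; qlra.
- by exists (u2, - u1, 0); rewrite nz oppr_eq0 u10 orbT /=; split=> //; qlra.
- by exists (u2, - u1, 0); rewrite nz u20 /=; split=> //; qlra.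
have [u30|u30] := eqVneq u3 0; last first.
  have w10 : w1 = 0 by apply: (mulfI u30); rewrite u10 in c2; qlra.
  by exists (1, 0, 0); rewrite nz oner_eq0 /= w10 u10; split=> //; ring.
have [w10|w10] := eqVneq w1 0.
  by exists (1, 0, 0); rewrite nz oner_eq0 /= w10 u10; split=> //; ring.
by exists (w2, - w1, 0); rewrite nz oppr_eq0 w10 orbT /= u10 u20 u30; split=> //; ring.
Qed.

End Polygon.

(** * General position by shears *)

Section Generic.
Context {R : realType}.
Implicit Types X Y Z : nat -> R.

(** The tents will be functions of y and z alone; this condition keeps the tent over one vertex from
    acting on a distant part of the polygon. *)
Definition star M Y Z := forall k t, 0 <= t -> `|t - k%:R| < M%:R ->
  lin Y t = Y k -> lin Z t = Z k -> t = k%:R.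

Lemma cpoly_perM M X Y Z k q : cpoly M X Y Z ->
  [/\ X (k + q * M)%N = X k, Y (k + q * M)%N = Y k & Z (k + q * M)%N = Z k].
Proof.
move=> Pl; elim: q => [|q [IH1 IH2 IH3]]; first by rewrite mul0n addn0.
have [E1 E2 E3] := cpoly_per Pl (k + q * M).
by rewrite mulSn [(M + _)%N]addnC addnA E1 E2 E3.
Qed.

Lemma cpoly_mod M X Y Z k : cpoly M X Y Z ->
  [/\ X k = X (k %% M)%N, Y k = Y (k %% M)%N & Z k = Z (k %% M)%N] /\
  [/\ X k.+1 = X (k %% M).+1%N, Y k.+1 = Y (k %% M).+1%N & Z k.+1 = Z (k %% M).+1%N].
Proof.
move=> Pl; have [E1 E2 E3] := cpoly_perM (k %% M) (k %/ M) Pl.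
have [F1 F2 F3] := cpoly_perM (k %% M).+1 (k %/ M) Pl.
move: E1 E2 E3 F1 F2 F3; rewrite addSn [(k %% M + _)%N]addnC -divn_eq.
by do 6 move=> ->.
Qed.

Lemma cpoly_shift M X Y Z k0 : cpoly M X Y Z ->
  cpoly M (fun k : nat => X (k + k0)%N) (fun k : nat => Y (k + k0)%N) (fun k : nat => Z (k + k0)%N) /\
  polyset (fun k : nat => X (k + k0)%N) (fun k : nat => Y (k + k0)%N) (fun k : nat => Z (k + k0)%N) = polyset X Y Z.
Proof.
move=> Pl; have k00 : 0 <= k0%:R :> R := ler0n R k0; split; first split.
- exact: cpoly_gt0 Pl.
- by move=> k; have := cpoly_per Pl (k + k0); rewrite [(k + k0 + M)%N]addnAC.
- move=> s t s0 t0 st; rewrite !lin_shift // => E1 E2 E3.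
  apply: (addIr k0%:R) => /=; apply: (cpoly_inj Pl) => //; try exact: addr_ge0.
  by have -> : s + k0%:R - (t + k0%:R) = s - t by ring.
have per W (q : nat) (t : R) : (forall k, W (k + q * M)%N = W k) -> 0 <= t -> lin W (t + (q * M)%:R) = lin W t.
  by move=> per t0; rewrite -lin_shift // (_ : (fun k => _) = W) //; apply/funext.
apply/seteqP; split=> _ [t t0 ->].
  by exists (t + k0%:R); rewrite ?addr_ge0 // !lin_shift.
have kM : (k0 <= k0 * M)%N by rewrite leq_pmulr // (cpoly_gt0 Pl).
exists (t + (k0 * M - k0)%:R); first by rewrite addr_ge0.
rewrite !lin_shift ?addr_ge0 // -addrA -natrD subnK //.
by rewrite !per // => k; have [? ? ?] := cpoly_perM k k0 Pl.
Qed.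

Lemma star_shift M Y Z k0 : star M Y Z ->
  star M (fun k : nat => Y (k + k0)%N) (fun k : nat => Z (k + k0)%N).
Proof.
move=> st k t t0 tk; rewrite !lin_shift // => E1 E2.
apply: (addIr k0%:R) => /=; rewrite -natrD; apply: st => //; first by rewrite addr_ge0.
by have -> : t + k0%:R - (k + k0)%:R = t - k%:R by rewrite natrD; ring.
Qed.

(** The shear of y and z amounts to projecting along [(1, tau, tau ^+ 2)]. A vertex and an edge lie
    in a plane with normal [nu]; if the projection direction is not in that plane, two of its points
    with the same image coincide. The shear of x afterwards separates consecutive vertices and does
    not touch y and z. *)
Lemma generic_position M X Y Z : cpoly M X Y Z ->
  exists (P : pt R -> pt R) X' Y' Z', [/\ iso P, cpoly M X' Y' Z',
    P @` polyset X Y Z = polyset X' Y' Z', star M Y' Z' & forall k, X' k != X' k.+1].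
Proof.
move=> Pl; have M0 := cpoly_gt0 Pl; have M1 : 1 <= M%:R :> R by rewrite ler1n.
have nex (kj : nat * nat) : exists n : pt R, let k := kj.1 in let j := kj.2 in
    [/\ n != 0, n.1.1 * (X j - X k) + n.1.2 * (Y j - Y k) + n.2 * (Z j - Z k) = 0
    & n.1.1 * (X j.+1 - X k) + n.1.2 * (Y j.+1 - Y k) + n.2 * (Z j.+1 - Z k) = 0].
  exact: exists_normal.
have [nu nuP] := choice nex.
have [|tau tauP] := @generic_root R [seq nu (k, j) | k <- iota 0 M, j <- iota 0 M].
  by move=> n /allpairsP[[k j] [_ _ ->]]; have [] := nuP (k, j).
pose Y1 k := Y k + (- tau) * X k; pose Z1 k := Z k + (- tau ^+ 2) * X k.
have st : star M Y1 Z1.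
  move=> k t t0 tk; rewrite !linD /Y1 /Z1 => EY EZ.
  have [l /andP[l1 l2]] := truncnP t0.
  have lI : l%:R <= t <= l.+1%:R by rewrite l1 ltW.
  have km : (k %% M < M)%N by rewrite ltn_mod. have lm : (l %% M < M)%N by rewrite ltn_mod.
  have := tauP (nu (k %% M, l %% M)%N); rewrite allpairs_f ?mem_iota // => /(_ isT).
  have [_ /=] := nuP (k %% M, l %% M)%N; move: (nu _) => [[n1 n2] n3] /=.
  have [[<- <- <-] _] := cpoly_mod k Pl; have [[<- <- <-] [<- <- <-]] := cpoly_mod l Pl.
  move=> N1 N2 nz; pose s := t - l%:R.
  have LE W : lin W t - W k = (1 - s) * (W l - W k) + s * (W l.+1 - W k).
    by rewrite (linE W lI) -/s; ring.
  have N0 : n1 * (lin X t - X k) + n2 * (lin Y t - Y k) + n3 * (lin Z t - Z k) = 0.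
    rewrite !LE; transitivity ((1 - s) * (n1 * (X l - X k) + n2 * (Y l - Y k) + n3 * (Z l - Z k)) +
      s * (n1 * (X l.+1 - X k) + n2 * (Y l.+1 - Y k) + n3 * (Z l.+1 - Z k))); first by ring.
    by rewrite N1 N2 !mulr0 addr0.
  have DY : lin Y t - Y k = tau * (lin X t - X k) by qlra.
  have DZ : lin Z t - Z k = tau ^+ 2 * (lin X t - X k) by qlra.
  have : (n1 + n2 * tau + n3 * tau ^+ 2) * (lin X t - X k) = 0.
    by rewrite -N0 DY DZ; ring.
  move/eqP; rewrite mulf_eq0 (negbTE nz) /= => /eqP DX.
  rewrite DX !mulr0 in DY DZ.
  by apply: (cpoly_inj Pl) => //; rewrite lin_nat; apply/subr0_eq.
(* On a degenerate edge the midpoint would project onto a vertex. *)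
have nz k : (X k.+1 - X k, Y1 k.+1 - Y1 k, Z1 k.+1 - Z1 k) != 0 :> pt R.
  apply/eqP => -[/subr0_eq EX /subr0_eq EY /subr0_eq EZ].
  have kI : k%:R <= (k%:R + 1 / 2 : R) <= k.+1%:R.
    by rewrite -[k.+1%:R]natr1; apply/andP; split; qlra.
  have k0 := ler0n R k.
  have h : k%:R + 1 / 2 - k%:R = 1 / 2 :> R by ring.
  have : k%:R + 1 / 2 = k%:R :> R.
    apply: st; rewrite ?h; [by qlra|by rewrite ger0_norm; qlra| |].
      by rewrite (linE Y1 kI) EY; ring.
    by rewrite (linE Z1 kI) EZ; ring.
  by qlra.
have [|rho rhoP] := @generic_root R [seq (X k.+1 - X k, Y1 k.+1 - Y1 k, Z1 k.+1 - Z1 k) | k <- iota 0 M].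
  by move=> n /mapP[k _ ->].
pose X1 k := (X k + rho * Y1 k) + rho ^+ 2 * Z1 k.
have X1E t : lin X1 t = lin X t + rho * lin Y1 t + rho ^+ 2 * lin Z1 t by rewrite !linD.
have Y1E t : lin Y1 t = lin Y t + (- tau) * lin X t by rewrite linD.
have Z1E t : lin Z1 t = lin Z t + (- tau ^+ 2) * lin X t by rewrite linD.
pose P1 (q : pt R) : pt R := (q.1.1, q.1.2 + (- tau) * q.1.1, q.2 + (- tau ^+ 2) * q.1.1).
pose P2 (q : pt R) : pt R := (q.1.1 + rho * q.1.2 + rho ^+ 2 * q.2, q.1.2, q.2).
have iP1 : iso P1.
  have i1 : iso (fun q : pt R => (q.1.1, q.1.2 + (- tau) * q.1.1, q.2)).
    by apply: (@iso_mono _ (fun q => q.1.2 + (- tau) * q.1.1) 1) => // [|x y y' z _]; [cts|rewrite /=; qlra].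
  have i2 : iso (fun q : pt R => (q.1.1, q.1.2, q.2 + (- tau ^+ 2) * q.1.1)).
    by apply: (@iso_mono_z _ (fun q => q.2 + (- tau ^+ 2) * q.1.1) 1) => // [|x y z z' _]; [cts|rewrite /=; qlra].
  exact: (iso_comp i1 i2).
have iP2 : iso P2.
  by apply: (@iso_mono_x _ (fun q => q.1.1 + rho * q.1.2 + rho ^+ 2 * q.2) 1) => // [|x x' y z _]; [cts|rewrite /=; qlra].
exists (fun q => P2 (P1 q)), X1, Y1, Z1; split=> //.
- exact: iso_comp.
- split=> //.
    by move=> k; have [E1 E2 E3] := cpoly_per Pl k; rewrite /X1 /Y1 /Z1 E1 E2 E3.
  move=> s t s0 t0 st'; rewrite !X1E => EX EY EZ.
  rewrite EY EZ in EX; have {}EX : lin X s = lin X t by qlra.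
  rewrite !Y1E EX in EY; rewrite !Z1E EX in EZ.
  by apply: (cpoly_inj Pl) => //; qlra.
- apply/seteqP; split=> [_ [_ [t t0 ->] <-]|_ [t t0 ->]].
    by exists t; rewrite // /P2 /P1 /= X1E !Y1E !Z1E.
  by exists (lin X t, lin Y t, lin Z t); [exists t | rewrite /P2 /P1 /= X1E !Y1E !Z1E].
- move=> k; apply/eqP => E.
  have km : (k %% M < M)%N by rewrite ltn_mod.
  have := rhoP _ (map_f _ (_ : k %% M \in iota 0 M)%N); rewrite mem_iota add0n km => /(_ isT) /=.
  rewrite /Y1 /Z1; have [[<- <- <-] [<- <- <-]] := cpoly_mod k Pl.
  move/negP; apply; apply/eqP; move: E; rewrite /X1 /Y1 /Z1; qlra.
Qed.

End Generic.

(** * Monotone runs of the polygon *)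

Section Tips.
Context {R : realType}.
Implicit Types X Y Z : nat -> R.

Lemma runs (s : nat -> bool) M : (0 < M)%N -> s 0%N ->
  exists N t, [/\ t 0%N = 0%N, t N.+1 = M, forall j, (j <= N)%N -> (t j < t j.+1)%N
    & forall j k, (j <= N)%N -> (t j <= k < t j.+1)%N -> s k = ~~ odd j].
Proof.
move=> M0 s0; elim: M M0 => [//|[|M] IH] _.
  by exists 0%N, id; split=> // -[|j] [|k].
have [//|N [t [t0 tN tS tr]]] := IH.
have [sE|sE] := eqVneq (s M.+1) (s M).
  exists N, (fun j => if (j <= N)%N then t j else M.+2); split=> //=; first by rewrite ltnn.
    move=> j jN; rewrite jN; case: ifP => [_|jN']; first exact: tS.
    have -> : j = N by lia.
    by have := tS N (leqnn N); rewrite tN; lia.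
  move=> j k jN; rewrite jN; case: ifP => [_|jN']; first exact: tr.
  have -> : j = N by lia.
  move=> /andP[k0 k1]; move: k1; rewrite ltnS leq_eqVlt => /orP[/eqP->|k1].
    rewrite sE; apply: tr => //; rewrite tN ltnSn andbT.
    by have := tS N (leqnn N); rewrite tN; lia.
  by apply: tr => //; rewrite tN k0.
exists N.+1, (fun j => if (j <= N.+1)%N then t j else M.+2); split=> //=; first by rewrite ltnn.
  move=> j jN; rewrite jN; case: ifP => [jN'|jN']; first exact: tS.
  have -> : j = N.+1 by lia.
  by rewrite tN; lia.
move=> j k jN; rewrite jN; case: ifP => [jN'|jN']; first exact: tr.
have -> : j = N.+1 by lia.
rewrite tN => kM; have -> : k = M.+1 by lia.
have := tr N M (leqnn N); rewrite tN ltnSn andbT => h.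
have {}h : s M = ~~ odd N by apply: h; have := tS N (leqnn N); rewrite tN; lia.
by move: sE; rewrite h /=; case: (s _); case: odd.
Qed.

(* The polygon is monotone in x between the consecutive vertices [t j]. *)
Record tips M X Y Z N (t : nat -> nat) : Prop := Tips {
  tips_poly : cpoly M X Y Z;
  tips_star : star M Y Z;
  tips_odd : odd N;
  tips_0 : t 0%N = 0%N;
  tips_last : t N.+1 = M;
  tips_lt : forall j, (j <= N)%N -> (t j < t j.+1)%N;
  tips_mono : forall j k, (j <= N)%N -> (t j <= k < t j.+1)%N ->
    0 < (-1) ^+ j * (X k.+1 - X k) }.

Lemma exists_min X M : exists2 k0, (k0 <= M)%N & forall k, (k <= M)%N -> X k0 <= X k.
Proof.
elim: M => [|M [k0 k0M k0P]]; first by exists 0%N => // -[].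
have [le|/ltW le] := le_or_lt (X k0) (X M.+1).
  exists k0 => [|k]; first exact: leqW.
  by rewrite leq_eqVlt => /orP[/eqP->//|/k0P].
exists M.+1 => // k; rewrite leq_eqVlt => /orP[/eqP->//|/k0P].
exact: le_trans.
Qed.

(** Starting at a vertex with the least x makes the first edge run to the right and the last one to
    the left, so the number [N.+1] of alternating runs is even. *)
Lemma get_tips M X Y Z : cpoly M X Y Z -> star M Y Z -> (forall k, X k != X k.+1) ->
  exists X' Y' Z' N t, tips M X' Y' Z' N t /\ polyset X' Y' Z' = polyset X Y Z.
Proof.
move=> Pl st ne; have M0 := cpoly_gt0 Pl.
have [k0 _ k0P] := exists_min X M.
have {}k0P k : X k0 <= X k.
  have [[-> _ _] _] := cpoly_mod k Pl; apply: k0P.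
  by rewrite ltnW // ltn_mod.
have [Pl' E] := cpoly_shift k0 Pl; have st' := @star_shift R M Y Z k0 st.
move: Pl' E st'; set X' := fun k => X (k + k0)%N; set Y' := fun k => Y (k + k0)%N.
set Z' := fun k => Z (k + k0)%N => Pl' E st'.
pose s k := X' k < X' k.+1.
have sN k : ~~ s k -> X' k.+1 < X' k.
  by rewrite -leNgt lt_neqAle eq_sym ne.
have s0 : s 0%N by rewrite /s lt_neqAle ne /X' add0n k0P.
have [N [t [t0 tN tS tr]]] := runs M0 s0.
exists X', Y', Z', N, t; split=> //; split=> //.
  have lastP : s M.-1 = ~~ odd N.
    by apply: tr => //; rewrite tN; have := tS N (leqnn N); rewrite tN; lia.
  apply/negPn; rewrite -lastP /s prednK // -leNgt.
  by have [-> _ _] := cpoly_per Pl' 0; rewrite /X' add0n k0P.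
move=> j k jN kt; have := tr j k jN kt; rewrite -signr_odd.
case: odd => /= sk; rewrite ?expr1 ?expr0 ?mulN1r ?mul1r ?opprB subr_gt0.
  by apply: sN; rewrite sk.
exact: sk.
Qed.

Lemma tips_le M X Y Z N t i j : tips M X Y Z N t -> (i <= j <= N.+1)%N -> (t i <= t j)%N.
Proof.
move=> T /andP[]; elim: j => [|j IH]; first by rewrite leqn0 => /eqP->.
rewrite leq_eqVlt => /orP[/eqP->//|ij] jN.
by apply: leq_trans (IH ij (ltnW jN)) _; apply: ltnW; exact: (tips_lt T).
Qed.

Lemma tips_ltS M X Y Z N t i j : tips M X Y Z N t -> (i < j <= N.+1)%N -> (t i < t j)%N.
Proof.
move=> T /andP[ij jN]; apply: leq_trans (_ : t i.+1 <= t j)%N.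
  by apply: (tips_lt T); lia.
by apply: (tips_le T); rewrite ij.
Qed.

Lemma tips_incr M X Y Z N t j u v : tips M X Y Z N t -> (j <= N)%N ->
  (t j)%:R <= u -> u < v -> v <= (t j.+1)%:R ->
  0 < (-1) ^+ j * (lin X v - lin X u).
Proof.
move=> T jN u0 uv v1; rewrite mulrBr subr_gt0.
have tj := tips_lt T jN.
apply: (@incr_glue _ (fun u => (-1) ^+ j * lin X u) (t j)%:R (t j.+1)%:R (t j) (t j.+1)) => //.
- by move=> ? ? ? ? ?; qlra.
- move=> k a b ktj ka ab bk; rewrite -subr_gt0 -mulrBr.
  have m := tips_mono T jN ktj.
  rewrite !(@linE _ X k); [|by apply/andP; split; qlra|by apply/andP; split; qlra].
  have -> : (1 - (b - k%:R)) * X k + (b - k%:R) * X k.+1 -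
    ((1 - (a - k%:R)) * X k + (a - k%:R) * X k.+1) = (b - a) * (X k.+1 - X k) by ring.
  by rewrite mulrCA mulr_gt0 // subr_gt0.
- by move=> ? ? ? ? ?; qlra.
- exact: ltnW.
Qed.

End Tips.

(** * Stretching the tips to the walls *)

Section Tents.
Context {R : realType}.
Implicit Types X Y Z : nat -> R.

Definition dist Y Z k u : R := Num.max `|lin Y u - Y k| `|lin Z u - Z k|.

Definition tent Y Z (r : R) k u : R := Num.max 0 (1 - dist Y Z k u / r).

Definition speed Y Z k : R := Num.max `|Y k.+1 - Y k| `|Z k.+1 - Z k|.

Lemma dist_cts Y Z k : continuous (dist Y Z k).
Proof. by have := @lin_cts R Y; have := @lin_cts R Z => ? ?; rewrite /dist; cts. Qed.

(** The parameters in question form one period without the two half edges at the vertex, a compact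
    interval on which [star] makes the distance positive. *)
Lemma tip_radius M X Y Z : cpoly M X Y Z -> star M Y Z -> exists2 r, 0 < r &
  forall k u, (k <= M)%N -> k%:R + 1 / 2 <= u <= k%:R + M%:R - 1 / 2 -> r <= dist Y Z k u.
Proof.
move=> Pl st.
have [k r r' r0 rr H u uI|k kM|r r0 rP] := @fin_delta R M (fun k r => forall u,
    k%:R + 1 / 2 <= u <= k%:R + M%:R - 1 / 2 -> r <= dist Y Z k u).
- exact: le_trans rr (H u uI).
- have [|r r0 rP] := pos_min (compact_itv (a := k%:R + 1 / 2) (b := k%:R + M%:R - 1 / 2))
    (@dist_cts Y Z k); last by exists r.
  move=> u /= /andP[u0 u1]; have k0 := ler0n R k.
    rewrite /dist lt_max !normr_gt0 !subr_eq0 -negb_and; apply/negP => /andP[/eqP EY /eqP EZ].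
    have := st k u _ _ EY EZ; rewrite ger0_norm; last by qlra.
    have h1 : 0 <= u by qlra. have h2 : u - k%:R < M%:R by qlra.
    by move=> /(_ h1 h2) E; move: u0; rewrite E; qlra.
- by exists r => // k u kM uI; exact: (rP k kM u uI).
Qed.

Lemma lin_per M X Y Z u : cpoly M X Y Z -> 0 <= u ->
  [/\ lin X (u + M%:R) = lin X u, lin Y (u + M%:R) = lin Y u & lin Z (u + M%:R) = lin Z u].
Proof.
move=> Pl u0; have per W : (forall k, W (k + M)%N = W k) -> lin W (u + M%:R) = lin W u.
  by move=> pW; rewrite -lin_shift // (_ : (fun k => _) = W) //; apply/funext.
by split; apply: per => k; have [] := cpoly_per Pl k.
Qed.

Lemma dist_after Y Z k u : k%:R <= u <= k.+1%:R -> dist Y Z k u = (u - k%:R) * speed Y Z k.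
Proof.
move=> uI; have /andP[u0 _] := uI; have h : 0 <= u - k%:R by rewrite subr_ge0.
have E W : lin W u - W k = (u - k%:R) * (W k.+1 - W k) by rewrite (linE W uI); ring.
by rewrite /dist !E !normrM (ger0_norm h) -maxr_pMr.
Qed.

Lemma dist_before Y Z k u : k%:R <= u <= k.+1%:R ->
  dist Y Z k.+1 u = (k.+1%:R - u) * speed Y Z k.
Proof.
move=> uI; have /andP[_ u0] := uI; have h : 0 <= k.+1%:R - u by rewrite subr_ge0.
have E W : lin W u - W k.+1 = - ((k.+1%:R - u) * (W k.+1 - W k)).
  by rewrite (linE W uI) -[k.+1%:R]natr1; ring.
by rewrite /dist !E !normrN !normrM (ger0_norm h) -maxr_pMr.
Qed.

(* [r] is so small that the tent of a vertex only meets the two half edges at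
   this vertex. *)
Record tented M X Y Z N (t : nat -> nat) (w : nat -> R) (r : R) : Prop := Tented {
  tented_tips : tips M X Y Z N t;
  tented_gt0 : 0 < r;
  tented_far : forall k u, (k <= M)%N -> k%:R + 1 / 2 <= u <= k%:R + M%:R - 1 / 2 ->
    r <= dist Y Z k u;
  tented_close : w N.+1 = w 0%N;
  tented_wall : forall j, (j <= N.+1)%N -> (-1) ^+ j * (w j - X (t j)) < 0 }.

Section Moved.
Variables (M : nat) (X Y Z : nat -> R) (N : nat) (t : nat -> nat) (w : nat -> R) (r : R).

Definition rise j := w j - X (t j).

(** The new x-coordinate: a function of y and z is added to x, hence an isotopy irrespective of how
    the tents overlap in the plane. *)
Definition moved u := lin X u + \sum_(j < N.+1) rise j * tent Y Z r (t j) u.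
End Moved.

Lemma tent_ge0 Y Z (r : R) k u : 0 <= tent Y Z r k u.
Proof. by rewrite le_max lexx. Qed.

Lemma tent_far M X Y Z N t w r k u : tented M X Y Z N t w r -> (k <= M)%N ->
  k%:R + 1 / 2 <= u <= k%:R + M%:R - 1 / 2 -> tent Y Z r k u = 0.
Proof.
move=> T kM uI; have h := tented_far T kM uI; have r0 := tented_gt0 T.
by rewrite /tent max_l // subr_le0 ler_pdivlMr // mul1r.
Qed.

Lemma sum_two n (F : nat -> R) a b : (a < n)%N -> (b < n)%N -> a <> b ->
  (forall j, (j < n)%N -> j <> a -> j <> b -> F j = 0) -> \sum_(j < n) F j = F a + F b.
Proof.
move=> an bn ab F0; rewrite (bigD1 (Ordinal an)) //= (bigD1 (Ordinal bn)) /=; last first.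
  by apply/eqP => /(congr1 val) /= E; exact/ab/esym.
rewrite big1 ?addr0 // => j /andP[ja jb]; apply: F0 => // E.
  by move/eqP: ja; apply; apply: val_inj.
by move/eqP: jb; apply; apply: val_inj.
Qed.

(** For any other tip the parameter, increased by a period if the tip comes later, lies in the range
    where [tented_far] makes the tent vanish. *)
Lemma moved_strand M X Y Z N t w r i u : tented M X Y Z N t w r -> (i <= N)%N ->
  (t i)%:R <= u <= (t i.+1)%:R -> moved X Y Z N t w r u =
  lin X u + rise X t w i * tent Y Z r (t i) u + rise X t w i.+1 * tent Y Z r (t i.+1) u.
Proof.
move=> T iN /andP[u0 u1]; have tp := tented_tips T; have Pl := tips_poly tp.
have tM j : (j <= N)%N -> (t j + 1 <= M)%N.
  by move=> jN; rewrite addn1 -(tips_last tp); apply: (tips_ltS tp); lia.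
have leR (a b : nat) : (a + 1 <= b)%N -> a%:R + 1 <= b%:R :> R by rewrite natr1 ler_nat addn1.
have M1 := leR _ _ (tM 0%N isT); rewrite (tips_0 tp) in M1.
have tge0 j : 0 <= (t j)%:R :> R := ler0n R (t j).
have up : 0 <= u := le_trans (tge0 i) u0.
have zero j : (j <= N)%N -> j <> i -> j <> i.+1 -> (i = N -> j <> 0%N) -> tent Y Z r (t j) u = 0.
  move=> jN ji ji1 j0; have tjM := leR _ _ (tM j jN); have tj0 := tge0 j.
  have [ij|ji'] := ltnP i j.
    have tij : (t i.+1 + 1 <= t j)%N by rewrite addn1; apply: (tips_ltS tp); lia.
    have := leR _ _ tij => h.
    have [_ EY EZ] := lin_per Pl up.
    have := tent_far (u := u + M%:R) T (ltnW (etrans (esym (congr1 (leq^~ _) (addn1 _))) (tM j jN))).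
    rewrite /tent /dist EY EZ; apply; apply/andP; split; qlra.
  have tij : (t j + 1 <= t i)%N by rewrite addn1; apply: (tips_ltS tp); lia.
  have h := leR _ _ tij.
  apply: (tent_far T); first by have := tM j jN; lia.
  apply/andP; split; first by qlra.
  have [iE|iE] := eqVneq i N.
    have j1 : (t 0%N + 1 <= t j)%N by rewrite addn1; apply: (tips_ltS tp); have := j0 iE; lia.
    have h2 := leR _ _ j1; rewrite (tips_0 tp) in h2.
    by rewrite iE (tips_last tp) in u1; qlra.
  have h3 := leR _ _ (tM i.+1 _); rewrite ltn_neqAle iE iN in h3.
  by have := h3 isT; qlra.
rewrite /moved -[RHS]addrA; congr (lin X u + _).
have [iE|iE] := eqVneq i N.
  subst i.
  (* The last strand ends at the vertex at which the first one starts; the sum contains its tent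
     under the index 0. *)
  have -> : rise X t w N.+1 * tent Y Z r (t N.+1) u = rise X t w 0 * tent Y Z r (t 0%N) u.
    have [EX EY EZ] := cpoly_per Pl 0; rewrite add0n in EX EY EZ.
    by rewrite /rise /tent /dist (tented_close T) (tips_last tp) (tips_0 tp) EX EY EZ.
  apply: (@sum_two _ (fun j => rise X t w j * tent Y Z r (t j) u)) => //.
    by move=> N0; have := tips_odd tp; rewrite N0.
  by move=> j jN jN' j0; rewrite zero ?mulr0 //; lia.
apply: (@sum_two _ (fun j => rise X t w j * tent Y Z r (t j) u)); try lia.
by move=> j jN ji ji1; rewrite zero ?mulr0 //; move/eqP: iE.
Qed.

Lemma strand_len M X Y Z N t i : tips M X Y Z N t -> (i <= N)%N ->
  (t i.+1 + 1 <= t i + M)%N.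
Proof.
move=> tp iN; have [i0|i0] := posnP i.
  have N0 := odd_gt0 (tips_odd tp).
  have := @tips_ltS _ _ _ _ _ _ _ 1 N.+1 tp; rewrite i0 (tips_0 tp) (tips_last tp).
  by rewrite addn1 add0n; apply; lia.
rewrite addnC; apply: leq_add.
  by rewrite -(tips_0 tp); apply: (tips_ltS tp); lia.
by rewrite -(tips_last tp); apply: (tips_le tp); lia.
Qed.

Lemma tent_per M X Y Z N t w r k u : tented M X Y Z N t w r -> 0 <= u ->
  tent Y Z r k (u + M%:R) = tent Y Z r k u.
Proof.
move=> T u0; have [_ EY EZ] := lin_per (tips_poly (tented_tips T)) u0.
by rewrite /tent /dist EY EZ.
Qed.

Lemma tent_mono Y Z (r : R) k l u v : 0 < r -> dist Y Z k v <= dist Y Z l u ->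
  tent Y Z r l u <= tent Y Z r k v.
Proof.
move=> r0 d; have : dist Y Z k v / r <= dist Y Z l u / r by rewrite ler_pM2r ?invr_gt0.
by rewrite /tent; move: (_ / r) (_ / r) => A B; clear; mm.
Qed.

Lemma tent_off M X Y Z N t w r i u : tented M X Y Z N t w r -> (i <= N)%N ->
  (t i)%:R <= u <= (t i.+1)%:R ->
  ((t i)%:R + 1 / 2 <= u -> tent Y Z r (t i) u = 0) /\
  (u <= (t i.+1)%:R - 1 / 2 -> tent Y Z r (t i.+1) u = 0).
Proof.
move=> T iN /andP[u0 u1]; have tp := tented_tips T.
have tiM j : (j <= N.+1)%N -> (t j <= M)%N.
  by move=> jN; rewrite -(tips_last tp); apply: (tips_le tp); rewrite jN leqnn.
have up : 0 <= u := le_trans (ler0n R (t i)) u0.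
have len : (t i.+1)%:R + 1 <= (t i)%:R + M%:R :> R.
  by rewrite natr1 -natrD ler_nat -addn1; exact: strand_len tp iN.
split=> h.
  by apply: (tent_far T); [apply: tiM; lia | apply/andP; split; qlra].
rewrite -(tent_per _ T up); apply: (tent_far T); first by apply: tiM; lia.
by apply/andP; split; qlra.
Qed.

Lemma speed_ge0 Y Z k : 0 <= speed Y Z k.
Proof. by rewrite le_max normr_ge0. Qed.

Lemma tent_noninc M X Y Z N t w r i u v : tented M X Y Z N t w r -> (i <= N)%N ->
  (t i)%:R <= u -> u <= v -> v <= (t i.+1)%:R -> tent Y Z r (t i) v <= tent Y Z r (t i) u.
Proof.
move=> T iN u0 uv v1; have tp := tented_tips T; have r0 := tented_gt0 T.
have [|off _] := @tent_off _ _ _ _ _ _ _ _ i v T iN; first by rewrite v1 (le_trans u0).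
have [h|h] := le_or_lt ((t i)%:R + 1 / 2) v; first by rewrite off // tent_ge0.
apply: tent_mono => //; rewrite !dist_after ?ler_wpM2r ?speed_ge0 ?lerD2r //.
  by rewrite -[(t i).+1%:R]natr1; apply/andP; split; qlra.
by rewrite -[(t i).+1%:R]natr1; apply/andP; split; qlra.
Qed.

Lemma tent_nondec M X Y Z N t w r i u v : tented M X Y Z N t w r -> (i <= N)%N ->
  (t i)%:R <= u -> u <= v -> v <= (t i.+1)%:R ->
  tent Y Z r (t i.+1) u <= tent Y Z r (t i.+1) v.
Proof.
move=> T iN u0 uv v1; have tp := tented_tips T; have r0 := tented_gt0 T.
have [|_ off] := @tent_off _ _ _ _ _ _ _ _ i u T iN; first by rewrite u0 (le_trans uv).
have [h|h] := le_or_lt u ((t i.+1)%:R - 1 / 2); first by rewrite off // tent_ge0.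
have ti : (0 < t i.+1)%N by apply: leq_trans (tips_lt tp iN).
move: h v1; rewrite -(prednK ti); move: (t i.+1).-1 => k h v1.
apply: tent_mono => //; rewrite !dist_before ?ler_wpM2r ?speed_ge0 ?lerD2l ?lerN2 //.
  by rewrite -[k.+1%:R]natr1 in h v1 *; apply/andP; split; qlra.
by rewrite -[k.+1%:R]natr1 in h v1 *; apply/andP; split; qlra.
Qed.

Lemma rise_sign M X Y Z N t w r i : tented M X Y Z N t w r -> (i <= N)%N ->
  (-1) ^+ i * rise X t w i < 0 /\ 0 < (-1) ^+ i * rise X t w i.+1.
Proof.
move=> T iN; split; first by apply: (tented_wall T); exact: leqW.
by have := tented_wall T (iN : (i.+1 <= N.+1)%N); rewrite exprS mulN1r mulNr oppr_lt0.
Qed.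

(** All three terms go in the direction of the strand: the tent at its start decreases and has a
    rise against that direction, the tent at its end increases and has a rise along it. *)
Lemma moved_mono M X Y Z N t w r i u v : tented M X Y Z N t w r -> (i <= N)%N ->
  (t i)%:R <= u -> u < v -> v <= (t i.+1)%:R ->
  0 < (-1) ^+ i * (moved X Y Z N t w r v - moved X Y Z N t w r u).
Proof.
move=> T iN u0 uv v1; have tp := tented_tips T.
have [s1 s2] := rise_sign T iN.
rewrite !(moved_strand T iN); [|by rewrite u0 (le_trans (ltW uv))|by rewrite v1 (le_trans u0 (ltW uv))].
have h1 := tips_incr tp iN u0 uv v1.
have h2 := tent_noninc T iN u0 (ltW uv) v1.
have h3 := tent_nondec T iN u0 (ltW uv) v1.
move: ((-1) ^+ i) s1 s2 h1 h2 h3 => e s1 s2 h1 h2 h3.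
have m1 : 0 <= (e * rise X t w i) * (tent Y Z r (t i) v - tent Y Z r (t i) u).
  by apply: mulr_le0; rewrite ?subr_le0 // ltW.
have m2 : 0 <= (e * rise X t w i.+1) * (tent Y Z r (t i.+1) v - tent Y Z r (t i.+1) u).
  by apply: mulr_ge0; rewrite ?subr_ge0 // ltW.
by qlra.
Qed.

Lemma moved_tip M X Y Z N t w r i : tented M X Y Z N t w r -> (i <= N.+1)%N ->
  moved X Y Z N t w r (t i)%:R = w i.
Proof.
move=> T iN; have tp := tented_tips T; have r0 := tented_gt0 T.
have self j : tent Y Z r (t j) (t j)%:R = 1.
  by rewrite /tent /dist !lin_nat !subrr normr0 maxxx mul0r subr0 max_r ?ler01.
have tt j : (j <= N)%N -> (t j)%:R + 1 <= (t j.+1)%:R :> R.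
  by move=> jN; rewrite natr1 ler_nat; have := tips_lt tp jN.
case: i iN => [_|i iN].
  rewrite (@moved_strand _ _ _ _ _ _ _ _ 0 _ T) //; last first.
    by rewrite lexx ler_nat (tips_le tp).
  have [|_ ->] := @tent_off _ _ _ _ _ _ _ _ 0 (t 0%N)%:R T isT.
  - by rewrite lexx ler_nat (tips_le tp).
  - by rewrite self lin_nat /rise mulr1 mulr0 addr0 subrKC.
  - by have := tt 0%N isT; qlra.
rewrite ltnS in iN; rewrite (moved_strand T iN); last by rewrite lexx andbT ler_nat (tips_le tp) // leqnSn.
have [|off _] := @tent_off _ _ _ _ _ _ _ _ i (t i.+1)%:R T iN.
  by rewrite lexx andbT ler_nat (tips_le tp) // leqnSn.
rewrite off; first by rewrite self lin_nat /rise mulr1 mulr0 addr0 subrKC.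
by have := tt i iN; qlra.
Qed.

End Tents.

Section Strands.
Context {R : realType}.
Implicit Types X Y Z : nat -> R.

Lemma alternateP i : (-1) ^+ i = 1 :> R \/ (-1) ^+ i = -1 :> R.
Proof. by rewrite -signr_odd; case: odd; [right|left]. Qed.

Lemma strand_sign (w : nat -> R) i x : 0 < (-1) ^+ i * (w i.+1 - w i) ->
  strand w i x = ((-1) ^+ i * w i <= (-1) ^+ i * x <= (-1) ^+ i * w i.+1).
Proof.
rewrite /strand /between; case: (alternateP i) => ->; rewrite ?mul1r ?mulN1r => h.
  by rewrite orb_idr // => /andP[? ?]; apply/andP; split; qlra.
rewrite !lerN2 [RHS]andbC orb_idl // => /andP[? ?]; apply/andP; split; qlra.
Qed.

Lemma wall_order M X Y Z N t w r i : tented M X Y Z N t w r -> (i <= N)%N ->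
  0 < (-1) ^+ i * (w i.+1 - w i).
Proof.
move=> T iN; have tp := tented_tips T.
rewrite -(moved_tip T (iN : (i.+1 <= N.+1)%N)) -(moved_tip T (leqW iN)).
apply: (moved_mono T iN); [exact: lexx| |exact: lexx].
by rewrite ltr_nat; exact: (tips_lt tp).
Qed.

Lemma moved_cts M X Y Z N t w r : tented M X Y Z N t w r -> continuous (moved X Y Z N t w r).
Proof.
move=> T; have c1 := @lin_cts R X; have c2 := @dist_cts R Y Z.
have cs n : continuous (fun u => \sum_(j < n) rise X t w j * tent Y Z r (t j) u).
  elim: n => [|n IH].
    by rewrite (_ : (fun u => _) = fun=> 0); [cts | apply/funext => u; rewrite big_ord0].
  rewrite (_ : (fun u => _) = fun u => \sum_(j < n) rise X t w j * tent Y Z r (t j) u +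
      rise X t w n * tent Y Z r (t n) u); last by apply/funext => u; rewrite big_ord_recr.
  by have c3 := c2 (t n); rewrite /tent; cts.
by have := cs N.+1 => c4; rewrite /moved; cts.
Qed.

Lemma strand_inverse M X Y Z N t w r i : tented M X Y Z N t w r -> (i <= N)%N ->
  exists g : R -> R, [/\ continuous g,
    forall u, (t i)%:R <= u <= (t i.+1)%:R -> g (moved X Y Z N t w r u) = u
  & forall x, strand w i x -> (t i)%:R <= g x <= (t i.+1)%:R /\ moved X Y Z N t w r (g x) = x].
Proof.
move=> T iN; have tp := tented_tips T.
have cm := moved_cts T; have ord := wall_order T iN.
have tt : (t i)%:R <= (t i.+1)%:R :> R by rewrite ler_nat ltnW // (tips_lt tp).
have [||g [cg gK gI gE]] := @inverse_incr R (fun u => (-1) ^+ i * moved X Y Z N t w r u) _ _ tt.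
- by cts.
- by move=> u v u0 uv v1; rewrite -subr_gt0 -mulrBr; exact: (moved_mono T iN).
have ee x : (-1) ^+ i * ((-1) ^+ i * x) = x :> R by rewrite mulrA -expr2 sqrr_sign mul1r.
exists (fun x => g ((-1) ^+ i * x)); split.
- by cts.
- exact: gK.
- move=> x; rewrite (strand_sign _ ord) => xI; split; first exact: gI.
  rewrite -[LHS]ee gE ?ee //.
  by rewrite (moved_tip T (leqW iN)) (moved_tip T (iN : (i.+1 <= N.+1)%N)).
Qed.

(** Close to the tip both [lin X] and its tent are affine in the parameter, so [moved] is affine
    with slope [sg] and its inverse is affine too; this makes the strands straight near the
    walls. *)
Lemma inverse_after M X Y Z N t w r i (g : R -> R) : tented M X Y Z N t w r -> (i <= N)%N ->
  (forall u, (t i)%:R <= u <= (t i.+1)%:R -> g (moved X Y Z N t w r u) = u) ->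
  exists c d, 0 < d /\ forall x, strand w i x -> `|x - w i| <= d ->
    g x = (t i)%:R + `|x - w i| * c /\ 0 <= `|x - w i| * c <= 1.
Proof.
move=> T iN gK; have tp := tented_tips T; have r0 := tented_gt0 T.
have [s1 _] := rise_sign T iN; have ord := wall_order T iN; have tl := tips_lt tp iN.
set k := t i in gK *; set mu := speed Y Z k.
have kI : (t i <= k < t i.+1)%N by rewrite leqnn.
have dX := tips_mono tp iN kI; have mu0 : 0 <= mu := speed_ge0 Y Z k.
have kk : k%:R + 1 <= (t i.+1)%:R :> R by rewrite natr1 ler_nat.
pose sg := X k.+1 - X k - rise X t w i * mu / r.
have sg0 : 0 < (-1) ^+ i * sg.
  have : 0 <= (- ((-1) ^+ i * rise X t w i)) * (mu / r) by rewrite mulr_ge0 ?divr_ge0 ?(ltW r0) //; qlra.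
  rewrite /sg; have -> : (-1) ^+ i * (X k.+1 - X k - rise X t w i * mu / r) =
    (-1) ^+ i * (X k.+1 - X k) + - ((-1) ^+ i * rise X t w i) * (mu / r) by ring.
  by qlra.
(* Up to 1/2 the tent of the other end is absent; the second bound keeps the point above the foot of
   its own tent, also when [mu] is 0. *)
pose h := Num.min (1 / 2) (r / (mu + 1)).
have mu1 : 0 < mu + 1 by qlra.
have h0 : 0 < h by rewrite lt_min !divr_gt0.
have h2 : h <= 1 / 2 by rewrite ge_min lexx.
have hr : h * mu <= r.
  apply: le_trans (_ : h * (mu + 1) <= _); first by rewrite ler_pM2l //; qlra.
  by rewrite -ler_pdivlMr // ge_min lexx orbT.
have mv s : 0 <= s <= h -> moved X Y Z N t w r (k%:R + s) = w i + s * sg.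
  move=> /andP[s0 sh]; have uI : (t i)%:R <= k%:R + s <= (t i.+1)%:R.
    by rewrite -/k; apply/andP; split; qlra.
  have uI' : k%:R <= k%:R + s <= k.+1%:R by rewrite -[k.+1%:R]natr1; apply/andP; split; qlra.
  rewrite (moved_strand T iN uI); have [_ ->] := tent_off T iN uI; last by qlra.
  have smu : s * mu <= r by apply: le_trans hr; rewrite ler_wpM2r.
  have -> : tent Y Z r (t i) (k%:R + s) = 1 - s * mu / r.
    rewrite /tent (dist_after Y Z uI') -/mu addrAC subrr add0r max_r //.
    by rewrite subr_ge0 ler_pdivrMr // mul1r.
  rewrite (linE X uI') /sg /rise -/k; field.
  by rewrite gt_eqF.
exists ((-1) ^+ i * sg)^-1, (h * ((-1) ^+ i * sg)); split; first by rewrite mulr_gt0.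
move=> x sx xd; pose s := `|x - w i| * ((-1) ^+ i * sg)^-1.
have s01 : 0 <= s <= h.
  by rewrite /s mulr_ge0 ?invr_ge0 ?(ltW sg0) //= ler_pdivrMr.
have xE : w i + s * sg = x.
  have xw : `|x - w i| = (-1) ^+ i * (x - w i).
    move: sx; rewrite (strand_sign _ ord) -subr_ge0 -mulrBr => /andP[h3 _].
    by rewrite -{1}(ger0_norm h3) normrM normrX normrN1 expr1n mul1r.
  rewrite /s xw invfM; have nz : sg != 0.
    by apply: contraTneq sg0 => ->; rewrite mulr0 ltxx.
  case: (alternateP i) => ->; rewrite ?invr1 ?invrN1 ?mul1r ?mulN1r.
    by rewrite divfK // subrKC.
  by field.
have /andP[s0 sh] := s01.
split; last by apply/andP; split; rewrite -/s; qlra.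
rewrite -{1}xE -(mv _ s01) gK //; apply/andP; split; rewrite -/k; qlra.
Qed.

Lemma inverse_before M X Y Z N t w r i (g : R -> R) : tented M X Y Z N t w r -> (i <= N)%N ->
  (forall u, (t i)%:R <= u <= (t i.+1)%:R -> g (moved X Y Z N t w r u) = u) ->
  exists c d, 0 < d /\ forall x, strand w i x -> `|x - w i.+1| <= d ->
    g x = (t i.+1)%:R - `|x - w i.+1| * c /\ 0 <= `|x - w i.+1| * c <= 1.
Proof.
move=> T iN gK; have tp := tented_tips T; have r0 := tented_gt0 T.
have [_ s1] := rise_sign T iN; have ord := wall_order T iN; have tl := tips_lt tp iN.
have [k kE] : {k | t i.+1 = k.+1} by exists (t i.+1).-1; rewrite prednK //; lia.
rewrite kE in gK tl *; set mu := speed Y Z k.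
have kI : (t i <= k < t i.+1)%N by rewrite kE ltnSn andbT -ltnS.
have dX := tips_mono tp iN kI; have mu0 : 0 <= mu := speed_ge0 Y Z k.
have kk : (t i)%:R <= k%:R :> R by rewrite ler_nat -ltnS.
have k1 : k.+1%:R = k%:R + 1 :> R by rewrite natr1.
pose sg := X k.+1 - X k + rise X t w i.+1 * mu / r.
have sg0 : 0 < (-1) ^+ i * sg.
  have : 0 <= ((-1) ^+ i * rise X t w i.+1) * (mu / r) by rewrite mulr_ge0 ?divr_ge0 ?(ltW r0) //; qlra.
  rewrite /sg; have -> : (-1) ^+ i * (X k.+1 - X k + rise X t w i.+1 * mu / r) =
    (-1) ^+ i * (X k.+1 - X k) + ((-1) ^+ i * rise X t w i.+1) * (mu / r) by ring.
  by qlra.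
pose h := Num.min (1 / 2) (r / (mu + 1)).
have mu1 : 0 < mu + 1 by qlra.
have h0 : 0 < h by rewrite lt_min !divr_gt0.
have h2 : h <= 1 / 2 by rewrite ge_min lexx.
have hr : h * mu <= r.
  apply: le_trans (_ : h * (mu + 1) <= _); first by rewrite ler_pM2l //; qlra.
  by rewrite -ler_pdivlMr // ge_min lexx orbT.
have mv s : 0 <= s <= h -> moved X Y Z N t w r (k.+1%:R - s) = w i.+1 - s * sg.
  move=> /andP[s0 sh]; have uI : (t i)%:R <= k.+1%:R - s <= (t i.+1)%:R.
    by rewrite kE k1; apply/andP; split; qlra.
  have uI' : k%:R <= k.+1%:R - s <= k.+1%:R by rewrite k1; apply/andP; split; qlra.
  rewrite (moved_strand T iN uI); have [off _] := tent_off T iN uI.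
  rewrite off {off}; last by rewrite k1; qlra.
  have smu : s * mu <= r by apply: le_trans hr; rewrite ler_wpM2r.
  have -> : tent Y Z r (t i.+1) (k.+1%:R - s) = 1 - s * mu / r.
    rewrite /tent kE (dist_before Y Z uI') -/mu subKr max_r //.
    by rewrite subr_ge0 ler_pdivrMr // mul1r.
  rewrite (linE X uI') /sg /rise kE k1; field.
  by rewrite gt_eqF.
exists ((-1) ^+ i * sg)^-1, (h * ((-1) ^+ i * sg)); split; first by rewrite mulr_gt0.
move=> x sx xd; pose s := `|x - w i.+1| * ((-1) ^+ i * sg)^-1.
have s01 : 0 <= s <= h.
  by rewrite /s mulr_ge0 ?invr_ge0 ?(ltW sg0) //= ler_pdivrMr.
have xE : w i.+1 - s * sg = x.
  have xw : `|x - w i.+1| = (-1) ^+ i * (w i.+1 - x).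
    move: sx; rewrite (strand_sign _ ord) => /andP[_]; rewrite -subr_ge0 -mulrBr => h3.
    by rewrite -{1}(ger0_norm h3) normrM normrX normrN1 expr1n mul1r distrC.
  rewrite /s xw invfM; have nz : sg != 0.
    by apply: contraTneq sg0 => ->; rewrite mulr0 ltxx.
  case: (alternateP i) => ->; rewrite ?invr1 ?invrN1 ?mul1r ?mulN1r.
    by rewrite divfK // subKr.
  by field.
have /andP[s0 sh] := s01.
split; last by apply/andP; split; rewrite -/s; qlra.
rewrite -{1}xE -(mv _ s01) gK //; apply/andP; split; rewrite ?k1; qlra.
Qed.

End Strands.

(** * The zigzag of strands over x *)

Section Zigzags.
Context {R : realType}.
Implicit Types X Y Z : nat -> R.

(** As in [combed] before any strand is straight, except that at the wall [w j] the strands part in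
    an arbitrary direction [(D j, E j)] of the (y,z)-plane. *)
Record zigzag (N : nat) (w : nat -> R) (Y Z : nat -> R -> R) (D E : nat -> R) (d : R)
    : Prop := Zigzag {
  zz_ctsY : forall i, continuous (Y i);
  zz_ctsZ : forall i, continuous (Z i);
  zz_disj : forall i j x, (i < j <= N)%N -> strand w i x -> strand w j x ->
    Y i x = Y j x -> Z i x = Z j x ->
    j = i.+1 /\ x = w j \/ [/\ i = 0%N, j = N & x = w 0%N];
  zz_cone : forall j x, (j < N)%N -> strand w j x -> strand w j.+1 x ->
    `|x - w j.+1| <= d -> Y j.+1 x = Y j x + `|x - w j.+1| * D j.+1 /\
                          Z j.+1 x = Z j x + `|x - w j.+1| * E j.+1;
  zz_cone0 : forall x, strand w 0 x -> strand w N x -> `|x - w 0%N| <= d ->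
    Y 0%N x = Y N x + `|x - w 0%N| * D 0%N /\ Z 0%N x = Z N x + `|x - w 0%N| * E 0%N;
  zz_d : 0 < d <= 1 }.

Lemma cpoly_bounded M X Y Z u : cpoly M X Y Z -> 0 <= u -> exists2 v, 0 <= v < M%:R &
  [/\ lin X u = lin X v, lin Y u = lin Y v & lin Z u = lin Z v].
Proof.
move=> Pl u0; have M0 := cpoly_gt0 Pl; have M1 : 1 <= M%:R :> R by rewrite ler1n.
have : u < ((Num.truncn u).+1 * M)%:R.
  have /andP[_ h] := Num.Theory.truncn_itv u0; apply: lt_le_trans h _.
  by rewrite ler_nat leq_pmulr.
move: (Num.truncn u).+1 => n.
elim: n u u0 => [|n IH] u u0; first by rewrite mul0n; qlra.
rewrite mulSn natrD => un; have [uM|Mu] := ltP u M%:R; first by exists u; rewrite ?u0.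
have [||v vI [E1 E2 E3]] := IH (u - M%:R); [by qlra|by qlra|].
exists v => //; rewrite -E1 -E2 -E3.
have [|F1 F2 F3] := lin_per (u := u - M%:R) Pl; first by qlra.
by rewrite -F1 -F2 -F3 subrK.
Qed.

Lemma find_strand M X Y Z N t (u : R) : tips M X Y Z N t -> 0 <= u <= M%:R ->
  exists2 i, (i <= N)%N & (t i)%:R <= u <= (t i.+1)%:R.
Proof.
move=> tp /andP[u0 uM].
have H n : (n <= N)%N -> u <= (t n.+1)%:R ->
    exists2 i, (i <= N)%N & (t i)%:R <= u <= (t i.+1)%:R.
  elim: n => [|n IH] nN un; first by exists 0%N => //; rewrite (tips_0 tp) u0.
  have [le|/ltW le] := le_or_lt u (t n.+1)%:R; first by apply: IH => //; exact: ltnW.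
  by exists n.+1 => //; rewrite le.
by apply: (H N) => //; rewrite (tips_last tp).
Qed.

Lemma strand_moved M X Y Z N t w r i u : tented M X Y Z N t w r -> (i <= N)%N ->
  (t i)%:R <= u <= (t i.+1)%:R -> strand w i (moved X Y Z N t w r u).
Proof.
move=> T iN /andP[u0 u1]; rewrite (strand_sign _ (wall_order T iN)).
rewrite -(moved_tip T (iN : (i.+1 <= N.+1)%N)) -(moved_tip T (leqW iN)).
rewrite -![_ * _ <= _]subr_ge0 -!mulrBr; apply/andP; split.
  move: u0; rewrite le_eqVlt => /orP[/eqP<-|u0]; first by rewrite subrr mulr0.
  by apply/ltW/(moved_mono T iN).
move: u1; rewrite le_eqVlt => /orP[/eqP->|u1]; first by rewrite subrr mulr0.
by apply/ltW/(moved_mono T iN).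
Qed.

Lemma cts_tents Y Z N (t : nat -> nat) (a : nat -> R) (r : R) : continuous (fun q : R * R =>
  \sum_(j < N) a j * Num.max 0 (1 - Num.max `|q.1 - Y (t j)| `|q.2 - Z (t j)| / r)).
Proof.
elim: N => [|n IH].
  by rewrite (_ : (fun q => _) = fun=> 0); [exact: ctsC | apply/funext => u; rewrite big_ord0].
rewrite (_ : (fun q => _) = fun q => \sum_(j < n) a j *
  Num.max 0 (1 - Num.max `|q.1 - Y (t j)| `|q.2 - Z (t j)| / r) +
  a n * Num.max 0 (1 - Num.max `|q.1 - Y (t n)| `|q.2 - Z (t n)| / r)).
  by move: (Y (t n)) (Z (t n)) (a n) => y z b; cts.
by apply/funext => u; rewrite big_ord_recr.
Qed.

Lemma tented_zigzag M X Y Z N t w r : tented M X Y Z N t w r ->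
  exists (P : pt R -> pt R) Yf Zf D E d, [/\ iso P, zigzag N w Yf Zf D E d
    & P @` polyset X Y Z = zset N w Yf Zf].
Proof.
move=> T; have tp := tented_tips T; have Pl := tips_poly tp.
have gex i : exists g : R -> R, continuous g /\ ((i <= N)%N ->
    (forall u, (t i)%:R <= u <= (t i.+1)%:R -> g (moved X Y Z N t w r u) = u) /\
    (forall x, strand w i x -> (t i)%:R <= g x <= (t i.+1)%:R /\ moved X Y Z N t w r (g x) = x)).
  have [iN|iN] := leqP i N; last by exists (fun=> 0); split; [exact: ctsC|].
  by have [g [cg gK gS]] := strand_inverse T iN; exists g.
have [g gP] := choice gex.
have cg i : continuous (g i) by have [] := gP i.
have gK i u : (i <= N)%N -> (t i)%:R <= u <= (t i.+1)%:R -> g i (moved X Y Z N t w r u) = u.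
  by move=> iN; have [_ /(_ iN)[h _]] := gP i; exact: h.
have gS i x : (i <= N)%N -> strand w i x -> (t i)%:R <= g i x <= (t i.+1)%:R /\
    moved X Y Z N t w r (g i x) = x.
  by move=> iN; have [_ /(_ iN)[_ h]] := gP i; exact: h.
pose Yf i x := lin Y (g i x); pose Zf i x := lin Z (g i x).
have aex i : exists cd : R * R, (i <= N)%N -> 0 < cd.2 /\ forall x, strand w i x ->
    `|x - w i| <= cd.2 -> g i x = (t i)%:R + `|x - w i| * cd.1 /\ 0 <= `|x - w i| * cd.1 <= 1.
  have [iN|iN] := leqP i N; last by exists 0.
  have [c [d cd]] := inverse_after T iN (fun u => gK i u iN).
  by exists (c, d).
have bex i : exists cd : R * R, (i <= N)%N -> 0 < cd.2 /\ forall x, strand w i x ->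
    `|x - w i.+1| <= cd.2 -> g i x = (t i.+1)%:R - `|x - w i.+1| * cd.1 /\ 0 <= `|x - w i.+1| * cd.1 <= 1.
  have [iN|iN] := leqP i N; last by exists 0.
  have [c [d cd]] := inverse_before T iN (fun u => gK i u iN).
  by exists (c, d).
have [ca caP] := choice aex; have [cb cbP] := choice bex.
have [j d d' d'0 dd H jN|j jN|d0 d00 dP] := @fin_delta R N (fun i d => (i <= N)%N ->
    d <= (ca i).2 /\ d <= (cb i).2).
- by have [h1 h2] := H jN; split; exact: le_trans dd _.
- have [a0 _] := caP j jN; have [b0 _] := cbP j jN.
  by exists (Num.min (ca j).2 (cb j).2); rewrite ?lt_min ?a0 ?b0 // !ge_min !lexx orbT.
pose d := Num.min d0 1.
have dd i : (i <= N)%N -> d <= (ca i).2 /\ d <= (cb i).2.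
  move=> iN; have [h1 h2] := dP i iN iN.
  have dd0 : d <= d0 by rewrite ge_min lexx.
  by split; exact: le_trans dd0 _.
pose prev j := if j is i.+1 then i else N.
(* The two edges at a tip are both followed away from the wall, one forwards and one backwards, so
   their difference has the sum of the two velocities. The strand before strand 0 is strand [N]. *)
pose sl (W : nat -> R) j := (ca j).1 * (W (t j).+1 - W (t j)) +
  (cb (prev j)).1 * (W (t (prev j).+1) - W (t (prev j).+1).-1).
have after W i x : (i <= N)%N -> strand w i x -> `|x - w i| <= d ->
    lin W (g i x) = W (t i) + `|x - w i| * ((ca i).1 * (W (t i).+1 - W (t i))).
  move=> iN sx xd; have [_ h] := caP i iN.
  have [-> /andP[s0 s1]] := h x sx (le_trans xd (dd i iN).1).
  rewrite (@linE _ W (t i)); first by ring.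
  by rewrite -[(t i).+1%:R]natr1; apply/andP; split; qlra.
have before W i x : (i <= N)%N -> strand w i x -> `|x - w i.+1| <= d ->
    lin W (g i x) = W (t i.+1) - `|x - w i.+1| * ((cb i).1 * (W (t i.+1) - W (t i.+1).-1)).
  move=> iN sx xd; have [_ h] := cbP i iN.
  have [-> /andP[s0 s1]] := h x sx (le_trans xd (dd i iN).2).
  have ti : (0 < t i.+1)%N by apply: leq_trans (tips_lt tp iN).
  rewrite -(prednK ti) /=; move: (t i.+1).-1 => k.
  have k1 : k.+1%:R = k%:R + 1 :> R by rewrite natr1.
  rewrite (@linE _ W k); first by rewrite k1; ring.
  by rewrite k1; apply/andP; split; qlra.
pose F y z := \sum_(j < N.+1) rise X t w j *
  Num.max 0 (1 - Num.max `|y - Y (t j)| `|z - Z (t j)| / r).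
have mE u : moved X Y Z N t w r u = lin X u + F (lin Y u) (lin Z u) by [].
exists (fun q => (q.1.1 + F q.1.2 q.2, q.1.2, q.2)), Yf, Zf, (sl Y), (sl Z), d; split.
- apply: (@iso_mono_x _ (fun q => q.1.1 + F q.1.2 q.2) 1) => // [|x x' y z _]; last by rewrite /=; qlra.
  have cF : continuous (fun q : pt R => F q.1.2 q.2).
    have h := @cts_tents Y Z N.+1 t (rise X t w) r.
    have h2 : continuous (fun q : pt R => (q.1.2, q.2)) by cts.
    exact: (ctscomp h2 h).
  by cts.
- split.
  + by move=> i; exact: (ctscomp (cg i) (@lin_cts R Y)).
  + by move=> i; exact: (ctscomp (cg i) (@lin_cts R Z)).
  + move=> i j x /andP[ij jN] si sj EY EZ; have iN : (i <= N)%N by rewrite ltnW // (leq_trans ij).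
    have [/andP[u0 u1] uE] := gS i x iN si; have [/andP[v0 v1] vE] := gS j x jN sj.
    rewrite /Yf /Zf in EY EZ; move: (g i x) (g j x) u0 u1 uE v0 v1 vE EY EZ => u v u0 u1 uE v0 v1 vE EY EZ.
    have EX : lin X u = lin X v by have := uE; rewrite -vE !mE EY EZ => /addIr.
    have up : 0 <= u := le_trans (ler0n R _) u0. have vp : 0 <= v := le_trans (ler0n R _) v0.
    have tij : (t i.+1)%:R <= (t j)%:R :> R by rewrite ler_nat (tips_le tp) // ij leqW.
    have vM : v <= M%:R by apply: le_trans v1 _; rewrite ler_nat -(tips_last tp) (tips_le tp) // ltnS jN leqnn.
    (* Equal points have parameters that are equal, at the wall shared by consecutive strands, or a
       full period apart, at the closing wall. *)
    have [uv|uv] := ltP `|u - v| M%:R.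
      have uvE := cpoly_inj Pl up vp uv EX EY EZ.
      have tE : t i.+1 = t j by apply/eqP; rewrite -(eqr_nat R); apply/eqP; qlra.
      left; have ijE : j = i.+1.
        apply/eqP; rewrite eqn_leq ij andbT leqNgt; apply/negP => lt.
        have := @tips_ltS _ _ _ _ _ _ _ i.+1 j tp; rewrite lt leqW // tE ltnn => /(_ isT).
        by [].
      split=> //; rewrite -(moved_tip T (leqW jN)) -uE; congr moved.
      by rewrite -tE; qlra.
    have uv' : u <= v by qlra.
    rewrite ler0_norm in uv; last by qlra.
    have u00 : u = 0 by qlra. have vMM : v = M%:R by qlra.
    right; split.
    * apply/eqP; rewrite -leqn0 leqNgt; apply/negP => i0.
      have := @tips_ltS _ _ _ _ _ _ _ 0 i tp; rewrite i0 leqW // (tips_0 tp) => /(_ isT).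
      by rewrite -(ltr_nat R); qlra.
    * apply/eqP; rewrite eqn_leq jN leqNgt; apply/negP => jN'.
      have := @tips_ltS _ _ _ _ _ _ _ j.+1 N.+1 tp; rewrite ltnS jN' leqnn (tips_last tp) => /(_ isT).
      by rewrite -(ltr_nat R); qlra.
    * by rewrite -uE u00 -(moved_tip T (leq0n _)) (tips_0 tp).
  + move=> j x jN sj sj1 xd; rewrite /Yf /Zf.
    by rewrite !(after _ _ _ jN sj1 xd) !(before _ _ _ (ltnW jN) sj xd) /sl /=; split; ring.
  + move=> x s0 sN xd; rewrite /Yf /Zf !(after _ _ _ (leq0n N) s0 xd).
    have wN := tented_close T; rewrite -wN in xd.
    rewrite !(before _ _ _ (leqnn N) sN xd) /sl /= wN (tips_last tp) (tips_0 tp).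
    by have [_ EY EZ] := cpoly_per Pl 0; rewrite add0n in EY EZ; rewrite EY EZ; split; ring.
  + by rewrite lt_min d00 ltr01 ge_min lexx orbT.
- apply/seteqP; split=> [_ [_ [u u0 ->] <-]|_ [i [x [iN sx ->]]]] /=.
    have [v /andP[v0 vM] [-> -> ->]] := cpoly_bounded Pl u0.
    have [|i iN vi] := find_strand tp (u := v); first by rewrite v0 ltW.
    exists i, (moved X Y Z N t w r v); split=> //; first exact: (strand_moved T).
    by rewrite /Yf /Zf gK.
  have [/andP[u0 _] uE] := gS i x iN sx.
  exists (lin X (g i x), lin Y (g i x), lin Z (g i x)).
    by exists (g i x) => //; exact: le_trans (ler0n R _) u0.
  by rewrite /= -mE uE.
Qed.

End Zigzags.

(** * Choice of the walls and normalization of the cones *)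

Section Normalize.
Context {R : realType}.

Record walls (N : nat) (w : nat -> R) : Prop := Walls {
  walls_odd : odd N;
  walls_gap : forall j, (j <= N)%N -> 20 <= (-1) ^+ j * (w j.+1 - w j);
  walls_close : w N.+1 = w 0%N;
  walls_sep : forall i j, (i < j <= N)%N -> 3 <= `|w i - w j|;
  walls_nested : nested N w;
  walls_lt : w 0%N + 1 < w N }.

(** The distances [B j] from 0 exceed the bound [C] of all tips and shrink by 10 from one wall to
    the next, with alternating sides; the constant 10 yields all required gaps generously. As [N] is
    odd, wall [N] is on the right and the last strand can return to [w 0] on the left. *)
Lemma walls_exist N (x : nat -> R) : odd N ->
  exists w, walls N w /\ forall j, (j <= N.+1)%N -> (-1) ^+ j * (w j - x j) < 0.
Proof.
move=> oN; have [C xC] : exists C, forall j, (j <= N.+1)%N -> `|x j| <= C.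
  elim: (N.+1) => [|n [C IH]]; first by exists `|x 0%N| => -[].
  exists (Num.max C `|x n.+1|) => j; rewrite leq_eqVlt le_max => /orP[/eqP->|/IH->//].
  by rewrite lexx orbT.
have C0 : 0 <= C := le_trans (normr_ge0 _) (xC 0%N isT).
pose B j : R := C + 10 * (N.+1 - j)%:R.
pose w j := if j == N.+1 then - B 0%N else - ((-1) ^+ j * B j).
have wE j : (j <= N)%N -> w j = - ((-1) ^+ j * B j).
  by move=> jN; rewrite /w ltn_eqF.
have w0 : w 0%N = - B 0%N by rewrite wE // expr0 mul1r.
have wN : w N.+1 = w 0%N by rewrite w0 /w eqxx.
have ee j : (-1) ^+ j * (-1) ^+ j = 1 :> R by rewrite -expr2 sqrr_sign.
have BS i j : (i < j <= N)%N -> B j + 10 <= B i.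
  move=> /andP[ij jN]; have : (N.+1 - j)%:R + 1 <= (N.+1 - i)%:R :> R by rewrite natr1 ler_nat; lia.
  by rewrite /B; qlra.
have B10 j : (j <= N)%N -> C + 10 <= B j.
  move=> jN; have : 1 <= (N.+1 - j)%:R :> R by rewrite ler1n subn_gt0 ltnS.
  by rewrite /B; qlra.
have sw j : (j <= N)%N -> (-1) ^+ j * w j = - B j.
  by move=> jN; rewrite wE // mulrN mulrA ee mul1r.
have swS j : (j < N)%N -> (-1) ^+ j * w j.+1 = B j.+1.
  by move=> jN; rewrite wE // exprS mulN1r mulNr opprK mulrA ee mul1r.
have sN : (-1) ^+ N = -1 :> R by rewrite -signr_odd oN expr1.
have swN : (-1) ^+ N * w N.+1 = B 0%N by rewrite wN w0 sN mulrN mulN1r opprK.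
have gap j : (j <= N)%N -> 20 <= (-1) ^+ j * (w j.+1 - w j).
  move=> jN; rewrite mulrBr sw //; have := B10 j jN; move: jN.
  rewrite leq_eqVlt => /orP[/eqP->|jN].
    by rewrite swN; have := B10 0%N isT; qlra.
  by rewrite swS //; have := B10 j.+1 jN; qlra.
have nw j : (j <= N)%N -> `|w j| = B j.
  move=> jN; rewrite wE // normrN normrM normrX normrN1 expr1n mul1r ger0_norm //.
  by have := B10 j jN; qlra.
have str i y : (i <= N)%N -> strand w i y = ((-1) ^+ i * w i <= (-1) ^+ i * y <= (-1) ^+ i * w i.+1).
  by move=> iN; apply: strand_sign; have := gap i iN; qlra.
exists w; split; first split=> //.
- move=> i j ijN; have := BS _ _ ijN; have /andP[ij jN] := ijN.
  have := lerB_dist (w i) (w j); rewrite !nw //; first by qlra.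
  by lia.
- move=> i k y ikN sy; have iN : (i <= N)%N by lia. have kN : (k <= N)%N by lia.
  have yB : `|y| <= B k.
    move: sy; rewrite str // sw // swS; last by lia.
    have hB : B k.+1 + 10 <= B k by apply: BS; lia.
    rewrite ler_norml; case: (@alternateP R k) => ->; rewrite ?mul1r ?mulN1r => /andP[? ?];
      by apply/andP; split; qlra.
  have yi : `|y| <= B i.+1.
    apply: le_trans yB _; have [->//|ik] := eqVneq i.+1 k.
    have hB : B k + 10 <= B i.+1 by apply: BS; lia.
    by qlra.
  have Bi : B i.+1 + 10 <= B i by apply: BS; lia.
  split.
    rewrite str // sw // swS; last by lia.
    move: yi; rewrite ler_norml; case: (@alternateP R i) => ->; rewrite ?mul1r ?mulN1r => /andP[? ?];
      by apply/andP; split; qlra.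
  have := lerB_dist (w i) y; rewrite nw // distrC; qlra.
- have := sw N (leqnn N); rewrite sN mulN1r => h; rewrite w0.
  by have := B10 0%N isT; have := B10 N (leqnn N); qlra.
- move=> j; rewrite leq_eqVlt => /orP[/eqP->|jN].
    have := xC N.+1 (leqnn _); rewrite exprS sN mulrNN mulr1 mul1r wN w0 ler_norml.
    by have := B10 0%N isT => ? /andP[? ?]; qlra.
  have jN' : (j <= N)%N by [].
  rewrite mulrBr sw //; have := B10 j jN'; have := xC j (leqW jN'); rewrite ler_norml.
  by case: (@alternateP R j) => ->; rewrite ?mul1r ?mulN1r => /andP[? ?] ?; qlra.
Qed.

(** The correction at a wall acts within distance 2 of it, and walls are at least 3 apart, so it
    spares the unit neighbourhoods already treated. *)
Lemma plateaus N (w : nat -> R) (c : nat -> R) : walls N w ->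
  exists k : R -> R, continuous k /\ forall j (x : R), (j <= N)%N -> `|x - w j| <= 1 -> k x = c j.
Proof.
move=> W; have : forall n, (n <= N)%N -> exists k : R -> R, continuous k /\
    forall j (x : R), (j <= n)%N -> `|x - w j| <= 1 -> k x = c j.
  elim=> [|n IH] nN; first by exists (fun=> c 0%N); split=> [|[]//]; exact: ctsC.
  have [k [ck kP]] := IH (ltnW nN).
  have ct : continuous (trap 1 2 : R -> R) by apply: cts_trap; cts.
  exists (fun x => k x + (c n.+1 - k x) * trap 1 2 `|x - w n.+1|); split; first by cts.
  move=> j x; rewrite leq_eqVlt => /orP[/eqP->|jn] xw.
    by rewrite trap1 ?ltr1n // mulr1 subrKC.
  rewrite trap0 ?ltr1n ?mulr0 ?addr0 //; first exact: kP.
  have jN : (j < n.+1 <= N)%N by rewrite jn nN.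
  have h1 := walls_sep W jN; have h2 := ler_distD x (w j) (w n.+1).
  by rewrite [`|w j - x|]distrC in h2; qlra.
by apply.
Qed.

Lemma zigzag_shear_z N w Y Z (D E c : nat -> R) (d : R) : walls N w ->
  zigzag N w Y Z D E d -> exists (P : pt R -> pt R) Z',
  [/\ iso P, zigzag N w Y Z' D (fun j => E j + c j * D j) d
  & P @` zset N w Y Z = zset N w Y Z'].
Proof.
move=> W z; have [k [ck kP]] := plateaus c W; have /andP[d0 d1] := zz_d z.
have kd j x : (j <= N)%N -> `|x - w j| <= d -> k x = c j.
  by move=> jN xd; apply: kP => //; exact: le_trans d1.
pose P (q : pt R) : pt R := (q.1.1, q.1.2, q.2 + k q.1.1 * q.1.2).
have iP : iso P.
  apply: (@iso_mono_z _ (fun q => q.2 + k q.1.1 * q.1.2) 1) => // [|x y z1 z2 _]; last by rewrite /=; qlra.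
  by cts.
exists P, (fun i x => Z i x + k x * Y i x); split=> //; first split.
- exact: (zz_ctsY z).
- move=> i; have cY0 : forall i, continuous (Y i) := zz_ctsY z.
  have cZ0 : forall i, continuous (Z i) := zz_ctsZ z.
  by have := cY0 i; have := cZ0 i => ? ?; cts.
- move=> i j x ij si sj EY EZ; apply: (zz_disj z ij si sj EY).
  by rewrite EY in EZ; apply: addIr EZ.
- move=> j x jN sj sj1 xd; have [-> ->] := zz_cone z jN sj sj1 xd.
  by rewrite (kd j.+1) //; split=> //; ring.
- move=> x s0 sN xd; have [-> ->] := zz_cone0 z s0 sN xd.
  by rewrite (kd 0%N) //; split=> //; ring.
- exact: (zz_d z).
- apply/seteqP; split=> [_ [_ [i [x [iN sx ->]]] <-]|_ [i [x [iN sx ->]]]].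
    by exists i, x.
  by exists (x, Y i x, Z i x); [exists i, x|].
Qed.

Lemma zset_swap N w (Y Z : nat -> R -> R) : swap_yz @` zset N w Y Z = zset N w Z Y.
Proof.
apply/seteqP; split=> [_ [_ [i [x [iN sx ->]]] <-]|_ [i [x [iN sx ->]]]].
  by exists i, x.
by exists (x, Y i x, Z i x); [exists i, x|].
Qed.

Lemma zigzag_swap N w Y Z (D E : nat -> R) (d : R) :
  zigzag N w Y Z D E d -> zigzag N w Z Y E D d.
Proof.
move=> z; split; [exact: (zz_ctsZ z)|exact: (zz_ctsY z)| | | |exact: (zz_d z)].
- by move=> i j x ij si sj EZ EY; exact: (zz_disj z ij si sj EY EZ).
- by move=> j x jN sj sj1 xd; have [] := zz_cone z jN sj sj1 xd.
- by move=> x s0 sN xd; have [] := zz_cone0 z s0 sN xd.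
Qed.

Lemma zigzag_shear_y N w Y Z (D E c : nat -> R) (d : R) : walls N w ->
  zigzag N w Y Z D E d -> exists (P : pt R -> pt R) Y',
  [/\ iso P, zigzag N w Y' Z (fun j => D j + c j * E j) E d
  & P @` zset N w Y Z = zset N w Y' Z].
Proof.
move=> W /zigzag_swap z; have [P [Y' [iP z' PE]]] := zigzag_shear_z c W z.
exists (fun q => swap_yz (P (swap_yz q))), Y'; split; first exact: iso_swap_yz.
  exact: zigzag_swap.
by rewrite -[RHS](zset_swap N w Z) -PE -(zset_swap N w Y Z) !image_comp.
Qed.

(** If both components vanished, the two strands would coincide at distance [d] from their common
    wall, against disjointness. *)
Lemma zigzag_nonzero N w Y Z (D E : nat -> R) (d : R) j : walls N w ->
  zigzag N w Y Z D E d -> (j <= N)%N -> E j = 0 -> D j != 0.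
Proof.
move=> W z jN Ej; apply/eqP => Dj; have /andP[d0 d1] := zz_d z.
have str i y : (i <= N)%N -> strand w i y = ((-1) ^+ i * w i <= (-1) ^+ i * y <= (-1) ^+ i * w i.+1).
  by move=> iN; apply: strand_sign; have := walls_gap W iN; qlra.
case: j jN Ej Dj => [_|j jN] Ej Dj.
  have N0 := odd_gt0 (walls_odd W); have lt := walls_lt W.
  have g0 := walls_gap W (leq0n N); rewrite expr0 mul1r in g0.
  have s0 : strand w 0 (w 0%N + d) by rewrite str // expr0 !mul1r; apply/andP; split; qlra.
  have sN : strand w N (w 0%N + d).
    by rewrite str // -signr_odd (walls_odd W) (walls_close W) expr1 !mulN1r; apply/andP; split; qlra.
  have xd : `|w 0%N + d - w 0%N| <= d by rewrite addrAC subrr add0r gtr0_norm.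
  have [EY EZ] := zz_cone0 z s0 sN xd; rewrite Ej Dj !mulr0 !addr0 in EY EZ.
  have ij : (0 < N <= N)%N by rewrite N0 leqnn.
  by have [[_ xE]|[_ _ xE]] := zz_disj z ij s0 sN EY EZ; qlra.
have g1 := walls_gap W (ltnW jN); have g2 := walls_gap W jN.
rewrite exprS mulN1r in g2; set e := (-1) ^+ j in g1 g2.
have ee : e * e = 1 by rewrite /e -expr2 sqrr_sign.
have eE x : e * (w j.+1 - e * x) = e * w j.+1 - x by rewrite mulrBr mulrA ee mul1r.
have sj : strand w j (w j.+1 - e * d).
  by rewrite str ?(ltnW jN) // -/e eE; apply/andP; split; qlra.
have sj1 : strand w j.+1 (w j.+1 - e * d).
  by rewrite str // exprS mulN1r -/e !mulNr eE; apply/andP; split; qlra.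
have ne : `|e| = 1 by rewrite /e normrX normrN1 expr1n.
have xd : `|w j.+1 - e * d - w j.+1| <= d.
  by rewrite addrAC subrr add0r normrN normrM ne mul1r gtr0_norm.
have [EY EZ] := zz_cone z jN sj sj1 xd; rewrite Ej Dj !mulr0 !addr0 in EY EZ.
have ij : (j < j.+1 <= N)%N by rewrite ltnSn.
have ed : e * d != 0 by apply: mulf_neq0; [rewrite -normr_eq0 ne oner_eq0|rewrite gt_eqF].
have [[_ xE]|[j0 _ xE]] := zz_disj z ij sj sj1 (esym EY) (esym EZ).
  by move/eqP: ed; apply; qlra.
have wj : w j = w j.+1 - e * d by rewrite [in LHS]j0 -xE.
have dE : e * (w j.+1 - w j) = d by rewrite wj opprB addrCA subrr addr0 mulrA ee mul1r.
by qlra.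
Qed.

(** Shears with coefficients depending on x turn every direction [(D, E)] into [(1, 0)]. Three are
    needed: z is sheared to make [E] nonzero, y to make [D] equal to 1 with the help of [E], and z
    again to clear [E]. *)
Lemma zigzag_combed N w Y Z (D E : nat -> R) (d : R) : walls N w ->
  zigzag N w Y Z D E d -> exists (P : pt R -> pt R) Y' Z',
  [/\ iso P, combed N w 1 Y' Z' (fun=> 0) d & P @` zset N w Y Z = zset N w Y' Z'].
Proof.
move=> W z0.
have [P1 [Z1 [i1 z1 E1]]] := zigzag_shear_z (fun j => if E j == 0 then 1 else 0) W z0.
move: z1; set E' := fun j => _ => z1.
have nz j : (j <= N)%N -> E' j != 0.
  move=> jN; rewrite /E'; case: (eqVneq (E j) 0) => [Ej|Ej].
    by rewrite Ej add0r mul1r; exact: (zigzag_nonzero W z0 jN).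
  by rewrite mul0r addr0.
have [P2 [Y2 [i2 z2 E2]]] := zigzag_shear_y (fun j => (1 - D j) / E' j) W z1.
have [P3 [Z3 [i3 z3 E3]]] := zigzag_shear_z (fun j => - E' j) W z2.
have cY0 : forall i, continuous (Y2 i) := zz_ctsY z3.
have cZ0 : forall i, continuous (Z3 i) := zz_ctsZ z3.
(* Subtracting the course of strand 0 from every strand makes strand 0 straight and leaves all
   differences between strands unchanged; the clamp keeps the subtraction constant beyond its
   walls. *)
pose cl := @clamp R (w 0%N) (w 1%N).
have cc : continuous cl by apply: cts_clamp; cts.
have cy : continuous (fun x => Y2 0%N (cl x)) := ctscomp cc (cY0 0%N).
have cz : continuous (fun x => Z3 0%N (cl x)) := ctscomp cc (cZ0 0%N).
pose P4 (q : pt R) : pt R := (q.1.1, q.1.2 - Y2 0%N (cl q.1.1), q.2 - Z3 0%N (cl q.1.1)).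
have i4 : iso P4.
  have j1 : iso (fun q : pt R => (q.1.1, q.1.2 - Y2 0%N (cl q.1.1), q.2)).
    apply: (@iso_mono _ (fun q => q.1.2 - Y2 0%N (cl q.1.1)) 1) => // [|x y y' z _]; last by rewrite /=; qlra.
    by move: cy; move: (fun x => _) => f cf; cts.
  have j2 : iso (fun q : pt R => (q.1.1, q.1.2, q.2 - Z3 0%N (cl q.1.1))).
    apply: (@iso_mono_z _ (fun q => q.2 - Z3 0%N (cl q.1.1)) 1) => // [|x y z z' _]; last by rewrite /=; qlra.
    by move: cz; move: (fun x => _) => f cf; cts.
  exact: (iso_comp j1 j2).
have D1 j : (j <= N)%N -> D j + (1 - D j) / E' j * E' j = 1.
  by move=> jN; rewrite divfK ?nz // subrKC.
have E0 j : (j <= N)%N -> E' j + - E' j * (D j + (1 - D j) / E' j * E' j) = 0.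
  by move=> jN; rewrite D1 // mulr1 subrr.
exists (fun q => P4 (P3 (P2 (P1 q)))), (fun i x => Y2 i x - Y2 0%N (cl x)), (fun i x => Z3 i x - Z3 0%N (cl x)); split.
- exact: (iso_comp i4 (iso_comp i3 (iso_comp i2 i1))).
- split.
  + by move=> i; have := cY0 i => ?; apply: ctsD => //; apply: ctsN.
  + by move=> i; have := cZ0 i => ?; apply: ctsD => //; apply: ctsN.
  + move=> i j x ij si sj EY EZ.
    by apply: (zz_disj z3 ij si sj); [exact: addIr EY|exact: addIr EZ].
  + move=> _ x s0; have g := walls_gap W (leq0n N); rewrite expr0 mul1r in g.
    have xI : w 0%N <= x <= w 1%N.
      by move: s0; rewrite strand_sign expr0 !mul1r //; qlra.
    by rewrite /cl clamp_id // !subrr.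
  + by [].
  + by [].
  + move=> j x /andP[_ jN] sj1 xd; have /andP[_ d1] := zz_d z3.
    have g1 := walls_gap W (ltnW jN); have g2 := walls_gap W jN.
    have sj : strand w j x.
      move: sj1; rewrite !strand_sign ?exprS ?mulN1r; [|by qlra|by rewrite exprS mulN1r in g2; qlra].
      rewrite exprS mulN1r in g2.
      have h : `|(-1) ^+ j * (x - w j.+1)| <= 1.
        by rewrite normrM normrX normrN1 expr1n mul1r; exact: le_trans d1.
      move: h; rewrite ler_norml => /andP[h1 h2] /andP[h3 h4].
      by apply/andP; split; qlra.
    have [-> ->] := zz_cone z3 jN sj sj1 xd; rewrite E0 // D1 // mulr1 mulr0 addr0.
    by split=> //; ring.
  + move=> x s0 sN xd; have [-> ->] := zz_cone0 z3 s0 sN xd.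
    by rewrite E0 // D1 // mulr1 mulr0 addr0; split=> //; ring.
  + exact: (zz_d z3).
- have PE : P4 @` zset N w Y2 Z3 = zset N w (fun i x => Y2 i x - Y2 0%N (cl x)) (fun i x => Z3 i x - Z3 0%N (cl x)).
    apply/seteqP; split=> [_ [_ [i [x [iN sx ->]]] <-]|_ [i [x [iN sx ->]]]].
      by exists i, x.
    by exists (x, Y2 i x, Z3 i x); [exists i, x|].
  rewrite -PE -E3 -E2 -E1; apply/seteqP; split=> [_ [q qz <-]|_ [_ [_ [_ [q qz <-] <-] <-] <-]].
    by exists (P3 (P2 (P1 q))) => //; exists (P2 (P1 q)) => //; exists (P1 q) => //; exists q.
  by exists q.
Qed.

End Normalize.

Theorem theorem1p1 (R : realType) (K : set (R * R * R)) :
  simple_closed_curve K -> tame K ->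
  exists n : nat, (1 <= n)%N /\ carries (potholder n) K.
Proof.
move=> _ [L [Lp KL]].
have [M [X [Y [Z [Pl LE]]]]] := polygonal_poly Lp.
have [P1 [X1 [Y1 [Z1 [i1 Pl1 E1 st1 ne1]]]]] := generic_position Pl.
have [X2 [Y2 [Z2 [N [t [tp E2]]]]]] := get_tips Pl1 st1 ne1.
have [r r0 rP] := tip_radius (tips_poly tp) (tips_star tp).
have [w [W wX]] := walls_exist (fun j => X2 (t j)) (tips_odd tp).
have T : tented M X2 Y2 Z2 N t w r by split=> //; exact: walls_close W.
have [P3 [Y3 [Z3 [D [E [d [i3 z3 E3]]]]]]] := tented_zigzag T.
have [P4 [Y4 [Z4 [i4 C4 E4]]]] := zigzag_combed W z3.
have N0 := odd_gt0 (walls_odd W).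
have [|P5 [Y5 [Z5 [b5 [d5 [i5 C5 E5]]]]]] := comb_all (walls_nested W) _ N0 C4.
  move=> k /andP[_ kN]; have := walls_gap W (ltnW kN); case: (@alternateP R k) => ->; rewrite ?mul1r ?mulN1r.
    by move=> h; apply: lt_le_trans (ler_norm _); qlra.
  by move=> h; rewrite distrC; apply: lt_le_trans (ler_norm _); qlra.
have NE : N = N.-1.+1 by rewrite prednK.
have F : final N.-1 w Y5 Z5 b5 d5.
  split; rewrite -?NE //.
  - by move=> j jN; have jN' : (j <= N)%N; [lia|have := walls_gap W jN'; qlra].
  - by have := walls_odd W; rewrite {1}NE.
  - exact: walls_close W.
  - exact: walls_lt W.
have [P6 [a [c [h [A0 [A1 [B0 [B1 [d6 [i6 C6 E6]]]]]]]]]] := final_crossing F.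
have [n [n1 [P7 [over [h' [i7 rz E7]]]]]] := potholder_carries C6.
exists n; split=> //; exists over, h'; split=> //.
have -> : Defs.lift (potholder n) h' =
    (fun q => P7 (P6 (P5 (P4 (P3 (P1 q)))))) @` L.
  rewrite -E7 -E6 -NE -E5 -E4 -E3 E2 -E1 LE.
  apply/seteqP; split=> [_ [_ [_ [_ [_ [_ [q qL <-] <-] <-] <-] <-] <-]|_ [q qL <-]]; first by exists q.
  exists (P6 (P5 (P4 (P3 (P1 q))))) => //; exists (P5 (P4 (P3 (P1 q)))) => //.
  by exists (P4 (P3 (P1 q))) => //; exists (P3 (P1 q)) => //; exists (P1 q) => //; exists q.
apply: amb_iso KL _.
exact: (iso_comp i7 (iso_comp i6 (iso_comp i5 (iso_comp i4 (iso_comp i3 i1))))).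
Qed.
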